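(* Suppose that functions $a,b,c\in UC_b(\mathbb{R})$ are bounded with their derivatives up to order 3, and that there exists a constant $a_0>0$ such that $\inf_{x\in\mathbb{R}}a(x)\geq a_0>0$. For each function $\phi\in C_b^\infty(\mathbb{R})=D(A)$ define $A\phi = a\phi'' + b\phi' + c\phi$. For each $t\geq0$, each $x\in\mathbb{R}$ and each $f\in UC_b(\mathbb{R})$ define $$ (S(t)f)(x) = \frac14 f\Big(x+2\sqrt{a(x)t}\Big) + \frac14 f\Big(x-2\sqrt{a(x)t}\Big) + \frac12 f\big(x+2b(x)t\big) + tc(x)f(x). $$ Assume also that $\lambda\in\mathbb{R}$ and $\lambda>\sup_{x\in\mathbb{R}}|c(x)|=\|c\|$. Then: 1. The closure $\overline{A}$ of the operator $A$ generates a $C_0$-semigroup in $UC_b(\mathbb{R})$. 2. For each $g\in UC_b(\mathbb{R})$ the solution $f\colon\mathbb{R}\to\mathbb{R}$ of the equation $$ a(x)f''(x)+b(x)f'(x)+(c(x)-\lambda)f(x)=-g(x)\quad\text{for all }x\in\mathbb{R} $$ exists, is unique in $UC_b(\mathbb{R})$ and is given for all $x\in\mathbb{R}$ by the formula $$ f(x)=\int_0^\infty e^{-\lambda t}\left(e^{t\overline{A}}g\right)(x)dt=\lim_{n\to\infty}\int_0^\infty e^{-\lambda t}\left((S(t/n))^ng\right)(x)dt, $$ where $S(t/n)$ is obtained by substituting $t/n$ for $t$ in the definition of $S(t)$, and $(S(t/n))^n$ is the composition of $n$ copies of the linear bounded operator $S(t/n)$. Suppose additionally that the function $g$ is bounded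 with derivatives up to order 5. Then (with $f$ the solution from item 2): 3. There exist nonnegative constants $C_0,C_1,\ldots,C_4$ such that for all $t>0$ and all $n\in\mathbb{N}$ the following inequality holds: $$\| S(t/n)^n g - e^{t\overline{A}}g \| \leq \frac{t^2e^{\|c\|t}}{n}\big(C_0\|g\|+C_1\|g'\|+C_2\|g''\|+C_3\|g'''\|+C_4\|g^{(IV)}\|\big).$$ 4. The error bound in the formula of item 2 is given, for all $n\in\mathbb{N}$, by the inequality $$ \sup_{x\in\mathbb{R}}\left|f(x)-\int_0^\infty e^{-\lambda t}\left((S(t/n))^ng\right)(x)dt\right|\leq\frac{2C_g}{n\cdot (\lambda-\|c\|)^3}, $$ where $C_g=C_0\|g\|+C_1\|g'\|+C_2\|g''\|+C_3\|g'''\|+C_4\|g^{(IV)}\|$. 5. The integral in item 2 can be calculated over $[0,T]$ instead of $[0,\infty)$ with a controlled level of error: for each $\varepsilon>0$ there exists $T=\max\left(0,\frac{1}{\lambda-\|c\|}\ln\frac{2}{(\lambda-\|c\|)\varepsilon}\right)$ such that for all $n\in\mathbb{N}$ we have $$ \sup_{x\in\mathbb{R}}\left|f(x)-\int_0^T e^{-\lambda t}\left((S(t/n))^ng\right)(x)dt\right|\leq\frac{2C_g}{n\cdot (\lambda-\|c\|)^3}+\varepsilon. $$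
   Context: $UC_b(\mathbb{R})$ is the Banach space of all bounded and uniformly continuous functions $f\colon\mathbb{R}\to\mathbb{R}$ with the uniform norm $\|f\|=\sup_{x\in\mathbb{R}}|f(x)|$. $C_b^\infty(\mathbb{R})$ is the subspace of $UC_b(\mathbb{R})$ consisting of all infinitely differentiable functions that are bounded and have bounded derivatives of all orders. A $C_0$-semigroup on a Banach space is a family $(V(t))_{t\ge0}$ of bounded linear operators with $V(0)=I$, $V(t+s)=V(t)V(s)$ for all $t,s\ge0$, and $t\mapsto V(t)\varphi$ continuous on $[0,+\infty)$ for each vector $\varphi$; its generator is $L\varphi=\lim_{t\to+0}(V(t)\varphi-\varphi)/t$ on the domain of all $\varphi$ for which the limit exists, and one writes $V(t)=e^{tL}$. Thus $(e^{t\overline{A}})_{t\ge0}$ denotes the semigroup generated by $\overline{A}$.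
   Formalization: In item 5 the truncation time uses max(2,‖g‖) in place of 2 inside the logarithm; the printed T fails when ‖g‖>2 (a=1, b=c=0, λ=1, g=3 gives error 3ε/2 for all n when ε<2), and the two agree when ‖g‖≤2. *)

(* Defs.v *)
From Stdlib Require Import Reals Lra Lia ClassicalEpsilon.
From Stdlib Require Import FunctionalExtensionality ProofIrrelevance.
From Coquelicot Require Import Coquelicot.
Open Scope R_scope.

Definition bounded_fun (f : R -> R) : Prop :=
  exists M : R, forall x : R, Rabs (f x) <= M.

(* [sup_abs f] is [p_infty] when [f] is unbounded; [sup_norm f] is then [0],
   so [sup_norm] is only meaningful on bounded functions. *)
Definition sup_abs (f : R -> R) : Rbar :=
  Lub_Rbar (fun y => exists x : R, y = Rabs (f x)).

Definition sup_norm (f : R -> R) : R := real (sup_abs f).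

Definition inf_fun (f : R -> R) : Rbar :=
  Glb_Rbar (fun y => exists x : R, y = f x).

(* Differentiability at every order up to [n] is required explicitly:
   [Derive_n] is total, so [ex_derive_n f n x] alone says nothing about the
   lower orders. *)
Definition bounded_derivs (n : nat) (f : R -> R) : Prop :=
  forall k : nat, (k <= n)%nat ->
    (forall x : R, ex_derive_n f k x) /\ bounded_fun (Derive_n f k).

Definition Cb_infty (f : R -> R) : Prop := forall n : nat, bounded_derivs n f.

Lemma sup_abs_bounded (f : R -> R) :
  bounded_fun f -> sup_abs f = Finite (sup_norm f).
Proof.
intros [M HM]; unfold sup_norm, sup_abs.
destruct (Lub_Rbar_correct (fun y => exists x : R, y = Rabs (f x)))
  as [Hub Hlub].
destruct (Lub_Rbar (fun y => exists x : R, y = Rabs (f x))) as [r| |];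
  [reflexivity| |].
- exfalso; apply (Hlub (Finite M)).
  intros y [x ->]; apply HM.
- exfalso; apply (Hub (Rabs (f 0))); now exists 0.
Qed.

Lemma sup_norm_ge (f : R -> R) (x : R) :
  bounded_fun f -> Rabs (f x) <= sup_norm f.
Proof.
intros Hf.
destruct (Lub_Rbar_correct (fun y => exists x : R, y = Rabs (f x)))
  as [Hub _].
assert (H := Hub (Rabs (f x)) (ex_intro _ x eq_refl)).
fold (sup_abs f) in H; rewrite (sup_abs_bounded f Hf) in H; exact H.
Qed.

Lemma sup_norm_le (f : R -> R) (M : R) :
  (forall x, Rabs (f x) <= M) -> sup_norm f <= M.
Proof.
intros HM.
destruct (Lub_Rbar_correct (fun y => exists x : R, y = Rabs (f x)))
  as [_ Hlub].
assert (Hf : bounded_fun f) by now exists M.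
assert (H : Rbar_le (sup_abs f) (Finite M)).
{ apply Hlub; intros y [x ->]; apply HM. }
rewrite (sup_abs_bounded f Hf) in H; exact H.
Qed.

Lemma sup_norm_pos (f : R -> R) : bounded_fun f -> 0 <= sup_norm f.
Proof.
intros Hf; apply Rle_trans with (1 := Rabs_pos (f 0)); now apply sup_norm_ge.
Qed.

Definition in_UCb (f : R -> R) : Prop :=
  bounded_fun f /\ uniform_continuity f (fun _ => True).

Record UCb := mkUCb { UCb_fun :> R -> R; UCb_prop : in_UCb UCb_fun }.

Lemma UCb_eq (f g : UCb) : (forall x, f x = g x) -> f = g.
Proof.
destruct f as [f Hf], g as [g Hg]; simpl; intros H.
assert (E : f = g) by now apply functional_extensionality.
subst g; f_equal; apply proof_irrelevance.
Qed.

Lemma in_UCb_const (k : R) : in_UCb (fun _ => k).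
Proof.
split.
- exists (Rabs k); intros _; lra.
- intros eps; exists (mkposreal 1 Rlt_0_1); intros x y _ _ _.
  rewrite Rminus_diag, Rabs_R0; apply cond_pos.
Qed.

Lemma in_UCb_plus (f g : R -> R) :
  in_UCb f -> in_UCb g -> in_UCb (fun x => f x + g x).
Proof.
intros [[M HM] Uf] [[N HN] Ug]; split.
- exists (M + N); intros x.
  apply Rle_trans with (1 := Rabs_triang _ _).
  specialize (HM x); specialize (HN x); lra.
- intros eps.
  destruct (Uf (pos_div_2 eps)) as [d1 H1], (Ug (pos_div_2 eps)) as [d2 H2].
  assert (Hd : 0 < Rmin d1 d2) by (apply Rmin_pos; apply cond_pos).
  exists (mkposreal _ Hd); simpl; intros x y _ _ Hxy.
  assert (L1 := Rmin_l d1 d2); assert (L2 := Rmin_r d1 d2).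
  specialize (H1 x y I I ltac:(lra)); specialize (H2 x y I I ltac:(lra)).
  simpl in H1, H2.
  replace (f x + g x - (f y + g y)) with ((f x - f y) + (g x - g y)) by ring.
  apply Rle_lt_trans with (1 := Rabs_triang _ _); lra.
Qed.

Lemma in_UCb_mult (f g : R -> R) :
  in_UCb f -> in_UCb g -> in_UCb (fun x => f x * g x).
Proof.
intros [[M HM] Uf] [[N HN] Ug].
assert (M0 : 0 <= M) by (specialize (HM 0); assert (K := Rabs_pos (f 0)); lra).
assert (N0 : 0 <= N) by (specialize (HN 0); assert (K := Rabs_pos (g 0)); lra).
split.
- exists (M * N); intros x; rewrite Rabs_mult.
  apply Rmult_le_compat; auto using Rabs_pos.
- intros eps.
  assert (He : 0 < eps / (M + N + 1)).
  { apply Rdiv_lt_0_compat; [apply cond_pos | lra]. }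
  destruct (Uf (mkposreal _ He)) as [d1 H1], (Ug (mkposreal _ He)) as [d2 H2].
  assert (Hd : 0 < Rmin d1 d2) by (apply Rmin_pos; apply cond_pos).
  exists (mkposreal _ Hd); simpl; intros x y _ _ Hxy.
  assert (L1 := Rmin_l d1 d2); assert (L2 := Rmin_r d1 d2).
  specialize (H1 x y I I ltac:(lra)); specialize (H2 x y I I ltac:(lra)).
  simpl in H1, H2; set (e := eps / (M + N + 1)) in *.
  replace (f x * g x - f y * g y)
    with (f x * (g x - g y) + (f x - f y) * g y) by ring.
  apply Rle_lt_trans with (1 := Rabs_triang _ _).
  rewrite !Rabs_mult.
  assert (E : (M + N + 1) * e = eps) by (unfold e; field; lra).
  assert (K1 : Rabs (f x) * Rabs (g x - g y) <= M * e).
  { apply Rmult_le_compat; auto using Rabs_pos; lra. }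
  assert (K2 : Rabs (f x - f y) * Rabs (g y) <= e * N).
  { apply Rmult_le_compat; auto using Rabs_pos; lra. }
  nra.
Qed.

Lemma in_UCb_scal (k : R) (f : R -> R) :
  in_UCb f -> in_UCb (fun x => k * f x).
Proof. intros Hf; now apply (in_UCb_mult (fun _ => k)); [apply in_UCb_const|]. Qed.

Lemma in_UCb_opp (f : R -> R) : in_UCb f -> in_UCb (fun x => - f x).
Proof.
intros Hf; replace (fun x => - f x) with (fun x => -1 * f x).
- now apply in_UCb_scal.
- apply functional_extensionality; intros x; ring.
Qed.

Lemma in_UCb_shift (f h : R -> R) :
  in_UCb f -> in_UCb h -> in_UCb (fun x => f (x + h x)).
Proof.
intros [[M HM] Uf] [_ Uh]; split.
- exists M; intros x; apply HM.
- intros eps; destruct (Uf eps) as [d Hd].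
  destruct (Uh (pos_div_2 d)) as [d1 Hd1].
  assert (Hp : 0 < Rmin (d / 2) d1).
  { apply Rmin_pos; [assert (K := cond_pos d); lra | apply cond_pos]. }
  exists (mkposreal _ Hp); simpl; intros x y _ _ Hxy.
  assert (L1 := Rmin_l (d / 2) d1); assert (L2 := Rmin_r (d / 2) d1).
  specialize (Hd1 x y I I ltac:(lra)); simpl in Hd1.
  apply Hd; auto.
  replace (x + h x - (y + h y)) with ((x - y) + (h x - h y)) by ring.
  apply Rle_lt_trans with (1 := Rabs_triang _ _); lra.
Qed.

Lemma sqrt_incr_le (u v : R) : v <= u -> sqrt u - sqrt v <= sqrt (u - v).
Proof.
intros Huv; destruct (Rle_lt_dec v 0) as [Hv|Hv].
- rewrite (sqrt_neg_0 v Hv), Rminus_0_r; apply sqrt_le_1_alt; lra.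
- assert (A := sqrt_sqrt u ltac:(lra)); assert (B := sqrt_sqrt v ltac:(lra)).
  assert (C := sqrt_sqrt (u - v) ltac:(lra)).
  assert (A0 := sqrt_pos u); assert (B0 := sqrt_pos v).
  assert (C0 := sqrt_pos (u - v)).
  nra.
Qed.

Lemma in_UCb_sqrt (f : R -> R) : in_UCb f -> in_UCb (fun x => sqrt (f x)).
Proof.
intros [[M HM] Uf]; split.
- exists (sqrt M); intros x.
  rewrite Rabs_pos_eq by apply sqrt_pos.
  apply sqrt_le_1_alt; apply Rle_trans with (1 := Rle_abs _); apply HM.
- intros eps.
  assert (He : 0 < eps * eps) by (assert (K := cond_pos eps); nra).
  destruct (Uf (mkposreal _ He)) as [d Hd]; exists d; intros x y _ _ Hxy.
  specialize (Hd x y I I Hxy); simpl in Hd.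
  apply Rle_lt_trans with (sqrt (Rabs (f x - f y))).
  + assert (M1 := fun u v (H : v <= u) => sqrt_le_1_alt v u H).
    destruct (Rle_lt_dec (f y) (f x)) as [H|H].
    * rewrite (Rabs_pos_eq (f x - f y)) by lra.
      rewrite Rabs_pos_eq by (specialize (M1 _ _ H); lra).
      now apply sqrt_incr_le.
    * apply Rlt_le in H.
      rewrite (Rabs_minus_sym (f x)), (Rabs_minus_sym (sqrt (f x))).
      rewrite (Rabs_pos_eq (f y - f x)) by lra.
      rewrite Rabs_pos_eq by (specialize (M1 _ _ H); lra).
      now apply sqrt_incr_le.
  + rewrite <- (sqrt_square eps) by (apply Rlt_le, cond_pos).
    apply sqrt_lt_1_alt; split; [apply Rabs_pos | exact Hd].
Qed.

Definition UCb_zero : UCb := mkUCb _ (in_UCb_const 0).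
Definition UCb_plus (f g : UCb) : UCb :=
  mkUCb _ (in_UCb_plus f g (UCb_prop f) (UCb_prop g)).
Definition UCb_opp (f : UCb) : UCb := mkUCb _ (in_UCb_opp f (UCb_prop f)).
Definition UCb_scal (k : R) (f : UCb) : UCb :=
  mkUCb _ (in_UCb_scal k f (UCb_prop f)).
Definition UCb_norm (f : UCb) : R := sup_norm f.

Lemma UCb_norm_ge (f : UCb) (x : R) : Rabs (f x) <= UCb_norm f.
Proof. apply sup_norm_ge, (UCb_prop f). Qed.

Lemma UCb_plus_comm (f g : UCb) : UCb_plus f g = UCb_plus g f.
Proof. apply UCb_eq; intros x; simpl; ring. Qed.
Lemma UCb_plus_assoc (f g h : UCb) :
  UCb_plus f (UCb_plus g h) = UCb_plus (UCb_plus f g) h.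
Proof. apply UCb_eq; intros x; simpl; ring. Qed.
Lemma UCb_plus_zero_r (f : UCb) : UCb_plus f UCb_zero = f.
Proof. apply UCb_eq; intros x; simpl; ring. Qed.
Lemma UCb_plus_opp_r (f : UCb) : UCb_plus f (UCb_opp f) = UCb_zero.
Proof. apply UCb_eq; intros x; simpl; ring. Qed.

Definition UCb_AbelianMonoid_mixin :=
  AbelianMonoid.Mixin UCb UCb_plus UCb_zero
    UCb_plus_comm UCb_plus_assoc UCb_plus_zero_r.
Canonical UCb_AbelianMonoid :=
  AbelianMonoid.Pack UCb UCb_AbelianMonoid_mixin UCb.

Definition UCb_AbelianGroup_mixin :=
  AbelianGroup.Mixin UCb_AbelianMonoid UCb_opp UCb_plus_opp_r.
Canonical UCb_AbelianGroup :=
  AbelianGroup.Pack UCb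
    (AbelianGroup.Class UCb UCb_AbelianMonoid_mixin UCb_AbelianGroup_mixin) UCb.

Lemma UCb_scal_assoc (k l : R) (f : UCb) :
  UCb_scal k (UCb_scal l f) = UCb_scal (k * l) f.
Proof. apply UCb_eq; intros x; simpl; ring. Qed.
Lemma UCb_scal_one (f : UCb) : UCb_scal 1 f = f.
Proof. apply UCb_eq; intros x; simpl; ring. Qed.
Lemma UCb_scal_distr_l (k : R) (f g : UCb) :
  UCb_scal k (UCb_plus f g) = UCb_plus (UCb_scal k f) (UCb_scal k g).
Proof. apply UCb_eq; intros x; simpl; ring. Qed.
Lemma UCb_scal_distr_r (k l : R) (f : UCb) :
  UCb_scal (k + l) f = UCb_plus (UCb_scal k f) (UCb_scal l f).
Proof. apply UCb_eq; intros x; simpl; ring. Qed.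

Definition UCb_ModuleSpace_mixin :=
  ModuleSpace.Mixin R_Ring UCb_AbelianGroup UCb_scal
    UCb_scal_assoc UCb_scal_one UCb_scal_distr_l UCb_scal_distr_r.
Canonical UCb_ModuleSpace :=
  ModuleSpace.Pack R_Ring UCb
    (ModuleSpace.Class R_Ring UCb (AbelianGroup.class UCb_AbelianGroup)
       UCb_ModuleSpace_mixin) UCb.

Lemma UCb_norm_triangle (f g : UCb) :
  UCb_norm (UCb_plus f g) <= UCb_norm f + UCb_norm g.
Proof.
apply sup_norm_le; intros x; simpl.
apply Rle_trans with (1 := Rabs_triang _ _).
apply Rplus_le_compat; apply UCb_norm_ge.
Qed.

Lemma UCb_norm_scal (k : R) (f : UCb) :
  UCb_norm (UCb_scal k f) <= Rabs k * UCb_norm f.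
Proof.
apply sup_norm_le; intros x; simpl; rewrite Rabs_mult.
apply Rmult_le_compat_l; [apply Rabs_pos | apply UCb_norm_ge].
Qed.

Lemma UCb_norm_eq_zero (f : UCb) : UCb_norm f = 0 -> f = UCb_zero.
Proof.
intros H; apply UCb_eq; intros x; simpl.
assert (K := UCb_norm_ge f x); rewrite H in K.
apply Rabs_eq_0; assert (P := Rabs_pos (f x)); lra.
Qed.

Definition UCb_ball (f : UCb) (e : R) (g : UCb) : Prop :=
  UCb_norm (minus g f) < e.

Lemma UCb_ball_center (f : UCb) (e : posreal) : UCb_ball f e f.
Proof.
apply Rle_lt_trans with (2 := cond_pos e); apply sup_norm_le; intros x; simpl.
rewrite Rplus_opp_r, Rabs_R0; lra.
Qed.

Lemma UCb_ball_sym (f g : UCb) (e : R) : UCb_ball f e g -> UCb_ball g e f.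
Proof.
apply Rle_lt_trans; apply sup_norm_le; intros x.
replace (Rabs (minus f g x)) with (Rabs (minus g f x)); [apply UCb_norm_ge|].
simpl; apply (Rabs_minus_sym (g x) (f x)).
Qed.

Lemma UCb_ball_triangle (f g h : UCb) (e1 e2 : R) :
  UCb_ball f e1 g -> UCb_ball g e2 h -> UCb_ball f (e1 + e2) h.
Proof.
unfold UCb_ball; intros H1 H2.
replace (minus h f) with (UCb_plus (minus h g) (minus g f)).
- apply Rle_lt_trans with (1 := UCb_norm_triangle _ _); lra.
- apply UCb_eq; intros x; simpl; ring.
Qed.

Definition UCb_UniformSpace_mixin :=
  UniformSpace.Mixin UCb UCb_zero UCb_ball
    UCb_ball_center UCb_ball_sym UCb_ball_triangle.
Canonical UCb_UniformSpace := UniformSpace.Pack UCb UCb_UniformSpace_mixin UCb.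

Canonical UCb_NormedModuleAux :=
  NormedModuleAux.Pack R_AbsRing UCb
    (NormedModuleAux.Class R_AbsRing UCb
       (ModuleSpace.class R_Ring UCb_ModuleSpace) UCb_UniformSpace_mixin) UCb.

Lemma UCb_norm_ball_1 (f g : UCb) (e : R) :
  UCb_norm (minus g f) < e -> ball f e g.
Proof. exact (fun H => H). Qed.

Lemma UCb_norm_ball_2 (f g : UCb) (e : posreal) :
  ball f e g -> UCb_norm (minus g f) < 1 * e.
Proof. rewrite Rmult_1_l; exact (fun H => H). Qed.

Definition UCb_NormedModule_mixin :=
  NormedModule.Mixin R_AbsRing UCb_NormedModuleAux UCb_norm 1
    UCb_norm_triangle UCb_norm_scal UCb_norm_ball_1 UCb_norm_ball_2
    UCb_norm_eq_zero.
Canonical UCb_NormedModule :=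
  NormedModule.Pack R_AbsRing UCb
    (NormedModule.Class R_AbsRing UCb
       (NormedModuleAux.class R_AbsRing UCb_NormedModuleAux)
       UCb_NormedModule_mixin) UCb.

Definition UCb_lim_fun (F : (UCb -> Prop) -> Prop) (x : R) : R :=
  R_complete_lim (fun P : R -> Prop => F (fun f : UCb => P (f x))).

Definition UCb_lim (F : (UCb -> Prop) -> Prop) : UCb :=
  match excluded_middle_informative (in_UCb (UCb_lim_fun F)) with
  | left H => mkUCb _ H
  | right _ => UCb_zero
  end.

Lemma UCb_lim_fun_cauchy (F : (UCb -> Prop) -> Prop) :
  ProperFilter F -> cauchy F -> forall (eps : posreal) (x : R),
  F (fun f : UCb => Rabs (f x - UCb_lim_fun F x) < eps).
Proof.
intros FF HF eps x.
refine (R_complete (filtermap (fun f : UCb => f x) F) _ _ eps).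
- intros e; destruct (HF e) as [f Hf]; exists (f x).
  unfold filtermap; apply filter_imp with (P := ball f e); [|exact Hf].
  intros g Hg; apply Rle_lt_trans with (2 := Hg).
  exact (UCb_norm_ge (minus g f) x).
Qed.

Lemma UCb_lim_fun_uniform (F : (UCb -> Prop) -> Prop) :
  ProperFilter F -> cauchy F -> forall eps : posreal,
  F (fun f : UCb => forall x, Rabs (f x - UCb_lim_fun F x) < eps).
Proof.
intros FF HF eps.
assert (He : 0 < eps / 3) by (assert (K := cond_pos eps); lra).
destruct (HF (mkposreal _ He)) as [f0 Hf0].
refine (filter_imp _ _ _ Hf0); intros f Hf x.
destruct (filter_ex (F := F) _
  (filter_and _ _ Hf0 (UCb_lim_fun_cauchy F FF HF (mkposreal _ He) x)))
  as [g [Hg1 Hg2]].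
assert (K1 := Rle_lt_trans _ _ _ (UCb_norm_ge (minus f f0) x) Hf).
assert (K2 := Rle_lt_trans _ _ _ (UCb_norm_ge (minus g f0) x) Hg1).
change (Rabs (f x - f0 x) < eps / 3) in K1.
change (Rabs (g x - f0 x) < eps / 3) in K2.
change (Rabs (g x - UCb_lim_fun F x) < eps / 3) in Hg2.
apply Rabs_def2 in K1; apply Rabs_def2 in K2; apply Rabs_def2 in Hg2.
apply Rabs_def1; lra.
Qed.

Lemma UCb_lim_fun_in (F : (UCb -> Prop) -> Prop) :
  ProperFilter F -> cauchy F -> in_UCb (UCb_lim_fun F).
Proof.
intros FF HF; split.
- destruct (filter_ex (F := F) _
    (UCb_lim_fun_uniform F FF HF (mkposreal 1 Rlt_0_1))) as [f Hf].
  exists (UCb_norm f + 1); intros x.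
  assert (K1 := UCb_norm_ge f x); specialize (Hf x); simpl in Hf.
  apply Rabs_def2 in Hf; apply Rabs_le_between in K1.
  apply Rabs_le_between; lra.
- intros eps; assert (He : 0 < eps / 3) by (assert (K := cond_pos eps); lra).
  destruct (filter_ex (F := F) _
    (UCb_lim_fun_uniform F FF HF (mkposreal _ He))) as [f Hf].
  simpl in Hf; destruct (UCb_prop f) as [_ Uf].
  destruct (Uf (mkposreal _ He)) as [d Hd]; exists d; intros x y _ _ Hxy.
  specialize (Hd x y I I Hxy); simpl in Hd.
  assert (Kx := Hf x); assert (Ky := Hf y).
  apply Rabs_def2 in Hd; apply Rabs_def2 in Kx; apply Rabs_def2 in Ky.
  apply Rabs_def1; lra.
Qed.

Lemma UCb_complete (F : (UCb -> Prop) -> Prop) :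
  ProperFilter F -> cauchy F ->
  forall eps : posreal, F (ball (UCb_lim F) eps).
Proof.
intros FF HF eps; unfold UCb_lim.
destruct (excluded_middle_informative (in_UCb (UCb_lim_fun F))) as [H|H].
- refine (filter_imp _ _ _ (UCb_lim_fun_uniform F FF HF (pos_div_2 eps))).
  intros f Hf; apply Rle_lt_trans with (eps / 2).
  + apply sup_norm_le; intros x; apply Rlt_le, (Hf x).
  + assert (K := cond_pos eps); lra.
- now exfalso; apply H, UCb_lim_fun_in.
Qed.

Lemma UCb_lim_close (F1 F2 : (UCb -> Prop) -> Prop) :
  filter_le F1 F2 -> filter_le F2 F1 -> close (UCb_lim F1) (UCb_lim F2).
Proof.
intros H12 H21.
assert (E : UCb_lim_fun F1 = UCb_lim_fun F2).
{ apply functional_extensionality; intros x; apply eq_close.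
  apply R_complete_close; intros P HP; [now apply H12 | now apply H21]. }
unfold UCb_lim; rewrite E; apply close_refl.
Qed.

Definition UCb_CompleteSpace_mixin :=
  CompleteSpace.Mixin UCb_UniformSpace UCb_lim UCb_complete UCb_lim_close.
Canonical UCb_CompleteSpace :=
  CompleteSpace.Pack UCb
    (CompleteSpace.Class UCb UCb_UniformSpace_mixin UCb_CompleteSpace_mixin) UCb.
Canonical UCb_CompleteNormedModule :=
  CompleteNormedModule.Pack R_AbsRing UCb
    (CompleteNormedModule.Class R_AbsRing UCb
       (NormedModule.class R_AbsRing UCb_NormedModule)
       UCb_CompleteSpace_mixin) UCb.

(* A partially defined operator on [X] is represented by its graph.  A graph
   equal to a [generator] is automatically single-valued, so [generates] with
   a closure includes closability. *)
Definition graph (X : Type) : Type := X * X -> Prop.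

(* [ball] on [X * X] bounds both components, so this is the closure of the
   graph in the product topology. *)
Definition closure_of {X : NormedModule R_AbsRing} (G : graph X) : graph X :=
  fun p => forall eps : posreal, exists q : X * X, ball p eps q /\ G q.

Record C0_semigroup {X : CompleteNormedModule R_AbsRing} (V : R -> X -> X)
  : Prop := {
  C0_linear : forall t, 0 <= t -> is_linear (V t);
  C0_zero : forall u, V 0 u = u;
  C0_add : forall t s, 0 <= t -> 0 <= s ->
    forall u, V (t + s) u = V t (V s u);
  C0_continuous : forall u t, 0 <= t ->
    filterlim (fun s => V s u) (within (fun s => 0 <= s) (locally t))
      (locally (V t u)) }.

Definition generator {X : CompleteNormedModule R_AbsRing} (V : R -> X -> X)
  : graph X :=
  fun p => filterlim (fun t => scal (/ t) (minus (V t (fst p)) (fst p)))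
             (at_right 0) (locally (snd p)).

Definition generates {X : CompleteNormedModule R_AbsRing} (L : graph X)
  (V : R -> X -> X) : Prop :=
  C0_semigroup V /\ forall p, L p <-> generator V p.

Definition operA (a b c : UCb) : graph UCb :=
  fun p => let (phi, psi) := p in
    Cb_infty phi /\
    forall x, psi x = a x * Derive_n phi 2 x + b x * Derive_n phi 1 x
                      + c x * phi x.

Definition S_fun (a b c : R -> R) (t : R) (f : R -> R) (x : R) : R :=
  1 / 4 * f (x + 2 * sqrt (a x * t)) + 1 / 4 * f (x - 2 * sqrt (a x * t))
  + 1 / 2 * f (x + 2 * b x * t) + t * c x * f x.

Lemma in_UCb_S_fun (a b c : UCb) (t : R) (f : UCb) :
  in_UCb (S_fun a b c t f).
Proof.
destruct a as [a Ha], b as [b Hb], c as [c Hc], f as [f Hf]; simpl.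
assert (Hs : in_UCb (fun x => 2 * sqrt (a x * t))).
{ apply in_UCb_scal, in_UCb_sqrt.
  now apply (in_UCb_mult a); [|apply in_UCb_const]. }
unfold S_fun; repeat apply in_UCb_plus.
- now apply in_UCb_scal, in_UCb_shift.
- apply in_UCb_scal.
  apply (in_UCb_shift f (fun x => - (2 * sqrt (a x * t)))); auto.
  now apply in_UCb_opp.
- apply in_UCb_scal, in_UCb_shift; auto.
  apply (in_UCb_mult (fun x => 2 * b x)); [|apply in_UCb_const].
  now apply in_UCb_scal.
- apply in_UCb_mult; auto; now apply in_UCb_scal.
Qed.

(* Since [sqrt] vanishes on negative reals, [S_fun] preserves [UCb] for every
   real [t] and every [a], not only for [t >= 0] and [a >= 0]. *)
Definition operS (a b c : UCb) (t : R) (f : UCb) : UCb :=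
  mkUCb _ (in_UCb_S_fun a b c t f).

(* [(S(t/n))^n g]; meaningful for [n >= 1]. *)
Definition chernoff (a b c : UCb) (n : nat) (t : R) (g : UCb) : UCb :=
  Nat.iter n (operS a b c (t / INR n)) g.

Definition solves (a b c : UCb) (lambda : R) (g f : UCb) : Prop :=
  forall x,
    ex_derive_n f 1 x /\ ex_derive_n f 2 x /\
    a x * Derive_n f 2 x + b x * Derive_n f 1 x + (c x - lambda) * f x = - g x.

(* Main.v *)
Require Import Defs.
From Stdlib Require Import Reals Lra Lia List ZArith ClassicalEpsilon.
From Stdlib Require Import FunctionalExtensionality.
From Coquelicot Require Import Coquelicot.
Import ListNotations.
Open Scope R_scope.

(** Write [A] for the operator [f |-> a f'' + b f' + c f], [w] for the norm of [c],
    and [G] for the graph of [A] on the functions whose first two derivatives lie in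
    the space of bounded uniformly continuous functions.

    Generation.  If [lambda > w], a maximum principle on the whole line gives
    [(lambda - w) |f| <= |lambda f - A f|], and with an interpolation inequality it
    bounds [f], [f'] and [f''] by [lambda f - A f], uniformly over a family of
    operators joining [A] to [f'' - f].  The method of continuity then solves
    [lambda f - A f = g] for every [g] ([elliptic_solvable]).  Smoothing by iterated
    moving averages shows that smooth functions are dense in the domain of [G] for
    the graph norm; as [lambda - A] is onto, [G] is exactly the closure of [A]
    ([closure_operA]).  A dissipative operator of this kind generates a semigroup,
    the limit of implicit Euler schemes ([hille_yosida]).

    Resolvent.  Any semigroup [V] generated by [G] satisfies
    [|V(t) f| <= exp (w t) |f|], so that integrating the derivative of
    [exp (- lambda t) V(t) f] identifies the solution of [lambda f - A f = g] with
    the Laplace transform of [V(t) g].  Uniqueness of the solution among all bounded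
    twice differentiable functions is again the maximum principle.

    Rate.  The telescoping identity for [S(t/n)^n - V(t/n)^n] reduces the error to
    the one-step error on [V(s) g], which is of order [(t/n)^2] as soon as the
    derivatives of [V(s) g] up to order four are controlled.  Propagating derivatives
    along the semigroup would worsen the exponential rate; instead [A^2] commutes
    with [V], and elliptic regularity bounds the derivatives of a function by its
    image under [1], [A] and [A^2] ([opgraph2_regular]).  This gives
    [exp (w t) t^2 / n] times a norm of [g] ([chernoff_rate]).  The bounds on the
    integrals follow from the moments of [exp (- (lambda - w) t)], and the
    convergence for arbitrary [g] from the density of smooth functions. *)


(** * Linear identities in normed modules *)

(** The operations are pinned to one path through the hierarchy of algebraic
    structures: inference from nested operations would select several convertible
    but syntactically different instances of the same operation. *)
Notation "u [+] v" := (@plus (CompleteNormedModule.AbelianMonoid R_AbsRing _) u v)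
  (at level 50, left associativity).
Notation "u [-] v" := (@minus (CompleteNormedModule.AbelianGroup R_AbsRing _) u v)
  (at level 50, left associativity).
Notation "k [*] u" := (@scal (AbsRing.Ring R_AbsRing)
  (CompleteNormedModule.ModuleSpace R_AbsRing _) k u)
  (at level 40, left associativity).
Notation vzero := (@zero (CompleteNormedModule.AbelianMonoid R_AbsRing _)).
Notation vopp := (@opp (CompleteNormedModule.AbelianGroup R_AbsRing _)).
Notation vnorm := (@norm R_AbsRing (CompleteNormedModule.NormedModule R_AbsRing _)).

Inductive mexpr : Type :=
| MVar (i : nat)
| MZero
| MPlus (e1 e2 : mexpr)
| MOpp (e : mexpr)
| MScal (k : R) (e : mexpr).

Fixpoint mexpr_coef (e : mexpr) (i : nat) : R :=
  match e with
  | MVar j => if Nat.eqb i j then 1 else 0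
  | MZero => 0
  | MPlus e1 e2 => mexpr_coef e1 i + mexpr_coef e2 i
  | MOpp e => - mexpr_coef e i
  | MScal k e => k * mexpr_coef e i
  end.

Fixpoint mexpr_coefs_eq (e1 e2 : mexpr) (n : nat) : Prop :=
  match n with
  | O => True
  | S n => mexpr_coef e1 n = mexpr_coef e2 n /\ mexpr_coefs_eq e1 e2 n
  end.

Section Module_expressions.
Context {X : CompleteNormedModule R_AbsRing}.

Fixpoint mexpr_eval (env : list X) (e : mexpr) : X :=
  match e with
  | MVar i => nth i env zero
  | MZero => zero
  | MPlus e1 e2 => plus (mexpr_eval env e1) (mexpr_eval env e2)
  | MOpp e => opp (mexpr_eval env e)
  | MScal k e => scal k (mexpr_eval env e)
  end.

Fixpoint lin_comb (c : nat -> R) (i : nat) (env : list X) : X :=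
  match env with
  | nil => zero
  | x :: env => plus (scal (c i) x) (lin_comb c (S i) env)
  end.

Lemma lin_comb_ext c1 c2 i env :
  (forall j, (i <= j < i + length env)%nat -> c1 j = c2 j) ->
  lin_comb c1 i env = lin_comb c2 i env.
Proof.
revert i; induction env as [|x env IH]; intros i H; simpl; auto.
simpl in H; rewrite (H i) by lia; f_equal; apply IH; intros j Hj; apply H; lia.
Qed.

Lemma lin_comb_zero i env : lin_comb (fun _ => 0) i env = zero.
Proof.
revert i; induction env as [|x env IH]; intros i; simpl; auto.
rewrite IH, plus_zero_r; exact (scal_zero_l x).
Qed.

Lemma plus_plus_swap (u v x y : X) :
  plus (plus u v) (plus x y) = plus (plus u x) (plus v y).
Proof.
rewrite <- !plus_assoc; f_equal; rewrite !plus_assoc; f_equal; apply plus_comm.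
Qed.

Lemma lin_comb_plus c1 c2 i env :
  plus (lin_comb c1 i env) (lin_comb c2 i env)
  = lin_comb (fun j => c1 j + c2 j) i env.
Proof.
revert i; induction env as [|x env IH]; intros i; simpl.
- apply plus_zero_r.
- rewrite plus_plus_swap, IH; f_equal.
  symmetry; exact (scal_distr_r (c1 i) (c2 i) x).
Qed.

Lemma lin_comb_scal k c i env :
  scal k (lin_comb c i env) = lin_comb (fun j => k * c j) i env.
Proof.
revert i; induction env as [|x env IH]; intros i; simpl.
- exact (@scal_zero_r _ (NormedModule.ModuleSpace R_AbsRing X) k).
- rewrite <- IH; rewrite scal_distr_l; f_equal.
  exact (scal_assoc k (c i) x).
Qed.

Lemma lin_comb_var env i n :
  lin_comb (fun j => if Nat.eqb j (n + i) then 1 else 0) n env = nth i env zero.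
Proof.
revert i n; induction env as [|x env IH]; intros i n; simpl.
- now destruct i.
- destruct i as [|i].
  + rewrite Nat.add_0_r, Nat.eqb_refl.
    rewrite (lin_comb_ext _ (fun _ => 0)).
    * rewrite lin_comb_zero, plus_zero_r; exact (scal_one x).
    * intros j Hj; rewrite (proj2 (Nat.eqb_neq _ _)); auto; lia.
  + rewrite (proj2 (Nat.eqb_neq n (n + S i))) by lia.
    rewrite <- (IH i (S n)).
    replace (scal 0 x) with (@zero X) by (symmetry; exact (scal_zero_l x)).
    rewrite plus_zero_l; apply lin_comb_ext; intros j _.
    now replace (n + S i)%nat with (S n + i)%nat by lia.
Qed.

Lemma mexpr_eval_lin_comb env e : mexpr_eval env e = lin_comb (mexpr_coef e) 0 env.
Proof.
induction e as [i| |e1 IH1 e2 IH2|e IH|k e IH]; simpl.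
- symmetry; apply (lin_comb_var env i 0).
- symmetry; apply lin_comb_zero.
- rewrite IH1, IH2; apply lin_comb_plus.
- rewrite IH; transitivity (scal (-1) (lin_comb (mexpr_coef e) 0 env)).
  + symmetry; exact (@scal_opp_one _ (NormedModule.ModuleSpace R_AbsRing X) _).
  + rewrite lin_comb_scal; apply lin_comb_ext; intros; simpl; ring.
- rewrite IH; apply lin_comb_scal.
Qed.

(** Reflexive decision of linear identities: two expressions agree when each vector
    occurs in both with the same total coefficient. *)
Lemma mexpr_eval_eq env e1 e2 :
  mexpr_coefs_eq e1 e2 (length env) -> mexpr_eval env e1 = mexpr_eval env e2.
Proof.
intros H; rewrite !mexpr_eval_lin_comb; apply lin_comb_ext; intros j [_ Hj].
revert H Hj; simpl; generalize (length env); induction n as [|n IH]; [lia|].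
intros [H1 H2] Hj; destruct (Nat.eq_dec j n) as [->|Hn]; auto.
apply IH; auto; lia.
Qed.

End Module_expressions.

Ltac mod_index x env :=
  lazymatch env with
  | x :: _ => constr:(0%nat)
  | _ :: ?env' => let i := mod_index x env' in constr:(S i)
  end.

Ltac mod_mem x env :=
  lazymatch env with
  | nil => constr:(false)
  | x :: _ => constr:(true)
  | _ :: ?env' => mod_mem x env'
  end.

Ltac mod_env env t :=
  lazymatch t with
  | plus ?u ?v => let env := mod_env env u in mod_env env v
  | minus ?u ?v => let env := mod_env env u in mod_env env v
  | opp ?u => mod_env env u
  | scal _ ?u => mod_env env u
  | zero => env
  | _ => lazymatch mod_mem t env with
         | true => env
         | false => constr:(t :: env)
         end
  end.

Ltac mod_reify env t :=
  lazymatch t with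
  | plus ?u ?v =>
      let u := mod_reify env u in let v := mod_reify env v in
      constr:(MPlus u v)
  | minus ?u ?v =>
      let u := mod_reify env u in let v := mod_reify env v in
      constr:(MPlus u (MOpp v))
  | opp ?u => let u := mod_reify env u in constr:(MOpp u)
  | scal ?k ?u => let u := mod_reify env u in constr:(MScal k u)
  | zero => constr:(MZero)
  | _ => let i := mod_index t env in constr:(MVar i)
  end.

(** Leaves to [field] one equality of real coefficients for each vector. *)
Ltac module_eq :=
  lazymatch goal with
  | |- @eq ?T ?u ?v =>
      let env := mod_env (@nil T) u in
      let env := mod_env env v in
      let e1 := mod_reify env u in
      let e2 := mod_reify env v in
      change (mexpr_eval env e1 = mexpr_eval env e2);
      apply mexpr_eval_eq; simpl; repeat split; try (field; repeat split; lra)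
  end.

(** * Norms, limits and linear maps *)

Lemma le_Rmin (x y z : R) : x <= Rmin y z -> x <= y /\ x <= z.
Proof.
intros H; split; apply Rle_trans with (1 := H); [apply Rmin_l | apply Rmin_r].
Qed.

Lemma lt_Rmin (x y z : R) : x < Rmin y z -> x < y /\ x < z.
Proof.
intros H; split; apply Rlt_le_trans with (1 := H); [apply Rmin_l | apply Rmin_r].
Qed.

(** Replaces the choice of [eps / (M + 1)] in continuity arguments. *)
Lemma small_factor (M eps : R) : 0 <= M -> 0 < eps ->
  exists d, 0 < d /\ forall e, 0 <= e <= d -> M * e < eps.
Proof.
intros HM He; exists (eps / (M + 1)).
assert (Hd : 0 < eps / (M + 1)) by (apply Rdiv_lt_0_compat; lra).
split; auto; intros e [He0 Hed].
apply Rmult_le_compat_l with (r := M) in Hed; auto.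
assert ((M + 1) * (eps / (M + 1)) = eps) by (field; lra); lra.
Qed.

Section Norms.
Context {X : CompleteNormedModule R_AbsRing}.

Lemma vnorm_triangle (x y : X) : vnorm (x [+] y) <= vnorm x + vnorm y.
Proof. exact (norm_triangle x y). Qed.

Lemma vnorm_ge_0 (x : X) : 0 <= vnorm x.
Proof. exact (norm_ge_0 x). Qed.

Lemma vnorm_opp (x : X) : vnorm (vopp x) = vnorm x.
Proof. exact (norm_opp x). Qed.

Lemma vnorm_zero : vnorm (vzero : X) = 0.
Proof. exact (@norm_zero _ (CompleteNormedModule.NormedModule R_AbsRing X)). Qed.

Lemma norm_minus_sym (x y : X) : vnorm (x [-] y) = vnorm (y [-] x).
Proof.
rewrite <- vnorm_opp; f_equal; module_eq.
Qed.

Lemma norm_minus_triangle (y x z : X) :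
  vnorm (x [-] z) <= vnorm (x [-] y) + vnorm (y [-] z).
Proof.
replace (x [-] z) with ((x [-] y) [+] (y [-] z)) by module_eq.
apply vnorm_triangle.
Qed.

Lemma norm_le_minus (x y : X) : vnorm x <= vnorm y + vnorm (x [-] y).
Proof.
replace (vnorm x) with (vnorm (y [+] (x [-] y))) by (f_equal; module_eq).
apply vnorm_triangle.
Qed.

Lemma vnorm_lipschitz (x y : X) : Rabs (vnorm x - vnorm y) <= vnorm (x [-] y).
Proof.
assert (A := norm_le_minus x y); assert (B := norm_le_minus y x).
rewrite (norm_minus_sym y x) in B; apply Rabs_le_between; lra.
Qed.

Lemma norm_scal_R (k : R) (x : X) : vnorm (k [*] x) = Rabs k * vnorm x.
Proof.
apply Rle_antisym; [exact (norm_scal k x)|].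
destruct (Req_dec k 0) as [-> |Hk].
- rewrite Rabs_R0, Rmult_0_l; apply vnorm_ge_0.
- replace (vnorm x) with (vnorm ((/ k) [*] (k [*] x)))
    by (f_equal; module_eq; auto).
  assert (K : vnorm ((/ k) [*] (k [*] x)) <= Rabs (/ k) * vnorm (k [*] x))
    by exact (norm_scal (/ k) (k [*] x)).
  rewrite Rabs_inv in K; assert (P := Rabs_pos_lt k Hk).
  apply Rmult_le_compat_l with (r := Rabs k) in K; [|lra].
  rewrite <- Rmult_assoc, Rinv_r, Rmult_1_l in K; lra.
Qed.

Lemma norm_scal_pos (k : R) (x : X) : 0 <= k -> vnorm (k [*] x) = k * vnorm x.
Proof. intros Hk; rewrite norm_scal_R, Rabs_pos_eq; auto. Qed.

Lemma norm_minus_diag (x : X) : vnorm (x [-] x) = 0.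
Proof.
transitivity (vnorm (vzero : X)); [f_equal; module_eq | apply vnorm_zero].
Qed.

Lemma norm_minus_eq_zero (x y : X) : vnorm (x [-] y) <= 0 -> x = y.
Proof.
intros H; assert (N : vnorm (x [-] y) = 0).
{ apply Rle_antisym; auto; apply vnorm_ge_0. }
assert (E : x [-] y = (vzero : X)) by exact (norm_eq_zero _ N).
replace x with (y [+] (x [-] y)) by module_eq; rewrite E; module_eq.
Qed.

Lemma filterlim_vnorm {T : Type} (F : (T -> Prop) -> Prop) {FF : Filter F}
  (u : T -> X) (l : X) :
  filterlim u F (locally l) <->
  forall eps, 0 < eps -> F (fun n => vnorm (u n [-] l) < eps).
Proof.
set (Y := CompleteNormedModule.NormedModule R_AbsRing X).
rewrite filterlim_locally; split; intros H eps.
- intros Heps; assert (Hf := @norm_factor_gt_0 _ Y).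
  assert (He : 0 < eps / @norm_factor _ Y) by now apply Rdiv_lt_0_compat.
  refine (filter_imp _ _ _ (H (mkposreal _ He))); intros n Hn.
  apply (@norm_compat2 _ Y) in Hn; simpl in Hn.
  replace (@norm_factor _ Y * (eps / @norm_factor _ Y)) with eps in Hn by (field; lra).
  exact Hn.
- refine (filter_imp _ _ _ (H eps (cond_pos eps))); intros n Hn.
  now apply (@norm_compat1 _ Y).
Qed.

Lemma lim_norm_le (u : nat -> X) (l x : X) (M : R) :
  filterlim u eventually (locally l) ->
  eventually (fun n => vnorm (u n [-] x) <= M) -> vnorm (l [-] x) <= M.
Proof.
intros Hu HM; apply Rnot_lt_le; intros HMl.
assert (He : 0 < vnorm (l [-] x) - M) by lra.
destruct (filter_ex (F := eventually) _
  (filter_and _ _ HM (proj1 (filterlim_vnorm _ u l) Hu _ He))) as [n [H1 H2]].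
assert (K := norm_minus_triangle (u n) l x).
rewrite (norm_minus_sym l (u n)) in K; lra.
Qed.

Lemma lim_norm_le_0 (u : nat -> X) (l : X) (M : R) :
  filterlim u eventually (locally l) ->
  eventually (fun n => vnorm (u n) <= M) -> vnorm l <= M.
Proof.
intros Hu HM; replace l with (l [-] vzero) by module_eq.
apply (lim_norm_le u); auto.
refine (filter_imp _ _ _ HM); intros n Hn.
now replace (u n [-] vzero) with (u n) by module_eq.
Qed.

Lemma lim_unique (u : nat -> X) (l x : X) :
  filterlim u eventually (locally l) -> filterlim u eventually (locally x) ->
  l = x.
Proof.
exact (filterlim_locally_unique (F := eventually)
  (V := CompleteNormedModule.NormedModule R_AbsRing X) u l x).
Qed.

Lemma lim_minus (u v : nat -> X) (l m : X) :
  filterlim u eventually (locally l) -> filterlim v eventually (locally m) ->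
  filterlim (fun n => u n [-] v n) eventually (locally (l [-] m)).
Proof.
set (Y := CompleteNormedModule.NormedModule R_AbsRing X).
intros Hu Hv.
apply (filterlim_comp_2 (H := locally (vopp m)) u (fun n => vopp (v n)) plus Hu).
- exact (filterlim_comp _ _ _ v _ _ _ _ Hv (filterlim_opp (V := Y) m)).
- exact (filterlim_plus (V := Y) l (vopp m)).
Qed.

Lemma lim_scal (a : nat -> R) (t : R) (x : X) :
  is_lim_seq a t ->
  filterlim (fun n => a n [*] x) eventually (locally (t [*] x)).
Proof.
set (Y := CompleteNormedModule.NormedModule R_AbsRing X).
intros Ha; apply (filterlim_comp nat R X a (fun k => k [*] x) _ (locally t)).
- exact Ha.
- exact (filterlim_scal_l (V := Y) t x).
Qed.

Lemma lim_const (x : X) : filterlim (fun _ : nat => x) eventually (locally x).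
Proof. apply filterlim_const. Qed.

Lemma lim_linear (P : X -> X) (u : nat -> X) (l : X) :
  is_linear P -> filterlim u eventually (locally l) ->
  filterlim (fun n => P (u n)) eventually (locally (P l)).
Proof.
intros HP Hu; apply filterlim_comp with (1 := Hu).
exact (linear_cont P l HP).
Qed.

End Norms.

Lemma cauchy_seq_lim {X : CompleteNormedModule R_AbsRing} (u : nat -> X) :
  (forall eps, 0 < eps -> exists N, forall n m, (N <= n)%nat -> (n <= m)%nat ->
     vnorm (u n [-] u m) <= eps) ->
  exists l, filterlim u eventually (locally l).
Proof.
intros H.
apply (proj1 (filterlim_locally_cauchy (U := X) (F := eventually) u)).
intros eps.
assert (He : 0 < eps / 2) by (assert (K := cond_pos eps); lra).
destruct (H _ He) as [N HN].
exists (fun n => (N <= n)%nat); split; [now exists N|].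
intros n m Hn Hm; apply (@norm_compat1 R_AbsRing X); assert (K := cond_pos eps).
apply Rle_lt_trans with (eps / 2); [|lra].
destruct (Nat.le_ge_cases n m) as [L|L].
- rewrite (@norm_minus_sym X); exact (HN n m Hn L).
- exact (HN m n Hm L).
Qed.

Section Linear_maps.
Context {X : CompleteNormedModule R_AbsRing}.

Lemma linear_intro (P : X -> X) (M : R) :
  (forall x y, P (x [+] y) = P x [+] P y) ->
  (forall k x, P (k [*] x) = k [*] P x) ->
  0 < M -> (forall x, vnorm (P x) <= M * vnorm x) -> is_linear P.
Proof. intros H1 H2 H3 H4; split; auto; now exists M. Qed.

Lemma linear_vplus (P : X -> X) (x y : X) :
  is_linear P -> P (x [+] y) = P x [+] P y.
Proof. intros HP; exact (linear_plus P HP x y). Qed.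

Lemma linear_vscal (P : X -> X) (k : R) (x : X) :
  is_linear P -> P (k [*] x) = k [*] P x.
Proof. intros HP; exact (linear_scal P HP k x). Qed.

Lemma linear_vminus (P : X -> X) (x y : X) :
  is_linear P -> P (x [-] y) = P x [-] P y.
Proof.
intros HP; replace (x [-] y) with (x [+] ((-1) [*] y)) by module_eq.
rewrite linear_vplus, linear_vscal by auto; module_eq.
Qed.

Lemma iter_linear (P : X -> X) (k : nat) :
  is_linear P -> is_linear (Nat.iter k P).
Proof.
intros HP; induction k as [|k IH]; simpl.
- apply is_linear_id.
- now apply (is_linear_comp (Nat.iter k P) P).
Qed.

Lemma iter_norm_le (P : X -> X) (M : R) (k : nat) (f : X) :
  0 <= M -> (forall x, vnorm (P x) <= M * vnorm x) ->
  vnorm (Nat.iter k P f) <= M ^ k * vnorm f.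
Proof.
intros HM HP; induction k as [|k IH]; simpl; [lra|].
apply Rle_trans with (1 := HP _); rewrite Rmult_assoc.
now apply Rmult_le_compat_l.
Qed.

(** From [P^(k+1) f - Q^(k+1) f = P (P^k f - Q^k f) + (P - Q) Q^k f]: only the
    one-step error along the orbit of [Q] matters. It serves to compare implicit
    Euler schemes of different steps, and a Chernoff product with the semigroup. *)
Lemma iter_telescope (P Q : X -> X) (f : X) (M E : R) (k : nat) :
  is_linear P -> 0 <= M -> (forall x, vnorm (P x) <= M * vnorm x) ->
  (forall j, (j < k)%nat ->
     vnorm ((P (Nat.iter j Q f)) [-] (Q (Nat.iter j Q f))) <= E * M ^ S j) ->
  vnorm ((Nat.iter k P f) [-] (Nat.iter k Q f)) <= INR k * E * M ^ k.
Proof.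
intros HP HM HPM; induction k as [|k IH]; intros HE.
- simpl; rewrite norm_minus_diag; lra.
- set (p := Nat.iter k P f) in *; set (q := Nat.iter k Q f) in *.
  change (vnorm (P p [-] Q q) <= INR (S k) * E * M ^ S k).
  apply Rle_trans with (1 := norm_minus_triangle (P q) _ _).
  rewrite <- linear_vminus by auto.
  assert (K1 := HPM (p [-] q)).
  assert (K2 : vnorm (p [-] q) <= INR k * E * M ^ k) by (apply IH; auto).
  assert (K3 : vnorm (P q [-] Q q) <= E * M ^ S k) by (apply HE; lia).
  apply Rmult_le_compat_l with (r := M) in K2; auto.
  rewrite S_INR; simpl in K3 |- *; lra.
Qed.

End Linear_maps.

Lemma exp_pow (x : R) (k : nat) : exp x ^ k = exp (INR k * x).
Proof.
induction k as [|k IH]; [simpl; now rewrite Rmult_0_l, exp_0|].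
rewrite S_INR, Rmult_plus_distr_r, exp_plus, Rmult_1_l, <- IH; simpl; ring.
Qed.

Lemma exp_ge_1 (x : R) : 0 <= x -> 1 <= exp x.
Proof. intros Hx; assert (K := exp_ineq1_le x); lra. Qed.

Lemma exp_le (x y : R) : x <= y -> exp x <= exp y.
Proof. intros [H| ->]; [now apply Rlt_le, exp_increasing | lra]. Qed.

(** * The Hille-Yosida theorem *)

(** The hypotheses of the Hille-Yosida theorem in the quasi-contractive case: the
    last field says that [mu - G] is onto, and closedness of [G] is a consequence. *)
Record m_dissipative {X : CompleteNormedModule R_AbsRing} (w : R) (G : graph X)
  : Prop := {
  md_plus : forall f g f' g',
    G (f, g) -> G (f', g') -> G (f [+] f', g [+] g');
  md_scal : forall k f g, G (f, g) -> G (k [*] f, k [*] g);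
  md_dense : forall f eps, 0 < eps ->
    exists u v, G (u, v) /\ vnorm (u [-] f) < eps;
  md_diss : forall mu f g, w < mu -> G (f, g) ->
    (mu - w) * vnorm f <= vnorm ((mu [*] f) [-] g);
  md_range : forall mu g, w < mu -> exists f, G (f, (mu [*] f) [-] g) }.

Lemma md_minus {X : CompleteNormedModule R_AbsRing} (w : R) (G : graph X) f g f' g' :
  m_dissipative w G ->
  G (f, g) -> G (f', g') -> G (f [-] f', g [-] g').
Proof.
intros HG H H'; apply (md_scal _ _ HG (-1)) in H'.
replace (f [-] f') with (f [+] ((-1) [*] f')) by module_eq.
replace (g [-] g') with (g [+] ((-1) [*] g')) by module_eq.
now apply (md_plus _ _ HG).
Qed.

Section Hille_Yosida.
Context {X : CompleteNormedModule R_AbsRing}.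
Variables (w : R) (G : graph X).
Hypotheses (Hw : 0 <= w) (HG : m_dissipative w G).

(* Steps for which [1 / (1 - w h) <= exp (2 w h)]. *)
Let admissible (h : R) : Prop := 0 < h /\ 2 * w * h <= 1.

(** [(1 - h G)^-1], one step of the implicit Euler scheme. *)
Definition resolvent (h : R) (g : X) : X :=
  epsilon (inhabits zero) (fun f => G (f, (/ h) [*] (f [-] g))).

Lemma admissible_rate h : admissible h -> w < / h.
Proof.
intros [H1 H2]; apply Rmult_lt_reg_r with h; auto; rewrite Rinv_l by lra.
destruct (Req_dec w 0) as [-> |Hw0]; [lra|].
assert (0 < w * h) by (apply Rmult_lt_0_compat; lra); lra.
Qed.

Lemma resolvent_spec h g :
  admissible h -> G (resolvent h g, (/ h) [*] (resolvent h g [-] g)).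
Proof.
intros Hh; apply (epsilon_spec (inhabits (vzero : X))
  (fun f => G (f, (/ h) [*] (f [-] g)))).
destruct (md_range _ _ HG (/ h) ((/ h) [*] g) (admissible_rate h Hh)) as [f Hf].
exists f; destruct Hh; cbv beta.
replace ((/ h) [*] (f [-] g)) with (((/ h) [*] f) [-] ((/ h) [*] g))
  by module_eq.
exact Hf.
Qed.

Lemma resolvent_unique h f g :
  admissible h -> G (f, (/ h) [*] (f [-] g)) -> resolvent h g = f.
Proof.
intros Hh Hf; assert (H1 := resolvent_spec h g Hh).
assert (H2 := md_minus _ _ _ _ _ _ HG H1 Hf).
assert (H3 := admissible_rate h Hh).
assert (H4 := md_diss _ _ HG _ _ _ H3 H2).
set (u := resolvent h g) in *; destruct Hh.
match type of H4 with _ <= ?t => replace t with 0 in H4 end.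
- apply norm_minus_eq_zero; assert (K := vnorm_ge_0 (u [-] f)).
  apply Rmult_le_reg_l with (/ h - w); lra.
- symmetry; rewrite <- (@vnorm_zero X); f_equal; module_eq.
Qed.

(** [(1 - h G) (f + h (1 - h G)^-1 g) = f] when [g] is the image of [f]. *)
Lemma resolvent_step h f g :
  admissible h -> G (f, g) -> resolvent h f = f [+] (h [*] (resolvent h g)).
Proof.
intros Hh Hf; apply resolvent_unique; auto.
assert (H1 := resolvent_spec h g Hh); set (u := resolvent h g) in *.
replace ((/ h) [*] ((f [+] (h [*] u)) [-] f))
  with (g [+] (h [*] ((/ h) [*] (u [-] g))))
  by (destruct Hh; module_eq).
now apply (md_plus _ _ HG); [|apply (md_scal _ _ HG)].
Qed.

Lemma resolvent_comm h f g :
  admissible h -> G (f, g) -> G (resolvent h f, resolvent h g).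
Proof.
intros Hh Hf; rewrite (resolvent_step h f g) by auto.
assert (H1 := resolvent_spec h g Hh); set (u := resolvent h g) in *.
replace u with (g [+] (h [*] ((/ h) [*] (u [-] g)))) at 2
  by (destruct Hh; module_eq).
now apply (md_plus _ _ HG); [|apply (md_scal _ _ HG)].
Qed.

Let growth := 2 * w.

Lemma resolvent_norm h g :
  admissible h -> vnorm (resolvent h g) <= exp (growth * h) * vnorm g.
Proof.
intros Hh; assert (H1 := resolvent_spec h g Hh).
assert (H2 := md_diss _ _ HG _ _ _ (admissible_rate h Hh) H1).
set (u := resolvent h g) in *; destruct Hh as [Hh1 Hh2].
replace (vnorm (((/ h) [*] u) [-] ((/ h) [*] (u [-] g))))
  with (/ h * vnorm g) in H2.
2: { rewrite <- norm_scal_pos by (left; now apply Rinv_0_lt_compat).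
     f_equal; module_eq. }
apply Rmult_le_compat_l with (r := h) in H2; [|lra].
rewrite <- !Rmult_assoc, Rinv_r, Rmult_minus_distr_l, Rinv_r in H2 by lra.
assert (K := exp_ineq1_le (growth * h)); unfold growth in *.
assert (N1 := vnorm_ge_0 u); assert (N2 := vnorm_ge_0 g).
assert (0 <= w * h) by (apply Rmult_le_pos; lra).
assert (K1 : 1 <= (1 + 2 * w * h) * (1 - w * h)) by nra.
assert (K2 : (1 + 2 * w * h) * vnorm g <= exp (2 * w * h) * vnorm g)
  by (apply Rmult_le_compat_r; lra).
apply Rle_trans with (2 := K2).
apply Rle_trans with ((1 + 2 * w * h) * ((1 - w * h) * vnorm u)).
- rewrite <- Rmult_assoc; rewrite <- (Rmult_1_l (vnorm u)) at 1.
  now apply Rmult_le_compat_r.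
- apply Rmult_le_compat_l; lra.
Qed.

Lemma resolvent_linear h : admissible h -> is_linear (resolvent h).
Proof.
intros Hh; apply linear_intro with (exp (growth * h)).
- intros x y; apply resolvent_unique; auto.
  assert (Hx := resolvent_spec h x Hh); assert (Hy := resolvent_spec h y Hh).
  set (u := resolvent h x) in *; set (v := resolvent h y) in *.
  replace ((/ h) [*] ((u [+] v) [-] (x [+] y))) with
    (((/ h) [*] (u [-] x)) [+] ((/ h) [*] (v [-] y)))
    by (destruct Hh; module_eq).
  now apply (md_plus _ _ HG).
- intros k x; apply resolvent_unique; auto.
  assert (Hx := resolvent_spec h x Hh); set (u := resolvent h x) in *.
  replace ((/ h) [*] ((k [*] u) [-] (k [*] x))) with
    (k [*] ((/ h) [*] (u [-] x))) by (destruct Hh; module_eq).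
  now apply (md_scal _ _ HG).
- apply exp_pos.
- intros x; now apply resolvent_norm.
Qed.

(* [k] implicit Euler steps of length [h]. *)
Let U (h : R) (k : nat) : X -> X := Nat.iter k (resolvent h).

Lemma euler_linear h k : admissible h -> is_linear (U h k).
Proof. intros Hh; now apply iter_linear, resolvent_linear. Qed.

Lemma euler_norm h k f : admissible h -> vnorm (U h k f) <= exp (growth * (INR k * h)) * vnorm f.
Proof.
intros Hh; replace (exp (growth * (INR k * h))) with (exp (growth * h) ^ k).
- apply iter_norm_le; [left; apply exp_pos|].
  intros x; now apply resolvent_norm.
- rewrite exp_pow; f_equal; ring.
Qed.

Lemma euler_norm_le h k t f :
  admissible h -> INR k * h <= t -> vnorm (U h k f) <= exp (growth * t) * vnorm f.
Proof.
intros Hh Ht; apply Rle_trans with (1 := euler_norm h k f Hh).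
apply Rmult_le_compat_r; [apply vnorm_ge_0|].
apply exp_le; apply Rmult_le_compat_l; unfold growth; lra.
Qed.

Lemma euler_comm h k f g : admissible h -> G (f, g) -> G (U h k f, U h k g).
Proof.
intros Hh Hf; induction k as [|k IH]; auto; simpl; now apply resolvent_comm.
Qed.

Lemma euler_add h k l f : U h (k + l) f = U h k (U h l f).
Proof. apply Nat.iter_add. Qed.

(** The increments of the scheme are [h] times the iterates applied to [g]. *)
Lemma euler_taylor h k f g eps :
  admissible h -> G (f, g) ->
  (forall j, (j <= k)%nat -> vnorm (U h j g [-] g) <= eps) ->
  vnorm ((U h k f [-] f) [-] ((INR k * h) [*] g)) <= INR k * h * eps.
Proof.
intros Hh Hf; induction k as [|k IH]; intros Heps.
- simpl; replace ((f [-] f) [-] ((0 * h) [*] g)) with (vzero : X)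
    by module_eq; rewrite vnorm_zero; lra.
- assert (IH' := IH (fun j Hj => Heps j (Nat.le_le_succ_r _ _ Hj))).
  assert (H1 := Heps (S k) (le_n _)).
  assert (H2 := resolvent_step h _ _ Hh (euler_comm h k f g Hh Hf)).
  change (U h (S k) f = U h k f [+] (h [*] (U h (S k) g))) in H2.
  rewrite H2, S_INR; set (u := U h k f) in *; set (v := U h (S k) g) in *.
  replace (((u [+] (h [*] v)) [-] f) [-] (((INR k + 1) * h) [*] g))
    with (((u [-] f) [-] ((INR k * h) [*] g)) [+] (h [*] (v [-] g)))
    by module_eq.
  apply Rle_trans with (1 := vnorm_triangle _ _); destruct Hh as [Hh1 Hh2].
  rewrite norm_scal_pos by lra.
  apply Rmult_le_compat_l with (r := h) in H1; lra.
Qed.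

Lemma euler_lipschitz h k f g t :
  admissible h -> G (f, g) -> INR k * h <= t ->
  vnorm (U h k f [-] f) <= INR k * h * (exp (growth * t) * vnorm g).
Proof.
intros Hh Hf; revert t; induction k as [|k IH]; intros t Ht.
- simpl; rewrite norm_minus_diag; lra.
- rewrite S_INR in Ht |- *; destruct (Hh) as [Hh1 Hh2].
  assert (IH' := IH t ltac:(lra)).
  assert (H2 := resolvent_step h _ _ Hh (euler_comm h k f g Hh Hf)).
  change (U h (S k) f = U h k f [+] (h [*] (U h (S k) g))) in H2.
  assert (H3 := euler_norm_le h (S k) t g Hh); rewrite S_INR in H3.
  specialize (H3 Ht).
  rewrite H2; set (u := U h k f) in *; set (v := U h (S k) g) in *.
  replace ((u [+] (h [*] v)) [-] f) with ((u [-] f) [+] (h [*] v))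
    by module_eq.
  apply Rle_trans with (1 := vnorm_triangle _ _).
  rewrite norm_scal_pos by lra.
  apply Rmult_le_compat_l with (r := h) in H3; lra.
Qed.

Lemma euler_modulus h k l f t d eps :
  admissible h -> 0 <= eps -> (forall j, INR j * h <= d -> vnorm (U h j f [-] f) <= eps) ->
  Rabs (INR k * h - INR l * h) <= d -> INR k * h <= t -> INR l * h <= t ->
  vnorm (U h k f [-] U h l f) <= exp (growth * t) * eps.
Proof.
intros Hh He HU.
assert (Hmain : forall k l, (k <= l)%nat -> INR l * h - INR k * h <= d ->
  INR k * h <= t -> vnorm (U h l f [-] U h k f) <= exp (growth * t) * eps).
{ clear k l; intros k l Hkl Hd Ht.
  replace l with (k + (l - k))%nat at 1 by lia; rewrite euler_add.
  rewrite <- linear_vminus by now apply euler_linear.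
  apply Rle_trans with (1 := euler_norm_le h k t _ Hh Ht).
  apply Rmult_le_compat_l; [left; apply exp_pos|].
  apply HU; rewrite minus_INR by auto; lra. }
intros Hd Hk Hl; apply Rabs_le_between in Hd.
destruct (Nat.le_ge_cases k l) as [L|L].
- rewrite norm_minus_sym; apply Hmain; auto; lra.
- apply Hmain; auto; lra.
Qed.

(** On the domain of [G^2] one step of length [m h] and [m] steps of length [h] both
    agree with [f + m h G f] up to order [(m h)^2]; telescoping adds [k] such
    errors. *)
Lemma euler_refine h m k f g g2 :
  admissible (INR m * h) -> admissible h -> G (f, g) -> G (g, g2) ->
  vnorm ((U (INR m * h) k f) [-] (U h (k * m) f))
  <= 2 * (INR k * (INR m * h)) * (INR m * h)
     * exp (growth * (INR k * (INR m * h))) * vnorm g2.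
Proof.
intros Hmh Hh Hf Hg; set (H := INR m * h) in *.
assert (E : forall i, Nat.iter i (U h m) f = U h (i * m) f).
{ induction i as [|i IH]; auto; simpl; rewrite IH; symmetry; apply euler_add. }
rewrite <- E.
apply Rle_trans with (INR k * (2 * H ^ 2 * vnorm g2) * exp (growth * H) ^ k).
2: { rewrite exp_pow; right.
     replace (INR k * (growth * H)) with (growth * (INR k * H)) by ring; ring. }
apply iter_telescope with (P := resolvent H).
- now apply resolvent_linear.
- left; apply exp_pos.
- intros x; now apply resolvent_norm.
- intros j Hj; rewrite E.
  set (fj := U h (j * m) f); set (gj := U h (j * m) g).
  set (g2j := U h (j * m) g2).
  assert (Hfj : G (fj, gj)) by now apply euler_comm.
  assert (Hgj : G (gj, g2j)) by now apply euler_comm.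
  assert (B : vnorm g2j <= exp (growth * H) ^ j * vnorm g2).
  { apply Rle_trans with (1 := euler_norm h (j * m) g2 Hh).
    rewrite exp_pow, mult_INR; right; f_equal; f_equal; unfold H; ring. }
  assert (T : forall h' i, admissible h' -> INR i * h' = H ->
    vnorm ((U h' i fj [-] fj) [-] (H [*] gj))
      <= H * (H * (exp (growth * H) * vnorm g2j))).
  { intros h' i Hh' <-; apply euler_taylor; auto; intros l Hl.
    assert (Hl' : INR l * h' <= INR i * h').
    { apply Rmult_le_compat_r; [apply Rlt_le, Hh'|now apply le_INR]. }
    apply Rle_trans with (1 := euler_lipschitz h' l gj g2j _ Hh' Hgj Hl').
    apply Rmult_le_compat_r; auto.
    apply Rmult_le_pos; [left; apply exp_pos | apply vnorm_ge_0]. }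
  assert (T1 := T H 1%nat Hmh (Rmult_1_l H)).
  assert (T2 := T h m Hh eq_refl).
  change (U H 1 fj) with (resolvent H fj) in T1.
  set (p := resolvent H fj) in *; set (q := U h m fj) in *.
  replace (p [-] q) with (((p [-] fj) [-] (H [*] gj)) [-] ((q [-] fj) [-] (H [*] gj))) by module_eq.
  assert (Tr : forall x y : X, vnorm (x [-] y) <= vnorm x + vnorm y).
  { intros x y; apply Rle_trans with (1 := vnorm_triangle _ _).
    rewrite (vnorm_opp y); lra. }
  apply Rle_trans with (1 := Tr _ _).
  apply Rle_trans with (2 * (H * (H * (exp (growth * H) * vnorm g2j)))); [lra|].
  apply Rmult_le_compat_l with (r := 2 * H ^ 2 * exp (growth * H)) in B.
  + simpl in B |- *; lra.
  + apply Rmult_le_pos; [|left; apply exp_pos].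
    assert (0 <= H ^ 2) by apply pow2_ge_0; lra.
Qed.


(* Dyadic steps: each scheme is refined by all the later ones. *)
Let step (n : nat) : R := / (2 * w + 1) / 2 ^ n.

Lemma step_pos n : 0 < step n.
Proof.
apply Rdiv_lt_0_compat; [apply Rinv_0_lt_compat; lra | apply pow_lt; lra].
Qed.

Lemma step_le n : step n <= / (2 * w + 1).
Proof.
assert (K : 0 < / (2 * w + 1)) by (apply Rinv_0_lt_compat; lra).
unfold step, Rdiv; rewrite <- (Rmult_1_r (/ (2 * w + 1))) at 2.
apply Rmult_le_compat_l; [lra|].
rewrite <- Rinv_1; apply Rinv_le_contravar; [lra | apply pow_R1_Rle; lra].
Qed.

Lemma step_le_1 n : step n <= 1.
Proof.
apply Rle_trans with (1 := step_le n).
rewrite <- Rinv_1; apply Rinv_le_contravar; lra.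
Qed.

Lemma step_admissible n : admissible (step n).
Proof.
split; [apply step_pos|].
apply Rle_trans with (2 * w * / (2 * w + 1)).
- apply Rmult_le_compat_l; [lra | apply step_le].
- apply Rmult_le_reg_r with (2 * w + 1); [lra|].
  rewrite Rmult_assoc, Rinv_l; lra.
Qed.

Lemma step_refine n m : (n <= m)%nat -> step n = INR (2 ^ (m - n)) * step m.
Proof.
intros Hnm; rewrite pow_INR; unfold step.
replace (2 ^ m) with (2 ^ (m - n) * 2 ^ n)
  by (rewrite <- pow_add; f_equal; lia).
assert (2 ^ n <> 0) by (apply pow_nonzero; lra).
assert (2 ^ (m - n) <> 0) by (apply pow_nonzero; lra).
simpl INR; replace (1 + 1) with 2 by ring; field; repeat split; auto; lra.
Qed.

Lemma step_lim : is_lim_seq step 0.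
Proof.
apply is_lim_seq_ext with (fun n => / (2 * w + 1) * (/ 2) ^ n).
- intros n; unfold step; rewrite pow_inv; auto.
- replace (Finite 0) with (Rbar_mult (/ (2 * w + 1)) 0)
    by (simpl; f_equal; ring).
  apply is_lim_seq_scal_l, is_lim_seq_geom; rewrite Rabs_pos_eq; lra.
Qed.

Lemma step_small eps : 0 < eps -> eventually (fun n => step n <= eps).
Proof.
intros He; assert (H := step_lim); apply is_lim_seq_spec in H.
refine (filter_imp _ _ _ (H (mkposreal _ He))); simpl; intros n Hn.
rewrite Rminus_0_r in Hn; apply Rabs_def2 in Hn; lra.
Qed.

Let idx (n : nat) (t : R) : nat := Z.to_nat (Int_part (t / step n)).

Lemma idx_spec n t :
  0 <= t -> INR (idx n t) * step n <= t < INR (idx n t) * step n + step n.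
Proof.
intros Ht; assert (Hs := step_pos n); unfold idx.
destruct (base_Int_part (t / step n)) as [H1 H2].
assert (H0 : 0 <= t / step n) by (apply Rdiv_le_0_compat; lra).
assert (HZ : (0 <= Int_part (t / step n))%Z).
{ apply Z.lt_succ_r, lt_IZR; rewrite succ_IZR; lra. }
rewrite INR_IZR_INZ, Z2Nat.id by auto.
assert (E : t / step n * step n = t) by (field; lra).
split; [rewrite <- E at 2; apply Rmult_le_compat_r; lra|].
assert (t / step n * step n < (IZR (Int_part (t / step n)) + 1) * step n)
  by (apply Rmult_lt_compat_r; lra).
lra.
Qed.

Lemma idx_lim t : 0 <= t -> is_lim_seq (fun n => INR (idx n t) * step n) t.
Proof.
intros Ht; apply is_lim_seq_le_le with (fun n => t - step n) (fun _ => t).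
- intros n; destruct (idx_spec n t Ht); lra.
- replace (Finite t) with (Finite (t - 0)) by (f_equal; ring).
  apply is_lim_seq_minus'; [apply is_lim_seq_const | apply step_lim].
- apply is_lim_seq_const.
Qed.

(** The resolvent maps the domain of [G] into that of [G^2] and is close to the
    identity on it for a small step. *)
Lemma md_dense2 f eps : 0 < eps ->
  exists u v v2, G (u, v) /\ G (v, v2) /\ vnorm (u [-] f) < eps.
Proof.
intros He; assert (He2 : 0 < eps / 2) by lra.
destruct (md_dense _ _ HG f _ He2) as (u & v & Huv & Hu).
destruct (small_factor (exp (growth * 1) * vnorm v) (eps / 2)) as (d & Hd & Hsm);
  [apply Rmult_le_pos; [left; apply exp_pos | apply vnorm_ge_0] | lra |].
destruct (filter_ex (F := eventually) _ (step_small d Hd)) as [n Hn].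
assert (Ha := step_admissible n); set (h := step n) in *.
exists (resolvent h u), (resolvent h v), (/ h [*] (resolvent h v [-] v)).
split; [now apply resolvent_comm|]; split; [now apply resolvent_spec|].
apply Rle_lt_trans with (1 := norm_minus_triangle u _ _).
assert (L := euler_lipschitz h 1 u v 1 Ha Huv).
simpl INR in L; rewrite Rmult_1_l in L.
specialize (L (step_le_1 n)); specialize (Hsm h ltac:(destruct Ha; lra)).
change (U h 1 u) with (resolvent h u) in L; lra.
Qed.

Lemma euler_equicontinuous f eps : 0 < eps ->
  exists d, 0 < d /\ forall h k, admissible h -> INR k * h <= d ->
    vnorm (U h k f [-] f) <= eps.
Proof.
intros He; set (M := exp (growth * 1)).
assert (HM : 0 < M) by apply exp_pos.
destruct (small_factor (M + 1) (eps / 2)) as (d1 & Hd1 & S1); [lra | lra|].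
destruct (md_dense _ _ HG f _ Hd1) as (u & v & Huv & Hu).
destruct (small_factor (M * vnorm v) (eps / 2)) as (d & Hd & S2);
  [apply Rmult_le_pos; [lra | apply vnorm_ge_0] | lra |].
exists (Rmin 1 d); split; [apply Rmin_pos; lra|]; intros h k Hh Hk.
destruct (le_Rmin _ _ _ Hk) as [Hk1 Hk2].
assert (L1 := euler_norm_le h k 1 (f [-] u) Hh Hk1).
assert (L2 := euler_lipschitz h k u v 1 Hh Huv Hk1); fold M in L1, L2.
rewrite (linear_vminus (U h k)) in L1 by now apply euler_linear.
rewrite (norm_minus_sym f u) in L1.
replace (U h k f [-] f)
  with ((U h k f [-] U h k u) [+] (U h k u [-] u) [+] (u [-] f)) by module_eq.
apply Rle_trans with (1 := vnorm_triangle _ _).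
assert (T := vnorm_triangle (U h k f [-] U h k u) (U h k u [-] u)).
specialize (S1 _ (conj (vnorm_ge_0 (u [-] f)) (Rlt_le _ _ Hu))).
assert (P : 0 <= INR k * h)
  by (apply Rmult_le_pos; [apply pos_INR | destruct Hh; lra]).
specialize (S2 _ (conj P Hk2)); lra.
Qed.

(** For data in the domain of [G^2] the schemes form a Cauchy sequence by
    [euler_refine], up to the rounding of [t] to a multiple of the step; all the
    iterates are bounded on bounded times, so density gives the rest. *)
Lemma euler_converges t f : 0 <= t ->
  exists l, filterlim (fun n => U (step n) (idx n t) f) eventually (locally l).
Proof.
intros Ht; apply cauchy_seq_lim; intros eps He.
set (M := exp (growth * t)); assert (HM : 0 < M) by apply exp_pos.
destruct (small_factor M (eps / 4)) as (e1 & He1 & S1); [lra | lra|].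
destruct (md_dense2 f _ He1) as (u & v & v2 & Hu & Hv & Huf).
destruct (euler_equicontinuous u _ He1) as (d & Hd & Heq).
destruct (small_factor (2 * t * M * vnorm v2) (eps / 4)) as (e2 & He2 & S2);
  [repeat apply Rmult_le_pos; try lra; apply vnorm_ge_0 | lra |].
destruct (filter_and _ _ (step_small _ He2) (step_small (d / 2) ltac:(lra)))
  as [N HN].
exists N; intros n m Hn Hm.
destruct (HN n Hn) as [Hn1 Hn2]; clear HN.
assert (An := step_admissible n); assert (Am := step_admissible m).
set (k := idx n t); set (l := idx m t).
destruct (idx_spec n t Ht) as [Hk1 Hk2]; fold k in Hk1, Hk2.
destruct (idx_spec m t Ht) as [Hl1 Hl2]; fold l in Hl1, Hl2.
assert (Hnm := step_refine n m Hm); set (p := (2 ^ (m - n))%nat) in *.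
assert (B1 : vnorm (U (step n) k u [-] U (step m) (k * p) u) <= eps / 4).
{ assert (K := euler_refine (step m) p k u v v2); rewrite <- Hnm in K.
  apply Rle_trans with (1 := K An Am Hu Hv); clear K.
  assert (K0 : 0 <= INR k * step n)
    by (apply Rmult_le_pos; [apply pos_INR | apply Rlt_le, step_pos]).
  assert (Kn := vnorm_ge_0 v2); assert (Ks := step_pos n).
  assert (Ke : exp (growth * (INR k * step n)) <= M).
  { apply exp_le, Rmult_le_compat_l; auto; unfold growth; lra. }
  apply Rle_trans with (2 * t * step n * M * vnorm v2).
  - apply Rmult_le_compat_r; auto; apply Rmult_le_compat.
    + apply Rmult_le_pos; lra.
    + left; apply exp_pos.
    + apply Rmult_le_compat_r; lra.
    + auto.
  - specialize (S2 (step n) (conj (Rlt_le _ _ Ks) Hn1)); lra. }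
assert (B2 : vnorm (U (step m) (k * p) u [-] U (step m) l u) <= eps / 4).
{ assert (E : INR (k * p) * step m = INR k * step n)
    by (rewrite mult_INR, Hnm; ring).
  assert (K := euler_modulus (step m) (k * p) l u t d e1 Am).
  specialize (S1 e1 ltac:(lra)); rewrite E in K; fold M in K.
  apply Rle_trans with (M * e1); [apply K; auto; try lra | lra].
  assert (step m <= step n).
  { rewrite Hnm; rewrite <- (Rmult_1_l (step m)) at 1.
    apply Rmult_le_compat_r; [apply Rlt_le, step_pos|].
    change 1 with (INR 1); apply le_INR; unfold p.
    assert (2 ^ (m - n) <> 0)%nat by (apply Nat.pow_nonzero; lia); lia. }
  apply Rabs_le_between; lra. }
assert (B3 : forall h j, admissible h -> INR j * h <= t ->
  vnorm (U h j f [-] U h j u) <= eps / 4).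
{ intros h j Hh Hj; rewrite <- linear_vminus by now apply euler_linear.
  apply Rle_trans with (1 := euler_norm_le h j t _ Hh Hj); fold M.
  rewrite norm_minus_sym.
  left; apply S1; split; [apply vnorm_ge_0 | lra]. }
assert (B4 := B3 _ _ An Hk1); assert (B5 := B3 _ _ Am Hl1).
rewrite norm_minus_sym in B5.
apply Rle_trans with (1 := norm_minus_triangle (U (step n) k u) _ _).
assert (T1 := norm_minus_triangle (U (step m) (k * p) u)
  (U (step n) k u) (U (step m) l f)).
assert (T2 := norm_minus_triangle (U (step m) l u)
  (U (step m) (k * p) u) (U (step m) l f)).
lra.
Qed.

Definition euler_limit (t : R) (f : X) : X :=
  epsilon (inhabits vzero)
    (fun l => filterlim (fun n => U (step n) (idx n t) f) eventually (locally l)).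

Let V := euler_limit.

Lemma euler_limit_lim t f : 0 <= t ->
  filterlim (fun n => U (step n) (idx n t) f) eventually (locally (V t f)).
Proof.
intros Ht; exact (epsilon_spec (inhabits vzero)
  (fun l => filterlim (fun n => U (step n) (idx n t) f) eventually (locally l))
  (euler_converges t f Ht)).
Qed.

Lemma euler_limit_norm t f : 0 <= t -> vnorm (V t f) <= exp (growth * t) * vnorm f.
Proof.
intros Ht; apply (lim_norm_le_0 _ _ _ (euler_limit_lim t f Ht)).
exists 0%nat; intros n _; apply euler_norm_le; [apply step_admissible|].
now apply idx_spec.
Qed.

Lemma euler_limit_linear t : 0 <= t -> is_linear (V t).
Proof.
intros Ht; apply linear_intro with (exp (growth * t)).
- intros x y; apply (lim_unique (fun n => U (step n) (idx n t) (x [+] y)));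
    [now apply euler_limit_lim|].
  replace (V t x [+] V t y) with (V t x [-] (vzero [-] V t y)) by module_eq.
  apply filterlim_ext with (fun n => U (step n) (idx n t) x [-]
    (vzero [-] U (step n) (idx n t) y)).
  + intros n; rewrite linear_vplus by apply euler_linear, step_admissible; module_eq.
  + apply lim_minus; [now apply euler_limit_lim|].
    apply lim_minus; [apply lim_const | now apply euler_limit_lim].
- intros k x; apply (lim_unique (fun n => U (step n) (idx n t) (k [*] x)));
    [now apply euler_limit_lim|].
  apply filterlim_ext with (fun n => k [*] U (step n) (idx n t) x).
  + intros n; rewrite linear_vscal by apply euler_linear, step_admissible; auto.
  + apply (lim_linear (fun z => k [*] z)); [|now apply euler_limit_lim].
    apply linear_intro with (Rabs k + 1).
    * intros; module_eq.
    * intros; module_eq.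
    * assert (P := Rabs_pos k); lra.
    * intros z; rewrite norm_scal_R; assert (P := vnorm_ge_0 z).
      apply Rmult_le_compat_r; lra.
- apply exp_pos.
- intros x; now apply euler_limit_norm.
Qed.

Lemma euler_limit_modulus f eps : 0 < eps -> exists d, 0 < d /\
  forall s t T, 0 <= s <= T -> 0 <= t <= T -> Rabs (s - t) <= d ->
  vnorm (V s f [-] V t f) <= exp (growth * T) * eps.
Proof.
intros He; destruct (euler_equicontinuous f _ He) as (d & Hd & Heq).
exists (d / 2); split; [lra|]; intros s t T Hs Ht Hst.
apply (lim_norm_le_0 (fun n => U (step n) (idx n s) f [-] U (step n) (idx n t) f)).
- apply lim_minus; apply euler_limit_lim; lra.
- refine (filter_imp (F := eventually) _ _ _ (step_small (d / 2) ltac:(lra))).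
  intros n Hn.
  destruct (idx_spec n s) as [S1 S2]; [lra|].
  destruct (idx_spec n t) as [T1 T2]; [lra|].
  apply Rabs_le_between in Hst.
  apply (euler_modulus (step n)) with d; try lra.
  + apply step_admissible.
  + intros j; apply Heq, step_admissible.
  + apply Rabs_le_between; lra.
Qed.

Lemma euler_limit_zero f : V 0 f = f.
Proof.
apply (lim_unique (fun n => U (step n) (idx n 0) f)).
- apply euler_limit_lim; lra.
- apply filterlim_ext with (fun _ : nat => f); [|apply lim_const].
  intros n; destruct (idx_spec n 0 (Rle_refl 0)) as [H _].
  assert (Hs := step_pos n).
  destruct (idx n 0) as [|k]; auto; exfalso.
  assert (0 < INR (S k) * step n)
    by (apply Rmult_lt_0_compat; auto; apply lt_0_INR; lia).
  lra.
Qed.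

(** The numbers of steps for [t], [s] and [t + s] are additive up to one step, which
    equicontinuity makes negligible. *)
Lemma euler_limit_add t s f : 0 <= t -> 0 <= s -> V (t + s) f = V t (V s f).
Proof.
intros Ht Hs.
apply (lim_unique (fun n => U (step n) (idx n (t + s)) f)).
- apply euler_limit_lim; lra.
- apply filterlim_vnorm; [apply _|]; intros eps He.
  set (M := exp (growth * (t + s))); assert (HM : 0 < M) by apply exp_pos.
  assert (He4 : 0 < eps / 4) by lra.
  destruct (small_factor M (eps / 4) (Rlt_le _ _ HM) He4) as (e & He3 & Sm).
  destruct (euler_equicontinuous f _ He3) as (d & Hd & Heq).
  assert (Hd2 : 0 < d / 2) by lra.
  refine (filter_imp (F := eventually) _ _ _ (filter_and _ _
    (step_small (d / 2) Hd2) (filter_and _ _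
    (proj1 (filterlim_vnorm eventually _ _) (euler_limit_lim s f Hs) _ He3)
    (proj1 (filterlim_vnorm eventually _ _) (euler_limit_lim t (V s f) Ht) _ He4)))).
  intros n [Hn [H1 H2]].
  assert (An := step_admissible n); assert (Ps := step_pos n).
  destruct (idx_spec n s Hs) as [S1 S2].
  destruct (idx_spec n t Ht) as [T1 T2].
  destruct (idx_spec n (t + s)) as [W1 W2]; [lra|].
  set (k := idx n t) in *; set (l := idx n s) in *;
  set (m := idx n (t + s)) in *; set (h := step n) in *.
  assert (B1 : vnorm (U h m f [-] U h (k + l) f) <= eps / 4).
  { specialize (Sm e ltac:(lra)); apply Rle_trans with (M * e); [|lra].
    apply euler_modulus with d; rewrite ?plus_INR; auto; try lra.
    apply Rabs_le_between; lra. }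
  rewrite euler_add in B1.
  assert (B2 : vnorm (U h k (U h l f) [-] U h k (V s f)) <= eps / 4).
  { rewrite <- linear_vminus by now apply euler_linear.
    assert (Hk : INR k * h <= t + s) by lra.
    apply Rle_trans with (1 := euler_norm_le h k (t + s) _ An Hk); fold M.
    left; apply Sm; split; [apply vnorm_ge_0 | lra]. }
  apply Rle_lt_trans with (1 := norm_minus_triangle (U h k (U h l f)) _ _).
  assert (K := norm_minus_triangle (U h k (V s f)) (U h k (U h l f)) (V t (V s f))).
  lra.
Qed.

Lemma euler_limit_taylor f g eps : G (f, g) -> 0 < eps ->
  exists d, 0 < d /\ forall t, 0 < t < d ->
    vnorm (V t f [-] f [-] t [*] g) <= eps * t.
Proof.
intros Hf He; destruct (euler_equicontinuous g _ He) as (d & Hd & Heq).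
exists d; split; auto; intros t Ht.
apply (lim_norm_le_0 (fun n => U (step n) (idx n t) f [-] f
  [-] (INR (idx n t) * step n) [*] g)).
- apply lim_minus.
  + apply lim_minus; [apply euler_limit_lim; lra | apply lim_const].
  + apply (lim_scal (fun n => INR (idx n t) * step n)), idx_lim; lra.
- exists 0%nat; intros n _; destruct (idx_spec n t) as [T1 T2]; [lra|].
  assert (An := step_admissible n).
  apply Rle_trans with (INR (idx n t) * step n * eps).
  + apply euler_taylor; auto; intros j Hj; apply Heq; auto.
    apply Rle_trans with (INR (idx n t) * step n); [|lra].
    apply Rmult_le_compat_r; [apply Rlt_le, step_pos | now apply le_INR].
  + rewrite Rmult_comm; apply Rmult_le_compat_l; lra.
Qed.

End Hille_Yosida.

(** The difference quotients spelled out, without division. *)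
Lemma generator_iff {X : CompleteNormedModule R_AbsRing} (V : R -> X -> X)
  (f g : X) :
  generator V (f, g) <->
  forall eps, 0 < eps -> exists d, 0 < d /\ forall t, 0 < t < d ->
    vnorm (V t f [-] f [-] t [*] g) <= eps * t.
Proof.
assert (E : forall t, 0 < t ->
  vnorm (/ t [*] (V t f [-] f) [-] g) = / t * vnorm (V t f [-] f [-] t [*] g)).
{ intros t Ht; rewrite <- norm_scal_pos by (left; now apply Rinv_0_lt_compat).
  f_equal; module_eq. }
unfold generator; simpl fst; simpl snd.
assert (L := filterlim_vnorm (at_right 0) (fun t => / t [*] (V t f [-] f)) g).
split.
- intros H eps He; destruct (proj1 L H eps He) as [d Hd].
  exists d; split; [apply cond_pos|]; intros t Ht.
  assert (K : vnorm (/ t [*] (V t f [-] f) [-] g) < eps).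
  { apply Hd; [|lra]; change (Rabs (t - 0) < d).
    rewrite Rminus_0_r, Rabs_pos_eq; lra. }
  rewrite E in K by lra; apply Rmult_lt_compat_l with (r := t) in K; [|lra].
  rewrite <- Rmult_assoc, Rinv_r, Rmult_1_l in K; lra.
- intros H; apply L; intros eps He.
  destruct (H (eps / 2)) as (d & Hd & Hdt); [lra|].
  exists (mkposreal d Hd); intros t Ht Ht0.
  change (Rabs (t - 0) < d) in Ht.
  rewrite Rminus_0_r in Ht; apply Rabs_def2 in Ht.
  rewrite E by lra; specialize (Hdt t ltac:(lra)).
  apply Rmult_lt_reg_l with t; [lra|].
  rewrite <- Rmult_assoc, Rinv_r, Rmult_1_l by lra.
  assert (0 < t * eps) by (apply Rmult_lt_0_compat; lra); lra.
Qed.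

(** The limit of the Euler schemes. Its generator extends [G]; it cannot be larger,
    because [mu - G] is onto while [mu] minus the generator is injective for large
    [mu]. *)
Theorem hille_yosida {X : CompleteNormedModule R_AbsRing} (w : R)
  (G : graph X) :
  0 <= w -> m_dissipative w G -> exists V, generates G V.
Proof.
intros Hw HG; exists (euler_limit w G).
set (V := euler_limit w G).
assert (HGV : forall f g, G (f, g) -> generator V (f, g)).
{ intros f g Hf; apply generator_iff; intros eps; now apply euler_limit_taylor. }
split.
- split.
  + intros t Ht; now apply (euler_limit_linear w G Hw HG).
  + intros f; now apply (euler_limit_zero w G Hw HG).
  + intros t s Ht Hs f; now apply (euler_limit_add w G Hw HG).
  + intros f t Ht; apply (filterlim_vnorm _ (fun s => V s f)).
    intros eps He; set (M := exp (2 * w * (t + 1))).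
    assert (HM : 0 < M) by apply exp_pos.
    destruct (small_factor M eps (Rlt_le _ _ HM) He) as (e & He1 & Sm).
    destruct (euler_limit_modulus w G Hw HG f _ He1) as (d & Hd & HV).
    assert (Hd1 : 0 < Rmin d 1) by (apply Rmin_pos; lra).
    exists (mkposreal _ Hd1); simpl; intros s Hst Hs.
    change (Rabs (s - t) < Rmin d 1) in Hst.
    destruct (lt_Rmin _ _ _ Hst) as [L1 L2].
    apply Rabs_def2 in L2.
    specialize (HV s t (t + 1) ltac:(lra) ltac:(lra) ltac:(lra)).
    specialize (Sm e ltac:(lra)); fold M V in HV; lra.
- intros [f g]; split; [apply HGV|]; intros Hfg.
  (* Compare with the solution [f'] of [(mu - G) f' = mu f - g]. *)
  set (mu := 2 * w + 1).
  destruct (md_range _ _ HG mu (mu [*] f [-] g)) as [f' Hf'];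
    [unfold mu; lra|].
  replace (mu [*] f' [-] (mu [*] f [-] g))
    with (g [+] mu [*] (f' [-] f)) in Hf' by module_eq.
  enough (E : f' = f).
  { rewrite E in Hf'.
    now replace (g [+] mu [*] (f [-] f)) with g in Hf' by module_eq. }
  apply norm_minus_eq_zero; set (u := f' [-] f) in *.
  apply le_epsilon; intros eps He; rewrite Rplus_0_l.
  assert (Hu : generator V (u, mu [*] u)).
  { apply generator_iff; intros e Hee; assert (He2 : 0 < e / 2) by lra.
    destruct (proj1 (generator_iff V _ _) (HGV _ _ Hf') _ He2)
      as (d1 & Hd1 & H1).
    destruct (proj1 (generator_iff V _ _) Hfg _ He2) as (d2 & Hd2 & H2).
    exists (Rmin d1 d2); split; [now apply Rmin_pos|]; intros t Ht.
    destruct (lt_Rmin _ _ _ (proj2 Ht)) as [L1 L2].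
    specialize (H1 t ltac:(lra)); specialize (H2 t ltac:(lra)).
    replace (V t u [-] u [-] t [*] (mu [*] u)) with
      ((V t f' [-] f' [-] t [*] (g [+] mu [*] u))
       [+] vopp (V t f [-] f [-] t [*] g)).
    - apply Rle_trans with (1 := vnorm_triangle _ _); rewrite vnorm_opp; lra.
    - assert (EV : V t u = V t f' [-] V t f).
      { apply linear_vminus, (euler_limit_linear w G Hw HG); lra. }
      rewrite EV; unfold u; module_eq. }
  destruct (proj1 (generator_iff V _ _) Hu (eps / 2)) as (d & Hd & H); [lra|].
  (* Growth at rate [mu] contradicts the bound at rate [2 w < mu]. *)
  set (t := Rmin (d / 2) (/ (2 * (mu * mu + 1)))).
  assert (Hmu : 1 <= mu) by (unfold mu; lra).
  assert (Hi : 0 < / (2 * (mu * mu + 1))) by (apply Rinv_0_lt_compat; nra).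
  assert (Ht : 0 < t) by (apply Rmin_pos; lra).
  assert (Ht1 : t <= d / 2) by apply Rmin_l.
  assert (Ht2 : t * (2 * (mu * mu + 1)) <= 1).
  { apply Rmult_le_reg_r with (/ (2 * (mu * mu + 1))); auto.
    rewrite Rmult_assoc, Rinv_r, Rmult_1_r, Rmult_1_l by nra; apply Rmin_r. }
  specialize (H t ltac:(lra)).
  assert (B := euler_limit_norm w G Hw HG t u (Rlt_le _ _ Ht)); fold V in B.
  assert (Hk : exp (2 * w * t) * (1 - 2 * w * t) <= 1).
  { assert (K := exp_ineq1_le (- (2 * w * t))).
    rewrite exp_Ropp in K; assert (P := exp_pos (2 * w * t)).
    apply Rmult_le_compat_l with (r := exp (2 * w * t)) in K; [|lra].
    rewrite Rinv_r in K by lra; lra. }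
  assert (N := vnorm_ge_0 u).
  assert (B2 : (1 + mu * t) * vnorm u <= vnorm (V t u) + eps / 2 * t).
  { rewrite <- norm_scal_pos by nra.
    replace ((1 + mu * t) [*] u)
      with (V t u [+] vopp (V t u [-] u [-] t [*] (mu [*] u))) by module_eq.
    apply Rle_trans with (1 := vnorm_triangle _ _); rewrite vnorm_opp; lra. }
  set (r := vnorm u) in *; set (x := 2 * w * t) in *.
  assert (Hx : mu * t = x + t) by (unfold mu, x; ring).
  assert (Hx0 : 0 <= x) by (unfold x; nra).
  assert (Hx1 : (x + t) * x <= t / 2).
  { rewrite <- Hx; replace x with (mu * t - t) by lra; nra. }
  assert (Hx2 : x <= 1) by (unfold x in *; nra).
  assert (B3 : exp x * r * (1 - x) <= r).
  { replace (exp x * r * (1 - x)) with (exp x * (1 - x) * r) by ring; nra. }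
  assert (B4 : (1 + mu * t) * r * (1 - x) <= r + eps / 2 * t).
  { apply Rle_trans with ((vnorm (V t u) + eps / 2 * t) * (1 - x)).
    - apply Rmult_le_compat_r; lra.
    - assert (vnorm (V t u) * (1 - x) <= exp x * r * (1 - x))
        by (apply Rmult_le_compat_r; lra).
      assert (0 <= eps / 2 * t * x) by (repeat apply Rmult_le_pos; lra).
      lra. }
  rewrite Hx in B4.
  apply Rmult_le_reg_r with (t / 2); [lra|].
  assert ((x + t) * x * r <= t / 2 * r) by (apply Rmult_le_compat_r; lra).
  lra.
Qed.

(** * Semigroups with a given generator *)

Lemma real_induction (P : R -> Prop) (T : R) :
  0 <= T ->
  (forall t, 0 <= t <= T -> (forall s, 0 <= s < t -> P s) -> P t) ->
  (forall t, 0 <= t < T -> P t ->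
     exists d, 0 < d /\ forall s, 0 < s < d -> P (t + s)) ->
  P T.
Proof.
intros HT Hclosed Hopen.
set (E := fun s => 0 <= s <= T /\ forall r, 0 <= r <= s -> P r).
assert (H0 : E 0).
{ split; [lra|]; intros r Hr; apply Hclosed; [lra|]; intros; lra. }
destruct (completeness E) as [m [Hub Hlub]].
- exists T; intros s [Hs _]; lra.
- now exists 0.
- assert (Hm0 : 0 <= m) by (apply Hub, H0).
  assert (HmT : m <= T) by (apply Hlub; intros s [Hs _]; lra).
  assert (Hlt : forall r, 0 <= r < m -> P r).
  { intros r Hr; destruct (Classical_Prop.classic (exists s, E s /\ r < s))
      as [[s [[_ Hs] Hrs]]|Hn]; [apply Hs; lra|].
    exfalso; assert (m <= r); [|lra].
    apply Hlub; intros s Hs; apply Rnot_lt_le; intros Hrs.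
    apply Hn; now exists s. }
  assert (Hm : P m) by (apply Hclosed; [lra | auto]).
  destruct (Rle_lt_or_eq_dec _ _ HmT) as [Hlt' | <-]; auto.
  destruct (Hopen m) as (d & Hd & HP); auto.
  set (e := Rmin (d / 2) (T - m)).
  assert (He : 0 < e) by (apply Rmin_pos; lra).
  assert (He1 : e <= d / 2) by apply Rmin_l.
  assert (He2 : e <= T - m) by apply Rmin_r.
  exfalso; assert (m + e <= m); [|lra].
  apply Hub; split; [lra|]; intros r Hr.
  destruct (Rle_lt_dec r m) as [Hr1|Hr1].
  + destruct (Req_dec r m) as [->|Hne]; auto; apply Hlt; lra.
  + replace r with (m + (r - m)) by ring; apply HP; lra.
Qed.

(** Only right difference quotients are bounded: for an abstract semigroup the left
    ones are not accessible before a bound that is uniform in time is known. *)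
Lemma dini_le (phi : R -> R) (K T : R) :
  0 <= T ->
  (forall t eps, 0 <= t <= T -> 0 < eps -> exists d, 0 < d /\
     forall s, 0 <= s <= T -> Rabs (s - t) < d -> Rabs (phi s - phi t) < eps) ->
  (forall t eps, 0 <= t < T -> 0 < eps -> exists d, 0 < d /\
     forall s, 0 < s < d -> t + s <= T -> phi (t + s) <= phi t + s * (K + eps)) ->
  phi T <= phi 0 + T * K.
Proof.
intros HT Hc Hd; apply le_epsilon; intros eps Heps.
set (e := eps / (T + 1)).
assert (He : 0 < e) by (apply Rdiv_lt_0_compat; lra).
assert (HeT : T * e <= eps).
{ apply Rle_trans with ((T + 1) * e); [apply Rmult_le_compat_r; lra|].
  right; unfold e; field; lra. }
enough (phi T <= phi 0 + T * (K + e)) by lra.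
apply (real_induction (fun t => t <= T -> phi t <= phi 0 + t * (K + e)) T);
  auto; [| |lra].
- intros t Ht IH _; apply le_epsilon; intros x Hx.
  destruct (Req_dec t 0) as [->|Ht0]; [lra|].
  destruct (Hc t (x / 2) Ht ltac:(lra)) as (d & Hd0 & Hs).
  destruct (small_factor (Rabs (K + e)) (x / 2) (Rabs_pos _) ltac:(lra))
    as (z & Hz & Sm).
  set (s0 := Rmin (Rmin (d / 2) t) z).
  assert (P0 : 0 < s0) by (apply Rmin_pos; [apply Rmin_pos|]; lra).
  destruct (le_Rmin _ _ _ (Rle_refl s0)) as [P12 P3].
  destruct (le_Rmin _ _ _ P12) as [P1 P2].
  specialize (Sm s0 ltac:(lra)).
  specialize (IH (t - s0) ltac:(lra) ltac:(lra)).
  specialize (Hs (t - s0) ltac:(lra)).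
  replace (t - s0 - t) with (- s0) in Hs by ring.
  rewrite Rabs_Ropp, (Rabs_pos_eq s0) in Hs by lra.
  specialize (Hs ltac:(lra)); apply Rabs_def2 in Hs.
  assert (Q := Rabs_le_between (K + e) (Rabs (K + e))).
  destruct (proj1 Q (Rle_refl _)) as [Q1 _].
  assert (- (s0 * Rabs (K + e)) <= s0 * (K + e)) by nra.
  lra.
- intros t Ht IH; destruct (Hd t e Ht He) as (d & Hd0 & Hs).
  exists d; split; auto; intros s Hs1 Hs2.
  specialize (Hs s Hs1 Hs2); specialize (IH ltac:(lra)); lra.
Qed.

Lemma exp_neg_le x : 0 <= x -> exp (- x) <= 1 - x + x * x.
Proof.
intros Hx; rewrite exp_Ropp; assert (K := exp_ineq1_le x).
apply Rle_trans with (/ (1 + x)); [apply Rinv_le_contravar; lra|].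
apply Rmult_le_reg_r with (1 + x); [lra|]; rewrite Rinv_l by lra.
assert (0 <= x * x * x) by (repeat apply Rmult_le_pos; lra); nra.
Qed.

Lemma mean_value_inequality {X : CompleteNormedModule R_AbsRing}
  (u : R -> X) (K T : R) :
  0 <= T ->
  (forall t eps, 0 <= t <= T -> 0 < eps -> exists d, 0 < d /\
     forall s, 0 <= s <= T -> Rabs (s - t) < d -> vnorm (u s [-] u t) < eps) ->
  (forall t eps, 0 <= t < T -> 0 < eps -> exists d, 0 < d /\
     forall s, 0 < s < d -> t + s <= T ->
       vnorm (u (t + s) [-] u t) <= s * (K + eps)) ->
  vnorm (u T [-] u 0) <= T * K.
Proof.
intros HT Hc Hd; assert (E := norm_minus_diag (u 0)).
enough (vnorm (u T [-] u 0) <= vnorm (u 0 [-] u 0) + T * K) by lra.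
apply (dini_le (fun s => vnorm (u s [-] u 0)) K T HT); intros t eps Ht He.
- destruct (Hc t eps Ht He) as (d & Hd0 & H); exists d; split; auto.
  intros s Hs Hst; apply Rle_lt_trans with (2 := H s Hs Hst).
  replace (u s [-] u t) with ((u s [-] u 0) [-] (u t [-] u 0)) by module_eq.
  apply vnorm_lipschitz.
- destruct (Hd t eps Ht He) as (d & Hd0 & H); exists d; split; auto.
  intros s Hs Hst; specialize (H s Hs Hst).
  assert (N := norm_minus_triangle (u t) (u (t + s)) (u 0)); lra.
Qed.

Section Generated_semigroup.
Context {X : CompleteNormedModule R_AbsRing}.
Variables (w : R) (G : graph X) (V : R -> X -> X).
Hypotheses (Hw : 0 <= w) (HG : m_dissipative w G) (HV : generates G V).

Lemma sg_linear t : 0 <= t -> is_linear (V t).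
Proof. apply HV. Qed.

Lemma sg_zero f : V 0 f = f.
Proof. apply HV. Qed.

Lemma sg_add t s f : 0 <= t -> 0 <= s -> V (t + s) f = V t (V s f).
Proof. intros Ht Hs; now apply HV. Qed.

Lemma sg_bounded t : 0 <= t ->
  exists M, 0 < M /\ forall f, vnorm (V t f) <= M * vnorm f.
Proof. intros Ht; exact (linear_norm _ (sg_linear t Ht)). Qed.

Lemma sg_continuous f t eps : 0 <= t -> 0 < eps -> exists d, 0 < d /\
  forall s, 0 <= s -> Rabs (s - t) < d -> vnorm (V s f [-] V t f) < eps.
Proof.
intros Ht He; assert (H := C0_continuous V (proj1 HV) f t Ht).
destruct (proj1 (filterlim_vnorm (within (fun s => 0 <= s) (locally t))
  (fun s => V s f) (V t f)) H eps He) as [d Hd].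
exists d; split; [apply cond_pos|].
intros s Hs Hst; now apply Hd.
Qed.

Lemma sg_taylor f g eps : G (f, g) -> 0 < eps -> exists d, 0 < d /\
  forall t, 0 < t < d -> vnorm (V t f [-] f [-] t [*] g) <= eps * t.
Proof.
intros Hf He; apply (proj2 HV) in Hf.
exact (proj1 (generator_iff V f g) Hf eps He).
Qed.

Lemma sg_taylor_at f g t eps : G (f, g) -> 0 <= t -> 0 < eps ->
  exists d, 0 < d /\ forall s, 0 < s < d ->
    vnorm (V (t + s) f [-] V t f [-] s [*] V t g) <= eps * s.
Proof.
intros Hf Ht He; destruct (sg_bounded t Ht) as (M & HM & HMt).
destruct (small_factor M eps (Rlt_le _ _ HM) He) as (e & Hee & Sm).
destruct (sg_taylor f g e Hf Hee) as (d & Hd & Hs).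
exists d; split; auto; intros s Hsd; specialize (Hs s Hsd).
replace (V (t + s) f [-] V t f [-] s [*] V t g) with (V t (V s f [-] f [-] s [*] g)).
2: { rewrite sg_add, !(linear_vminus (V t)), linear_vscal
       by (try apply sg_linear; lra); reflexivity. }
apply Rle_trans with (1 := HMt _).
apply Rmult_le_compat_l with (r := M) in Hs; [|lra].
apply Rle_trans with (1 := Hs); rewrite <- Rmult_assoc.
apply Rmult_le_compat_r; [lra | left; apply Sm; lra].
Qed.

Lemma sg_comm f g t : G (f, g) -> 0 <= t -> G (V t f, V t g).
Proof.
intros Hf Ht; apply (proj2 HV), generator_iff; intros eps He.
destruct (sg_taylor_at f g t eps Hf Ht He) as (d & Hd & Hs).
exists d; split; auto; intros s Hsd.
rewrite <- sg_add by lra; rewrite (Rplus_comm s t); auto.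
Qed.

(** With [u = V f], dissipativity applied to [u (s + r)] gives
    [(1 - w r) |u (s + r)| <= |u (s + r) - r G u (s + r)| = |u s| + o(r)], so the
    right derivative of [exp (- w s) |u s|] is nonpositive. *)
Lemma sg_norm_domain f g t :
  G (f, g) -> 0 <= t -> vnorm (V t f) <= exp (w * t) * vnorm f.
Proof.
intros Hf Ht.
enough (H : exp (- (w * t)) * vnorm (V t f)
            <= exp (- (w * 0)) * vnorm (V 0 f) + t * 0).
{ rewrite Rmult_0_r, Ropp_0, exp_0, sg_zero, Rmult_0_r, Rplus_0_r, Rmult_1_l in H.
  rewrite exp_Ropp in H; assert (P := exp_pos (w * t)).
  apply Rmult_le_compat_l with (r := exp (w * t)) in H; [|lra].
  rewrite <- Rmult_assoc, Rinv_r, Rmult_1_l in H; lra. }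
apply (dini_le (fun s => exp (- (w * s)) * vnorm (V s f)) 0 t Ht).
- intros s eps Hs He.
  assert (C1 : continuity_pt (fun r => exp (- (w * r))) s).
  { apply derivable_continuous_pt; apply ex_derive_Reals_0; auto_derive; auto. }
  set (N := vnorm (V s f)); assert (N0 : 0 <= N) by apply vnorm_ge_0.
  destruct (small_factor N (eps / 2) N0 ltac:(lra)) as (e & He1 & Sm).
  destruct (C1 _ He1) as (d1 & Hd1 & H1).
  destruct (sg_continuous f s (eps / 2) (proj1 Hs) ltac:(lra)) as (d2 & Hd2 & H2).
  exists (Rmin d1 d2); split; [now apply Rmin_pos|]; intros r Hr Hrs.
  destruct (lt_Rmin _ _ _ Hrs) as [L1 L2].
  specialize (H2 r (proj1 Hr) L2).
  assert (K1 : Rabs (exp (- (w * r)) - exp (- (w * s))) < e).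
  { destruct (Req_dec r s) as [->|Hne].
    - rewrite Rminus_diag, Rabs_R0; auto.
    - apply H1; split; [split; [exact I | auto] | exact L1]. }
  replace (exp (- (w * r)) * vnorm (V r f) - exp (- (w * s)) * N)
    with (exp (- (w * r)) * (vnorm (V r f) - N)
          + (exp (- (w * r)) - exp (- (w * s))) * N) by ring.
  apply Rle_lt_trans with (1 := Rabs_triang _ _); rewrite !Rabs_mult.
  assert (K2 := vnorm_lipschitz (V r f) (V s f)); fold N in K2.
  assert (K3 : Rabs (exp (- (w * r))) <= 1).
  { rewrite Rabs_pos_eq by (left; apply exp_pos).
    rewrite <- exp_0; apply exp_le.
    assert (0 <= w * r) by (apply Rmult_le_pos; lra); lra. }
  rewrite (Rabs_pos_eq N) by auto.
  assert (K4 : Rabs (exp (- (w * r))) * Rabs (vnorm (V r f) - N) < eps / 2).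
  { apply Rle_lt_trans with (1 * Rabs (vnorm (V r f) - N)); [|lra].
    apply Rmult_le_compat_r; auto; apply Rabs_pos. }
  specialize (Sm _ (conj (Rabs_pos _) (Rlt_le _ _ K1))).
  lra.
- intros s eps Hs He; rewrite Rplus_0_l.
  set (N := vnorm (V s f)); assert (N0 : 0 <= N) by apply vnorm_ge_0.
  destruct (sg_taylor_at f g s (eps / 3) Hf (proj1 Hs) ltac:(lra))
    as (d1 & Hd1 & H1).
  destruct (sg_continuous g s (eps / 3) (proj1 Hs) ltac:(lra)) as (d2 & Hd2 & H2).
  destruct (sg_continuous f s 1 (proj1 Hs) ltac:(lra)) as (d3 & Hd3 & H3).
  destruct (small_factor (w * w * (N + 1)) (eps / 3)) as (d4 & Hd4 & S4);
    [repeat apply Rmult_le_pos; lra | lra |].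
  destruct (small_factor w 1 Hw Rlt_0_1) as (d5 & Hd5 & S5).
  exists (Rmin (Rmin d1 d2) (Rmin d3 (Rmin d4 d5))).
  split; [repeat apply Rmin_pos; auto|]; intros r Hr Hrt.
  destruct (lt_Rmin _ _ _ (proj2 Hr)) as [L L'].
  destruct (lt_Rmin _ _ _ L) as [L1 L2].
  destruct (lt_Rmin _ _ _ L') as [L3 L45].
  destruct (lt_Rmin _ _ _ L45) as [L4 L5].
  assert (Er : Rabs (s + r - s) = r)
    by (replace (s + r - s) with r by ring; apply Rabs_pos_eq; lra).
  specialize (H1 r ltac:(lra)).
  specialize (H2 (s + r) ltac:(lra)); rewrite Er in H2; specialize (H2 L2).
  specialize (H3 (s + r) ltac:(lra)); rewrite Er in H3; specialize (H3 L3).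
  specialize (S4 r ltac:(lra)); specialize (S5 r ltac:(lra)).
  assert (Hwr : w < / r)
    by (apply Rmult_lt_reg_r with r; [lra|]; rewrite Rinv_l; lra).
  assert (D := md_diss _ _ HG _ _ _ Hwr (sg_comm f g (s + r) Hf ltac:(lra))).
  set (u := V (s + r) f) in *; set (v := V (s + r) g) in *.
  apply Rmult_le_compat_l with (r := r) in D; [|lra].
  rewrite <- Rmult_assoc, <- (norm_scal_pos r) in D by lra.
  replace (r * (/ r - w)) with (1 - w * r) in D by (field; lra).
  replace (r [*] (/ r [*] u [-] v)) with
    (V s f [+] ((u [-] V s f [-] r [*] V s g) [+] vopp (r [*] (v [-] V s g))))
    in D by module_eq.
  assert (T1 := vnorm_triangle (V s f)
    ((u [-] V s f [-] r [*] V s g) [+] vopp (r [*] (v [-] V s g)))).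
  assert (T2 := vnorm_triangle (u [-] V s f [-] r [*] V s g)
    (vopp (r [*] (v [-] V s g)))).
  rewrite vnorm_opp, norm_scal_pos in T2 by lra.
  assert (T3 := vnorm_lipschitz u (V s f)).
  apply Rabs_le_between in T3; fold N in T1, T3.
  apply Rmult_lt_compat_l with (r := r) in H2; [|lra].
  replace (exp (- (w * (s + r)))) with (exp (- (w * s)) * exp (- (w * r)))
    by (rewrite <- exp_plus; f_equal; ring).
  assert (Hx : 0 <= w * r) by (apply Rmult_le_pos; lra).
  assert (X1 := exp_neg_le _ Hx).
  assert (Hu : 0 <= vnorm u) by apply vnorm_ge_0.
  assert (X2 : exp (- (w * r)) * vnorm u
    <= (1 - w * r) * vnorm u + w * r * (w * r) * vnorm u).
  { rewrite <- Rmult_plus_distr_r; now apply Rmult_le_compat_r. }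
  assert (X3 : w * r * (w * r) * vnorm u <= r * (eps / 3)).
  { apply Rle_trans with (r * (w * w * (N + 1) * r)).
    - replace (w * r * (w * r) * vnorm u) with (r * (w * w * r * vnorm u)) by ring.
      apply Rmult_le_compat_l; [lra|].
      replace (w * w * (N + 1) * r) with (w * w * r * (N + 1)) by ring.
      apply Rmult_le_compat_l; [|lra].
      repeat apply Rmult_le_pos; lra.
    - apply Rmult_le_compat_l; lra. }
  assert (X4 : exp (- (w * r)) * vnorm u <= N + r * eps) by lra.
  rewrite Rmult_assoc.
  apply Rle_trans with (exp (- (w * s)) * (N + r * eps)).
  + apply Rmult_le_compat_l; auto; left; apply exp_pos.
  + assert (exp (- (w * s)) <= 1).
    { rewrite <- exp_0; apply exp_le.
      assert (0 <= w * s) by (apply Rmult_le_pos; lra); lra. }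
    rewrite Rmult_plus_distr_l; apply Rplus_le_compat_l.
    rewrite <- (Rmult_1_l (r * eps)) at 2; apply Rmult_le_compat_r; auto.
    apply Rmult_le_pos; lra.
Qed.

Lemma sg_norm f t : 0 <= t -> vnorm (V t f) <= exp (w * t) * vnorm f.
Proof.
intros Ht; apply le_epsilon; intros eps He.
destruct (sg_bounded t Ht) as (M & HM & HMt).
assert (P := exp_pos (w * t)).
destruct (small_factor (M + exp (w * t)) eps) as (e & He1 & Sm); [lra | auto |].
destruct (md_dense _ _ HG f _ He1) as (u & v & Huv & Hu).
assert (B := sg_norm_domain u v t Huv Ht).
assert (B1 : vnorm (V t f [-] V t u) <= M * vnorm (u [-] f)).
{ rewrite (norm_minus_sym u f), <- (linear_vminus (V t)) by now apply sg_linear.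
  apply HMt. }
assert (B2 := norm_le_minus (V t f) (V t u)).
assert (B3 := norm_le_minus u f).
apply Rmult_le_compat_l with (r := exp (w * t)) in B3; [|lra].
specialize (Sm _ (conj (vnorm_ge_0 (u [-] f)) (Rlt_le _ _ Hu))); lra.
Qed.

Lemma sg_norm_le f s t : 0 <= s <= t -> vnorm (V s f) <= exp (w * t) * vnorm f.
Proof.
intros Hs; apply Rle_trans with (1 := sg_norm f s (proj1 Hs)).
apply Rmult_le_compat_r; [apply vnorm_ge_0|]; apply exp_le.
apply Rmult_le_compat_l; lra.
Qed.

Lemma sg_lipschitz f g t :
  G (f, g) -> 0 <= t -> vnorm (V t f [-] f) <= t * (exp (w * t) * vnorm g).
Proof.
intros Hf Ht; set (K := exp (w * t) * vnorm g).
replace (V t f [-] f) with (V t f [-] V 0 f) by (now rewrite sg_zero).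
apply (mean_value_inequality (fun s => V s f) K t Ht); intros s eps Hs He.
- destruct (sg_continuous f s eps (proj1 Hs) He) as (d & Hd & H).
  exists d; split; auto; intros r Hr Hrs; now apply H.
- destruct (sg_taylor_at f g s eps Hf (proj1 Hs) He) as (d & Hd & H).
  exists d; split; auto; intros r Hr Hrt; specialize (H r Hr).
  assert (B : vnorm (V s g) <= K) by (apply sg_norm_le; lra).
  replace (V (s + r) f [-] V s f) with
    ((V (s + r) f [-] V s f [-] r [*] V s g) [+] r [*] V s g) by module_eq.
  apply Rle_trans with (1 := vnorm_triangle _ _).
  rewrite norm_scal_pos by lra.
  apply Rmult_le_compat_l with (r := r) in B; lra.
Qed.

(** The derivative [V s g - g] of [V s f - s g] is itself of order [s], because [g]
    lies in the domain. *)
Lemma sg_taylor2 f g k t : G (f, g) -> G (g, k) -> 0 <= t ->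
  vnorm (V t f [-] f [-] t [*] g) <= t ^ 2 * (exp (w * t) * vnorm k).
Proof.
intros Hf Hg Ht; set (K := t * (exp (w * t) * vnorm k)).
replace (t ^ 2 * (exp (w * t) * vnorm k)) with (t * K) by (unfold K; ring).
replace (V t f [-] f [-] t [*] g)
  with ((V t f [-] t [*] g) [-] (V 0 f [-] 0 [*] g))
  by (rewrite sg_zero; module_eq).
apply (mean_value_inequality (fun s => V s f [-] s [*] g) K t Ht);
  intros s eps Hs He.
- destruct (sg_continuous f s (eps / 2) (proj1 Hs) ltac:(lra)) as (d & Hd & H).
  destruct (small_factor (vnorm g) (eps / 2) (vnorm_ge_0 g) ltac:(lra))
    as (d2 & Hd2 & Sm).
  exists (Rmin d d2); split; [now apply Rmin_pos|].
  intros r Hr Hrs; destruct (lt_Rmin _ _ _ Hrs) as [L1 L2].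
  specialize (H r (proj1 Hr) L1).
  replace ((V r f [-] r [*] g) [-] (V s f [-] s [*] g))
    with ((V r f [-] V s f) [+] (s - r) [*] g) by module_eq.
  apply Rle_lt_trans with (1 := vnorm_triangle _ _).
  rewrite norm_scal_R, Rabs_minus_sym.
  specialize (Sm _ (conj (Rabs_pos _) (Rlt_le _ _ L2))); lra.
- destruct (sg_taylor_at f g s eps Hf (proj1 Hs) He) as (d & Hd & H).
  exists d; split; auto; intros r Hr Hrt; specialize (H r Hr).
  assert (B : vnorm (V s g [-] g) <= K).
  { apply Rle_trans with (1 := sg_lipschitz g k s Hg (proj1 Hs)).
    assert (N := vnorm_ge_0 k); assert (P := exp_pos (w * s)).
    apply Rmult_le_compat; try lra; [apply Rmult_le_pos; lra|].
    apply Rmult_le_compat_r; auto; apply exp_le, Rmult_le_compat_l; lra. }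
  replace ((V (s + r) f [-] (s + r) [*] g) [-] (V s f [-] s [*] g)) with
    ((V (s + r) f [-] V s f [-] r [*] V s g) [+] r [*] (V s g [-] g))
    by module_eq.
  apply Rle_trans with (1 := vnorm_triangle _ _).
  rewrite norm_scal_pos by lra.
  apply Rmult_le_compat_l with (r := r) in B; lra.
Qed.

(** For negative [s] the quotient is rewritten as [V (t + s)] applied to a right
    difference quotient at [0]; this uses the uniform bound on [V]. *)
Lemma sg_derivative f g t eps : G (f, g) -> 0 < t -> 0 < eps ->
  exists d, 0 < d /\ forall s, Rabs s < d ->
    vnorm (V (t + s) f [-] V t f [-] s [*] V t g) <= eps * Rabs s.
Proof.
intros Hf Ht He; set (M := exp (w * t)); assert (HM : 0 < M) by apply exp_pos.
destruct (sg_taylor_at f g t eps Hf (Rlt_le _ _ Ht) He) as (d1 & Hd1 & H1).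
destruct (small_factor M (eps / 2) (Rlt_le _ _ HM) ltac:(lra)) as (e & He2 & Sm).
destruct (sg_taylor f g _ Hf He2) as (d2 & Hd2 & H2).
destruct (sg_continuous g t (eps / 2) (Rlt_le _ _ Ht) ltac:(lra))
  as (d3 & Hd3 & H3).
exists (Rmin (Rmin d1 d2) (Rmin d3 t)); split; [repeat apply Rmin_pos; auto|].
intros s Hs.
destruct (lt_Rmin _ _ _ Hs) as [L L'].
destruct (lt_Rmin _ _ _ L) as [L1 L2].
destruct (lt_Rmin _ _ _ L') as [L3 L4].
destruct (total_order_T s 0) as [[Hs0| ->]|Hs0].
- rewrite (Rabs_left s) in * by auto.
  specialize (H2 (- s) ltac:(lra)).
  specialize (H3 (t + s) ltac:(lra)).
  replace (t + s - t) with s in H3 by ring.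
  rewrite (Rabs_left s) in H3 by auto; specialize (H3 L3).
  assert (E : V t f = V (t + s) (V (- s) f)).
  { rewrite <- sg_add by lra; f_equal; ring. }
  assert (B := sg_norm_le (V (- s) f [-] f [-] (- s) [*] g) (t + s) t ltac:(lra)).
  assert (EB : V (t + s) (V (- s) f [-] f [-] (- s) [*] g)
    = V t f [-] V (t + s) f [-] (- s) [*] V (t + s) g).
  { rewrite !(linear_vminus (V (t + s))), linear_vscal, <- E
      by (apply sg_linear; lra); reflexivity. }
  rewrite EB in B; fold M in B.
  replace (V (t + s) f [-] V t f [-] s [*] V t g) with
    (vopp (V t f [-] V (t + s) f [-] (- s) [*] V (t + s) g)
     [+] (- s) [*] vopp (V (t + s) g [-] V t g)) by module_eq.
  apply Rle_trans with (1 := vnorm_triangle _ _).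
  rewrite norm_scal_pos, !vnorm_opp by lra.
  apply Rmult_le_compat_l with (r := M) in H2; [|lra].
  specialize (Sm e ltac:(lra)).
  apply Rmult_lt_compat_r with (r := - s) in Sm; [|lra].
  apply Rmult_lt_compat_l with (r := - s) in H3; [|lra].
  lra.
- rewrite Rplus_0_r.
  replace (V t f [-] V t f [-] 0 [*] V t g) with (vzero : X) by module_eq.
  rewrite vnorm_zero, Rabs_R0; lra.
- rewrite (Rabs_pos_eq s) in * by lra; apply H1; lra.
Qed.

End Generated_semigroup.

(** * Maximum principle and a priori bounds *)

Lemma UCb_le_norm (f : UCb) (x : R) : Rabs (f x) <= vnorm f.
Proof. exact (UCb_norm_ge f x). Qed.

Lemma UCb_norm_le (f : UCb) (M : R) :
  (forall x, Rabs (f x) <= M) -> vnorm f <= M.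
Proof. exact (sup_norm_le f M). Qed.

Lemma UCb_minus_le_norm (f g : UCb) (x : R) :
  Rabs (f x - g x) <= vnorm (f [-] g).
Proof. exact (UCb_norm_ge (f [-] g) x). Qed.

Definition UCb_mult (f g : UCb) : UCb :=
  mkUCb _ (in_UCb_mult f g (UCb_prop f) (UCb_prop g)).

Definition UCb_const (k : R) : UCb := mkUCb _ (in_UCb_const k).

(** Differentiability inside the space: [f'] exists, is bounded and is uniformly
    continuous. Chains of this relation stand for the spaces of [k] times
    differentiable functions. *)
Definition is_deriv (f f1 : UCb) : Prop := forall x, is_derive f x (f1 x).

Lemma MVT_all (f df : R -> R) (x y : R) :
  (forall z, is_derive f z (df z)) ->
  exists z, Rmin x y <= z <= Rmax x y /\ f y - f x = df z * (y - x).
Proof.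
intros H; apply MVT_gen; [intros z _; apply H|].
intros z _; apply continuity_pt_filterlim, (ex_derive_continuous (V := R_NormedModule)).
now exists (df z).
Qed.

Lemma in_UCb_derive (f df : R -> R) :
  bounded_fun f -> bounded_fun df -> (forall x, is_derive f x (df x)) ->
  in_UCb f.
Proof.
intros Hf [M HM] Hd0; split; auto; intros eps.
assert (HM0 : 0 <= M) by (apply Rle_trans with (2 := HM 0); apply Rabs_pos).
destruct (small_factor M eps HM0 (cond_pos eps)) as (d & Hd & Sm).
exists (mkposreal _ Hd); simpl; intros x y _ _ Hxy.
destruct (MVT_all f df y x Hd0) as (z & _ & ->); rewrite Rabs_mult.
apply Rle_lt_trans with (M * Rabs (x - y)).
- apply Rmult_le_compat_r; [apply Rabs_pos | apply HM].
- apply Sm; split; [apply Rabs_pos | lra].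
Qed.

Lemma is_deriv_bound (f f1 : UCb) (x y : R) :
  is_deriv f f1 -> Rabs (f y - f x) <= vnorm f1 * Rabs (y - x).
Proof.
intros Hf; destruct (MVT_all f f1 x y Hf) as (z & _ & ->).
rewrite Rabs_mult; apply Rmult_le_compat_r; [apply Rabs_pos | apply UCb_le_norm].
Qed.

Lemma is_deriv_plus f f1 g g1 :
  is_deriv f f1 -> is_deriv g g1 -> is_deriv (f [+] g) (f1 [+] g1).
Proof. intros Hf Hg x; exact (is_derive_plus f g x _ _ (Hf x) (Hg x)). Qed.

Lemma is_deriv_minus f f1 g g1 :
  is_deriv f f1 -> is_deriv g g1 -> is_deriv (f [-] g) (f1 [-] g1).
Proof. intros Hf Hg x; exact (is_derive_minus f g x _ _ (Hf x) (Hg x)). Qed.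

Lemma is_deriv_scal k f f1 : is_deriv f f1 -> is_deriv (k [*] f) (k [*] f1).
Proof. intros Hf x; exact (is_derive_scal f x k _ (Hf x)). Qed.

Lemma is_deriv_mult f f1 g g1 :
  is_deriv f f1 -> is_deriv g g1 ->
  is_deriv (UCb_mult f g) (UCb_mult f1 g [+] UCb_mult f g1).
Proof.
intros Hf Hg x.
exact (is_derive_mult f g x _ _ (Hf x) (Hg x) Rmult_comm).
Qed.

Lemma is_deriv_ext (f f1 g : UCb) : is_deriv f f1 -> (forall x, g x = f1 x) -> is_deriv f g.
Proof. intros Hf E x; rewrite E; apply Hf. Qed.

Lemma second_derivative_max (u u1 : R -> R) (u2 x : R) :
  (forall y, is_derive u y (u1 y)) -> is_derive u1 x u2 ->
  (forall y, u y <= u x) -> u1 x = 0 /\ u2 <= 0.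
Proof.
intros H1 H2 Hmax.
assert (E : u1 x = 0).
{ set (pr := exist (fun l => derivable_pt_lim u x l) (u1 x)
    (proj1 (is_derive_Reals _ _ _) (H1 x)) : derivable_pt u x).
  change (derive_pt u x pr = 0).
  apply (deriv_maximum u (x - 1) (x + 1)); [lra | lra | auto]. }
split; auto; apply Rnot_lt_le; intros Hu2.
apply is_derive_Reals in H2.
destruct (H2 (u2 / 2) ltac:(lra)) as [d Hd].
assert (Hpos : forall h, 0 < h < d -> 0 < u1 (x + h)).
{ intros h Hh; specialize (Hd h ltac:(lra)).
  rewrite Rabs_pos_eq in Hd by lra; specialize (Hd ltac:(lra)).
  rewrite E, Rminus_0_r in Hd; apply Rabs_def2 in Hd.
  apply Rmult_lt_reg_r with (/ h); [apply Rinv_0_lt_compat; lra|].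
  unfold Rdiv in Hd; lra. }
assert (P := cond_pos d).
destruct (MVT_cor2 u u1 x (x + d / 2)) as (z & Hz & Hzx); [lra| |].
- intros y _; apply is_derive_Reals, H1.
- specialize (Hpos (z - x) ltac:(lra)).
  replace (x + (z - x)) with z in Hpos by ring.
  specialize (Hmax (x + d / 2)).
  assert (0 < u1 z * (x + d / 2 - x)) by (apply Rmult_lt_0_compat; lra).
  lra.
Qed.

(** A bounded function on the line need not attain its supremum. Subtracting
    [d^2 (y - x0)^2] forces a maximum at some [m]; there the first derivative of [u]
    is [2 d^2 (m - x0)], which is [O(d)] since [d^2 (m - x0)^2 <= 2 M], and the second
    one is at most [2 d^2]. Then [d] tends to [0]. *)
Lemma max_principle (A B Q u u1 u2 : R -> R) (K M q r : R) :
  0 < q -> 0 <= r -> (forall x, 0 <= A x <= K) -> (forall x, Rabs (B x) <= K) ->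
  (forall x, q <= Q x) -> (forall x, Rabs (u x) <= M) ->
  (forall x, is_derive u x (u1 x)) -> (forall x, is_derive u1 x (u2 x)) ->
  (forall x, - r <= A x * u2 x + B x * u1 x - Q x * u x) ->
  forall x, u x <= r / q.
Proof.
intros Hq Hr HA HB HQ Hu H1 H2 Heq x0.
assert (HM : 0 <= M) by (apply Rle_trans with (2 := Hu 0); apply Rabs_pos).
assert (HK : 0 <= K) by (apply Rle_trans with (2 := HB 0); apply Rabs_pos).
apply Rnot_lt_le; intros Hx0.
assert (Hrq : 0 <= r / q) by (apply Rdiv_le_0_compat; auto).
set (C := 2 * K + 2 * K * (2 * M + 1)).
assert (HC : 0 <= C).
{ unfold C; assert (0 <= K * (2 * M + 1)) by (apply Rmult_le_pos; lra); lra. }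
assert (Main : forall d, 0 < d <= 1 -> q * u x0 <= r + C * d).
{ intros d Hd.
  set (w := fun y => u y - d ^ 2 * (y - x0) ^ 2).
  set (w1 := fun y => u1 y - 2 * d ^ 2 * (y - x0)).
  assert (D1 : forall y, is_derive w y (w1 y)).
  { intros y; unfold w, w1; apply (is_derive_minus u); [apply H1|].
    auto_derive; auto; ring. }
  assert (D2 : forall y, is_derive w1 y (u2 y - 2 * d ^ 2)).
  { intros y; unfold w1; apply (is_derive_minus u1); [apply H2|].
    auto_derive; auto; ring. }
  set (L := (2 * M + 1) / d).
  assert (HL : 0 < L) by (apply Rdiv_lt_0_compat; lra).
  assert (HdL : d * L = 2 * M + 1) by (unfold L; field; lra).
  destruct (continuity_ab_maj w (x0 - L) (x0 + L)) as (m & Hm1 & Hm2); [lra| |].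
  { intros y _; apply continuity_pt_filterlim.
    apply (ex_derive_continuous (V := R_NormedModule)); eexists; apply D1. }
  assert (Wx0 : w x0 = u x0) by (unfold w; ring).
  assert (Hx0m : u x0 <= w m) by (rewrite <- Wx0; apply Hm1; lra).
  assert (Hmax : forall y, w y <= w m).
  { intros y.
    destruct (Rle_lt_dec (Rabs (y - x0)) L) as [Hy|Hy].
    - apply Rabs_le_between in Hy; apply Hm1; lra.
    - apply Rle_trans with (2 := Hx0m).
      assert (K1 := Hu y); apply Rabs_le_between in K1.
      assert (K2 := Hu x0); apply Rabs_le_between in K2.
      assert (K3 : 2 * M + 1 <= d * Rabs (y - x0))
        by (rewrite <- HdL; apply Rmult_le_compat_l; lra).
      assert (K4 : (2 * M + 1) * (2 * M + 1)
        <= (d * Rabs (y - x0)) * (d * Rabs (y - x0)))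
        by (apply Rmult_le_compat; lra).
      assert (K5 : Rabs (y - x0) * Rabs (y - x0) = (y - x0) ^ 2)
        by (rewrite <- Rabs_mult, Rabs_pos_eq; [ring | apply Rle_0_sqr]).
      unfold w; rewrite <- K5.
      replace (d ^ 2 * (Rabs (y - x0) * Rabs (y - x0)))
        with (d * Rabs (y - x0) * (d * Rabs (y - x0))) by ring.
      assert (0 <= M * M) by (now apply Rmult_le_pos); lra. }
  destruct (second_derivative_max w w1 _ m D1 (D2 m) Hmax) as [E1 E2].
  unfold w1 in E1.
  assert (K1 := Hu m); apply Rabs_le_between in K1.
  assert (K2 := Hu x0); apply Rabs_le_between in K2.
  assert (K3 : (d * (m - x0)) ^ 2 <= 2 * M)
    by (unfold w in Hx0m; rewrite Rpow_mult_distr; lra).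
  assert (K4 : Rabs (d * (m - x0)) <= 2 * M + 1)
    by (apply Rabs_le_between; split; nra).
  assert (Hux : u x0 <= u m).
  { unfold w in Hx0m; assert (0 <= d ^ 2 * (m - x0) ^ 2)
      by (apply Rmult_le_pos; apply pow2_ge_0); lra. }
  assert (K5 : q * u x0 <= Q m * u m).
  { apply Rmult_le_compat; auto; lra. }
  assert (K6 : A m * u2 m <= K * 2 * d).
  { destruct (HA m) as [A1 A2]; apply Rle_trans with (A m * (2 * d ^ 2)).
    - apply Rmult_le_compat_l; lra.
    - apply Rle_trans with (A m * (2 * d)); [|nra].
      apply Rmult_le_compat_l; nra. }
  assert (K7 : B m * u1 m <= K * (2 * d * (2 * M + 1))).
  { replace (u1 m) with (2 * d * (d * (m - x0))) by lra.
    apply Rle_trans with (1 := Rle_abs _); rewrite !Rabs_mult in *.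
    rewrite (Rabs_pos_eq 2), (Rabs_pos_eq d) in * by lra.
    apply Rmult_le_compat; auto using Rabs_pos.
    - repeat apply Rmult_le_pos; try lra; apply Rabs_pos.
    - apply Rmult_le_compat_l; lra. }
  specialize (Heq m); unfold C; lra. }
apply Rmult_lt_compat_l with (r := q) in Hx0; auto.
replace (q * (r / q)) with r in Hx0 by (field; lra).
destruct (small_factor C (q * u x0 - r) HC ltac:(lra)) as (d & Hd & Sm).
assert (Hd1 : 0 < Rmin d 1) by (apply Rmin_pos; lra).
destruct (le_Rmin _ _ _ (Rle_refl (Rmin d 1))) as [L1 L2].
specialize (Sm (Rmin d 1) ltac:(lra)); specialize (Main (Rmin d 1) ltac:(lra)); lra.
Qed.

Lemma elliptic_bound (A B Q u u1 u2 : R -> R) (K M q r : R) :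
  0 < q -> 0 <= r -> (forall x, 0 <= A x <= K) -> (forall x, Rabs (B x) <= K) ->
  (forall x, q <= Q x) -> (forall x, Rabs (u x) <= M) ->
  (forall x, is_derive u x (u1 x)) -> (forall x, is_derive u1 x (u2 x)) ->
  (forall x, Rabs (A x * u2 x + B x * u1 x - Q x * u x) <= r) ->
  forall x, Rabs (u x) <= r / q.
Proof.
intros Hq Hr HA HB HQ Hu H1 H2 Heq x; apply Rabs_le; split.
- enough (- u x <= r / q) by lra.
  apply (max_principle A B Q (fun y => - u y) (fun y => - u1 y)
    (fun y => - u2 y) K M q r); auto.
  + intros y; now rewrite Rabs_Ropp.
  + intros y; apply (is_derive_opp u); auto.
  + intros y; apply (is_derive_opp u1); auto.
  + intros y; specialize (Heq y); apply Rabs_le_between in Heq; lra.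
- apply (max_principle A B Q u u1 u2 K M q r); auto.
  intros y; specialize (Heq y); apply Rabs_le_between in Heq; lra.
Qed.

(** Landau's interpolation: [f'] differs by at most [h |f''|] from a difference
    quotient of step [h]. *)
Lemma first_derivative_bound (f f1 f2 : UCb) (h : R) :
  is_deriv f f1 -> is_deriv f1 f2 -> 0 < h ->
  vnorm f1 <= 2 * vnorm f / h + h * vnorm f2.
Proof.
intros H1 H2 Hh; apply UCb_norm_le; intros x.
destruct (MVT_all f f1 x (x + h) H1) as (z & Hz & E).
rewrite Rmin_left, Rmax_right in Hz by lra.
assert (B := is_deriv_bound f1 f2 z x H2).
assert (K1 := UCb_le_norm f x); assert (K2 := UCb_le_norm f (x + h)).
assert (Ez : f1 z = (f (x + h) - f x) / h) by (rewrite E; field; lra).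
assert (Bz : Rabs (f1 z) <= 2 * vnorm f / h).
{ rewrite Ez; unfold Rdiv; rewrite Rabs_mult, (Rabs_pos_eq (/ h))
    by (left; now apply Rinv_0_lt_compat).
  apply Rmult_le_compat_r; [left; now apply Rinv_0_lt_compat|].
  assert (T := Rabs_triang (f (x + h)) (- f x)); rewrite Rabs_Ropp in T.
  unfold Rminus; lra. }
assert (Bx : vnorm f2 * Rabs (x - z) <= h * vnorm f2).
{ rewrite Rmult_comm; apply Rmult_le_compat_r; [apply vnorm_ge_0|].
  apply Rabs_le; lra. }
replace (f1 x) with (f1 z + (f1 x - f1 z)) by ring.
apply Rle_trans with (1 := Rabs_triang _ _); lra.
Qed.

(** The maximum principle bounds [f], the equation bounds [f''] by [f'] and [f], and
    interpolation closes the loop. The constant depends on the coefficients only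
    through [K], [a1] and [q], so the bound is uniform along the method of
    continuity. *)
Lemma elliptic_apriori (K a1 q : R) : 0 < a1 -> 0 < q -> a1 <= K ->
  exists C, 0 < C /\ forall (A B Q f f1 f2 r : UCb),
    (forall x, a1 <= A x <= K) -> (forall x, Rabs (B x) <= K) ->
    (forall x, q <= Q x <= K) ->
    is_deriv f f1 -> is_deriv f1 f2 ->
    (forall x, A x * f2 x + B x * f1 x - Q x * f x = r x) ->
    vnorm f <= vnorm r / q /\ vnorm f1 <= C * vnorm r /\ vnorm f2 <= C * vnorm r.
Proof.
intros Ha Hq HaK.
(* [h] makes the first-order term absorb at most half of [a1 * norm f2] *)
set (h := a1 / (2 * K)).
assert (Hh : 0 < h) by (apply Rdiv_lt_0_compat; lra).
set (C2 := 2 / a1 * (1 + (2 * K / h + K) / q)).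
set (C1 := 2 / q / h + h * C2).
assert (HC2 : 0 < C2).
{ apply Rmult_lt_0_compat; [apply Rdiv_lt_0_compat; lra|].
  assert (0 < (2 * K / h + K) / q); [|lra].
  apply Rdiv_lt_0_compat; auto.
  assert (0 < 2 * K / h) by (apply Rdiv_lt_0_compat; lra); lra. }
assert (HC1 : 0 < C1).
{ assert (0 < 2 / q / h) by (repeat apply Rdiv_lt_0_compat; lra).
  assert (0 < h * C2) by (now apply Rmult_lt_0_compat); unfold C1; lra. }
exists (C1 + C2); split; [lra|].
intros A B Q f f1 f2 r HA HB HQ H1 H2 Heq.
assert (Nr := vnorm_ge_0 r); assert (N2 := vnorm_ge_0 f2).
assert (B0 : vnorm f <= vnorm r / q).
{ apply UCb_norm_le; apply (elliptic_bound A B Q f f1 f2 K (vnorm f)); auto.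
  - intros x; specialize (HA x); lra.
  - intros x; apply HQ.
  - apply UCb_le_norm.
  - intros x; rewrite Heq; apply UCb_le_norm. }
assert (B1 := first_derivative_bound f f1 f2 h H1 H2 Hh).
assert (B2 : a1 * vnorm f2 <= vnorm r + K * vnorm f1 + K * vnorm f).
{ apply Rmult_le_reg_l with (/ a1); [now apply Rinv_0_lt_compat|].
  rewrite <- Rmult_assoc, Rinv_l, Rmult_1_l by lra.
  apply UCb_norm_le; intros x.
  apply Rmult_le_reg_l with a1; auto.
  rewrite <- Rmult_assoc, Rinv_r, Rmult_1_l by lra.
  destruct (HA x) as [A1 A2]; destruct (HQ x) as [Q1 Q2].
  apply Rle_trans with (Rabs (A x * f2 x)).
  { rewrite Rabs_mult; apply Rmult_le_compat_r; [apply Rabs_pos|].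
    rewrite Rabs_pos_eq; lra. }
  replace (A x * f2 x) with (r x + (- (B x * f1 x) + Q x * f x))
    by (rewrite <- Heq; ring).
  apply Rle_trans with (1 := Rabs_triang _ _).
  assert (T := Rabs_triang (- (B x * f1 x)) (Q x * f x)).
  rewrite Rabs_Ropp, !Rabs_mult in T.
  assert (T1 := UCb_le_norm r x).
  assert (T2 : Rabs (B x) * Rabs (f1 x) <= K * vnorm f1).
  { apply Rmult_le_compat; auto using Rabs_pos, UCb_le_norm. }
  assert (T3 : Rabs (Q x) * Rabs (f x) <= K * vnorm f).
  { apply Rmult_le_compat; auto using Rabs_pos, UCb_le_norm.
    rewrite Rabs_pos_eq; lra. }
  lra. }
assert (B3 : vnorm f2 <= C2 * vnorm r).
{ assert (S1 : K * vnorm f1 <= 2 * K / h * vnorm f + a1 / 2 * vnorm f2).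
  { apply Rmult_le_compat_l with (r := K) in B1; [|lra].
    apply Rle_trans with (1 := B1); right; unfold h; field; lra. }
  assert (S2 : (2 * K / h + K) * vnorm f <= (2 * K / h + K) * (vnorm r / q)).
  { apply Rmult_le_compat_l; auto.
    assert (0 < 2 * K / h) by (apply Rdiv_lt_0_compat; lra); lra. }
  assert (S3 : a1 / 2 * vnorm f2 <= vnorm r + (2 * K / h + K) * (vnorm r / q))
    by lra.
  apply Rmult_le_reg_l with (a1 / 2); [lra|].
  apply Rle_trans with (1 := S3); right; unfold C2; field; lra. }
assert (0 <= C1 * vnorm r) by (apply Rmult_le_pos; lra).
assert (0 <= C2 * vnorm r) by (apply Rmult_le_pos; lra).
repeat split; auto; [|lra].
apply Rle_trans with (C1 * vnorm r); [|lra].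
apply Rle_trans with (1 := B1); unfold C1; rewrite Rmult_plus_distr_r.
apply Rplus_le_compat.
- apply Rmult_le_compat_l with (r := 2 / h) in B0;
    [|left; apply Rdiv_lt_0_compat; lra].
  apply Rle_trans with (2 / h * vnorm f); [right; field; lra|].
  apply Rle_trans with (1 := B0); right; field; lra.
- rewrite Rmult_assoc; apply Rmult_le_compat_l; lra.
Qed.

(** * Exponentially dominated integrals *)

Lemma UCb_continuous (f : UCb) (x : R) : continuous f x.
Proof.
destruct (UCb_prop f) as [_ Uf].
apply continuity_pt_filterlim; intros eps He.
destruct (Uf (mkposreal _ He)) as [d Hd]; exists d; split; [apply cond_pos|].
intros y [_ Hy]; apply (Hd y x I I Hy).
Qed.

Lemma continuous_ex_RInt (phi : R -> R) (x y : R) :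
  (forall t, continuous phi t) -> ex_RInt phi x y.
Proof.
intros H; apply (ex_RInt_continuous (V := R_CompleteNormedModule)); auto.
Qed.

Lemma is_derive_integral (phi : R -> R) (x0 x : R) :
  (forall t, continuous phi t) -> is_derive (RInt phi x0) x (phi x).
Proof.
intros Hc; apply (is_derive_RInt (V := R_CompleteNormedModule) phi (RInt phi x0) x0 x);
  auto.
apply filter_forall; intros z; apply (RInt_correct (V := R_CompleteNormedModule)).
now apply continuous_ex_RInt.
Qed.

(** Both [H - Phi] and [H + Phi] are nondecreasing, where [Phi] is the integral of
    [phi]; an explicit primitive [H] then spares the integration of [dH]. *)
Lemma RInt_bound (phi H dH : R -> R) (x y : R) :
  x <= y -> (forall t, continuous phi t) -> (forall t, is_derive H t (dH t)) ->
  (forall t, x <= t -> Rabs (phi t) <= dH t) ->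
  Rabs (RInt phi x y) <= H y - H x.
Proof.
intros Hxy Hc HD Hb.
assert (D : forall t, is_derive (RInt phi x) t (phi t))
  by (intros t; now apply is_derive_integral).
assert (E : RInt phi x x = 0) by exact (RInt_point x phi).
destruct (MVT_all (fun t => H t - RInt phi x t) (fun t => dH t - phi t) x y)
  as (z & Hz & Ez).
{ intros t; now apply (is_derive_minus H). }
destruct (MVT_all (fun t => H t + RInt phi x t) (fun t => dH t + phi t) x y)
  as (z' & Hz' & Ez').
{ intros t; now apply (is_derive_plus H). }
rewrite Rmin_left, Rmax_right in Hz, Hz' by auto; rewrite E in Ez, Ez'.
assert (B := Hb z ltac:(lra)); assert (B' := Hb z' ltac:(lra)).
apply Rabs_le_between in B; apply Rabs_le_between in B'.
assert (0 <= (dH z - phi z) * (y - x)) by (apply Rmult_le_pos; lra).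
assert (0 <= (dH z' + phi z') * (y - x)) by (apply Rmult_le_pos; lra).
apply Rabs_le; lra.
Qed.

Lemma is_RInt_gen_of_limit (phi : R -> R) (l : R) :
  (forall T, 0 <= T -> ex_RInt phi 0 T) ->
  (forall eps, 0 < eps -> exists T0, 0 <= T0 /\ forall T, T0 <= T ->
     Rabs (RInt phi 0 T - l) < eps) ->
  is_RInt_gen phi (at_point 0) (Rbar_locally p_infty) l.
Proof.
intros Hex Hl P [eps HP]; destruct (Hl eps (cond_pos eps)) as (T0 & HT0 & HT).
apply Filter_prod with (fun x => x = 0) (fun T => T0 < T).
- reflexivity.
- exists T0; auto.
- intros x T -> HTT; exists (RInt phi 0 T); split.
  + apply (RInt_correct (V := R_CompleteNormedModule)), Hex; lra.
  + apply HP, HT; lra.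
Qed.

Lemma exp_decay (K mu eps : R) : 0 <= K -> 0 < mu -> 0 < eps ->
  exists T0, 0 <= T0 /\ forall T, T0 <= T -> K * exp (- mu * T) < eps.
Proof.
intros HK Hmu He; assert (Hme : 0 < mu * eps) by (now apply Rmult_lt_0_compat).
exists (K / (mu * eps)); split; [now apply Rdiv_le_0_compat|]; intros T HT.
assert (E := exp_ineq1_le (mu * T)); assert (P := exp_pos (mu * T)).
replace (- mu * T) with (- (mu * T)) by ring; rewrite exp_Ropp.
apply Rmult_lt_reg_r with (exp (mu * T)); auto.
rewrite Rmult_assoc, Rinv_l, Rmult_1_r by lra.
apply Rlt_le_trans with (eps * (1 + mu * T)); [|apply Rmult_le_compat_l; lra].
apply Rmult_le_compat_l with (r := mu * eps) in HT; [|lra].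
replace (mu * eps * (K / (mu * eps))) with K in HT by (field; lra); lra.
Qed.

Lemma exp_dominated_integral (phi : R -> R) (K mu : R) :
  0 < mu -> (forall t, continuous phi t) ->
  (forall t, 0 <= t -> Rabs (phi t) <= K * exp (- mu * t)) ->
  exists l, is_RInt_gen phi (at_point 0) (Rbar_locally p_infty) l /\
    (forall T, 0 <= T -> Rabs (l - RInt phi 0 T) <= K / mu * exp (- mu * T)).
Proof.
intros Hmu Hc Hb.
assert (HK : 0 <= K).
{ assert (B := Hb 0 (Rle_refl 0)); rewrite Rmult_0_r, exp_0, Rmult_1_r in B.
  apply Rle_trans with (2 := B), Rabs_pos. }
assert (HKm : 0 <= K / mu) by (now apply Rdiv_le_0_compat).
assert (Htail : forall S T, 0 <= S -> S <= T ->
  Rabs (RInt phi 0 T - RInt phi 0 S) <= K / mu * exp (- mu * S)).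
{ intros S T HS HST.
  replace (RInt phi 0 T - RInt phi 0 S) with (RInt phi S T).
  2: { assert (E : plus (RInt phi 0 S) (RInt phi S T) = RInt phi 0 T)
         by (apply RInt_Chasles; now apply continuous_ex_RInt).
       change (RInt phi 0 S + RInt phi S T = RInt phi 0 T) in E; lra. }
  apply Rle_trans with (- (K / mu) * exp (- mu * T) - - (K / mu) * exp (- mu * S)).
  - apply (RInt_bound phi (fun t => - (K / mu) * exp (- mu * t))
      (fun t => K * exp (- mu * t))); auto.
    + intros t; auto_derive; auto; field; lra.
    + intros t Ht; apply Hb; lra.
  - assert (P := exp_pos (- mu * T)).
    assert (0 <= K / mu * exp (- mu * T)) by (apply Rmult_le_pos; lra); lra. }
assert (Hsmall := fun eps => exp_decay (K / mu) mu eps HKm Hmu).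
destruct (proj1 (filterlim_locally_cauchy (U := R_CompleteSpace)
  (F := Rbar_locally p_infty) (fun T => RInt phi 0 T))) as [l Hl].
{ intros eps; destruct (Hsmall (eps / 2)) as (T0 & HT0 & HT).
  { assert (P := cond_pos eps); lra. }
  exists (fun T => T0 < T); split; [now exists T0|].
  intros S T HS HT'; change (Rabs (RInt phi 0 T - RInt phi 0 S) < eps).
  assert (P := cond_pos eps).
  destruct (Rle_lt_dec S T) as [L|L].
  - apply Rle_lt_trans with (1 := Htail S T ltac:(lra) L).
    specialize (HT S ltac:(lra)); lra.
  - rewrite Rabs_minus_sym.
    apply Rle_lt_trans with (1 := Htail T S ltac:(lra) (Rlt_le _ _ L)).
    specialize (HT T ltac:(lra)); lra. }
assert (Hlim : forall eps, 0 < eps -> exists T0, 0 <= T0 /\ forall T, T0 <= T ->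
  Rabs (RInt phi 0 T - l) < eps).
{ intros eps He; destruct (proj1 (filterlim_locally _ _) Hl (mkposreal _ He)) as [M HM].
  exists (Rmax 0 (M + 1)); split; [apply Rmax_l|]; intros T HT.
  assert (K1 := Rmax_r 0 (M + 1)); apply (HM T); lra. }
exists l; split.
- apply is_RInt_gen_of_limit; auto; intros T _; now apply continuous_ex_RInt.
- intros T HT; apply le_epsilon; intros eps He.
  destruct (Hlim eps He) as (T0 & HT0 & HT1).
  specialize (HT1 (Rmax T T0) (Rmax_r _ _)).
  assert (B := Htail T (Rmax T T0) HT (Rmax_l _ _)).
  replace (l - RInt phi 0 T) with
    ((RInt phi 0 (Rmax T T0) - RInt phi 0 T) + - (RInt phi 0 (Rmax T T0) - l)) by ring.
  apply Rle_trans with (1 := Rabs_triang _ _); rewrite Rabs_Ropp; lra.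
Qed.

(** * Solvability of elliptic equations on the line *)

Lemma contraction_fixed_point {X : CompleteNormedModule R_AbsRing} (Phi : X -> X) :
  (forall u v, vnorm (Phi u [-] Phi v) <= / 2 * vnorm (u [-] v)) ->
  exists u, Phi u = u.
Proof.
intros H; set (u := fun n => Nat.iter n Phi (vzero : X)).
set (D := vnorm (u 0%nat [-] u 1%nat)).
assert (HD : 0 <= D) by apply vnorm_ge_0.
assert (H0 : forall k, vnorm (u 0%nat [-] u k) <= 2 * D).
{ induction k as [|k IH]; [rewrite norm_minus_diag; lra|].
  apply Rle_trans with (1 := norm_minus_triangle (u 1%nat) _ _); fold D.
  assert (K := H (u 0%nat) (u k)).
  change (vnorm (u 1%nat [-] u (S k)) <= / 2 * vnorm (u 0%nat [-] u k)) in K.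
  lra. }
assert (Hn : forall n k, vnorm (u n [-] u (n + k)%nat) <= 2 * D * / 2 ^ n).
{ induction n as [|n IH]; intros k.
  - simpl pow; rewrite Rinv_1, Rmult_1_r; apply H0.
  - apply Rle_trans with (1 := H (u n) (u (n + k)%nat)).
    assert (E : / 2 ^ S n = / 2 * / 2 ^ n) by (simpl; apply Rinv_mult).
    rewrite E; specialize (IH k); lra. }
destruct (cauchy_seq_lim u) as [l Hl].
- intros eps He.
  destruct (small_factor (2 * D) eps ltac:(lra) He) as (d & Hd & Sm).
  destruct (pow_lt_1_zero (/ 2)) with (y := d) as [N HN]; auto.
  { rewrite Rabs_pos_eq; lra. }
  exists N; intros n m Hnm Hm; replace m with (n + (m - n))%nat by lia.
  apply Rle_trans with (1 := Hn n _); rewrite <- pow_inv; left; apply Sm.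
  assert (P : 0 < (/ 2) ^ n) by (apply pow_lt; lra).
  specialize (HN n Hnm); rewrite Rabs_pos_eq in HN; lra.
- exists l; apply (lim_unique (fun n => u (S n))).
  + apply filterlim_vnorm; [apply _|]; intros eps He.
    refine (filter_imp _ _ _ (proj1 (filterlim_vnorm _ u l) Hl eps He)).
    intros n Hn'; apply Rle_lt_trans with (1 := H (u n) l).
    assert (Q := vnorm_ge_0 (u n [-] l)); lra.
  + apply filterlim_comp with (2 := Hl).
    intros P [N HN]; exists N; intros n Hn'; apply HN; lia.
Qed.

(** Solved by [u x = exp x * (integral over [y >= x] of exp (- y) * r y)], the
    only bounded solution. *)
Lemma first_order_solvable (r : UCb) :
  exists u : UCb, forall x, is_derive u x (u x - r x).
Proof.
set (N := vnorm r); set (phi := fun y => exp (- y) * r y).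
assert (Hphi : forall y, continuous phi y).
{ intros y; apply (continuous_mult (fun y => exp (- y)) r); [|apply UCb_continuous].
  apply (ex_derive_continuous (V := R_NormedModule)); auto_derive; auto. }
assert (Hb : forall y, Rabs (phi y) <= N * exp (- y)).
{ intros y; unfold phi; rewrite Rabs_mult, Rabs_pos_eq, Rmult_comm
    by (left; apply exp_pos).
  apply Rmult_le_compat_r; [left; apply exp_pos | apply UCb_le_norm]. }
destruct (exp_dominated_integral phi N 1 Rlt_0_1 Hphi) as (l & _ & Hl).
{ intros y _; replace (- (1) * y) with (- y) by ring; apply Hb. }
rewrite Rdiv_1_r in Hl.
set (F := RInt phi 0).
assert (HF : forall x, is_derive F x (phi x))
  by (intros x; exact (is_derive_integral phi 0 x Hphi)).
assert (HFl : forall x, Rabs (l - F x) <= N * exp (- x)).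
{ intros x; destruct (Rle_lt_dec 0 x) as [Hx|Hx].
  - specialize (Hl x Hx); replace (- (1) * x) with (- x) in Hl by ring.
    unfold F; lra.
  - specialize (Hl 0 (Rle_refl 0)); rewrite Rmult_0_r, exp_0 in Hl.
    assert (E : RInt phi 0 0 = 0) by exact (RInt_point 0 phi); rewrite E in Hl.
    assert (B := RInt_bound phi (fun t => - N * exp (- t)) (fun t => N * exp (- t))
      x 0 (Rlt_le _ _ Hx) Hphi).
    assert (S : - RInt phi x 0 = F x) by exact (opp_RInt_swap phi x 0
      (continuous_ex_RInt phi x 0 Hphi)).
    assert (B' : Rabs (RInt phi x 0) <= N * exp (- x) - N).
    { replace (N * exp (- x) - N) with (- N * exp (- 0) - - N * exp (- x))
        by (rewrite Ropp_0, exp_0; ring).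
      apply B; auto; intros t; auto_derive; auto; ring. }
    rewrite <- S; apply Rabs_le_between in Hl; apply Rabs_le_between in B'.
    apply Rabs_le; lra. }
set (u := fun x => exp x * (l - F x)).
assert (Hu : forall x, is_derive u x (u x - r x)).
{ intros x; unfold u.
  replace (exp x * (l - F x) - r x)
    with (exp x * (l - F x) + exp x * (0 - phi x)).
  - apply (is_derive_mult exp (fun z => l - F z)); [| |apply Rmult_comm].
    + auto_derive; auto; ring.
    + apply (is_derive_minus (fun _ => l) F); [exact (is_derive_const l x) | auto].
  - unfold phi; rewrite exp_Ropp; field; apply Rgt_not_eq, exp_pos. }
assert (Hub : forall x, Rabs (u x) <= N).
{ intros x; unfold u; rewrite Rabs_mult, Rabs_pos_eq by (left; apply exp_pos).
  apply Rle_trans with (exp x * (N * exp (- x))).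
  - apply Rmult_le_compat_l; auto; left; apply exp_pos.
  - right; rewrite exp_Ropp; field; apply Rgt_not_eq, exp_pos. }
assert (HU : in_UCb u).
{ apply in_UCb_derive with (fun x => u x - r x); auto.
  - now exists N.
  - exists (N + N); intros x.
    assert (K1 := UCb_le_norm r x); assert (K2 := Hub x).
    assert (T := Rabs_triang (u x) (- r x)); rewrite Rabs_Ropp in T.
    unfold N in *; unfold Rminus; lra. }
exists (mkUCb u HU); exact Hu.
Qed.

Lemma in_UCb_reflect (f : UCb) : in_UCb (fun x => f (- x)).
Proof.
destruct (UCb_prop f) as [[M HM] Uf]; split; [now exists M; intros x|].
intros eps; destruct (Uf eps) as [d Hd]; exists d; intros x y _ _ Hxy.
apply Hd; auto.
replace (- x - - y) with (- (x - y)) by ring; now rewrite Rabs_Ropp.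
Qed.

Lemma is_derive_reflect (f : R -> R) (x l : R) :
  is_derive f (- x) l -> is_derive (fun y => f (- y)) x (- l).
Proof.
intros H; replace (- l) with (scal (-1) l) by (unfold scal; simpl; unfold mult; simpl; ring).
apply (is_derive_comp f (fun y => - y)); auto; auto_derive; auto; ring.
Qed.

Lemma first_order_solvable_neg (r : UCb) :
  exists u : UCb, forall x, is_derive u x (r x - u x).
Proof.
destruct (first_order_solvable (mkUCb _ (in_UCb_reflect r))) as [v Hv].
exists (mkUCb _ (in_UCb_reflect v)); intros x; simpl.
replace (r x - v (- x)) with (- (v (- x) - r (- - x)))
  by (rewrite !Ropp_involutive; ring).
apply is_derive_reflect, (Hv (- x)).
Qed.

Lemma model_equation_solvable (r : UCb) :
  exists f f1 f2, is_deriv f f1 /\ is_deriv f1 f2 /\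
    forall x, f2 x - f x = r x.
Proof.
(* f'' - f factors as (d/dx - 1) (d/dx + 1) f *)
destruct (first_order_solvable (vopp r)) as [v Hv].
destruct (first_order_solvable_neg v) as [f Hf].
exists f, (v [-] f), (r [+] f); split; [exact Hf|]; split.
- intros x.
  replace ((r [+] f) x) with (v x - - r x - (v x - f x)) by (simpl; ring).
  apply (is_derive_minus v f); auto; apply Hv.
- intros x; simpl; ring.
Qed.

(** Method of continuity: solvability is transported along the segment from
    [f'' - f] to the given operator in steps of fixed length, each step being a
    contraction for the unknown right-hand side [y] of the previous operator. *)
Lemma elliptic_solvable (A B Q : UCb) (a1 q : R) :
  0 < a1 -> 0 < q -> (forall x, a1 <= A x) -> (forall x, q <= Q x) ->
  forall r : UCb, exists f f1 f2, is_deriv f f1 /\ is_deriv f1 f2 /\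
    forall x, A x * f2 x + B x * f1 x - Q x * f x = r x.
Proof.
intros Ha Hq HA HQ.
set (one := UCb_const 1).
set (As := fun s : R => one [+] s [*] (A [-] one)).
set (Qs := fun s : R => one [+] s [*] (Q [-] one)).
set (Bs := fun s : R => s [*] B).
set (solv := fun s : R => forall r : UCb, exists f f1 f2 : UCb,
  is_deriv f f1 /\ is_deriv f1 f2 /\
  forall x, As s x * f2 x + Bs s x * f1 x - Qs s x * f x = r x).
set (a1' := Rmin 1 a1); set (q' := Rmin 1 q).
set (K := 1 + vnorm A + vnorm B + vnorm Q).
assert (NA := vnorm_ge_0 A); assert (NB := vnorm_ge_0 B);
assert (NQ := vnorm_ge_0 Q).
assert (Ha' : 0 < a1') by (apply Rmin_pos; lra).
assert (Hq' : 0 < q') by (apply Rmin_pos; lra).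
assert (Ha1 : a1' <= 1) by apply Rmin_l.
assert (Ha2 : a1' <= a1) by apply Rmin_r.
assert (Hq1 : q' <= 1) by apply Rmin_l.
assert (Hq2 : q' <= q) by apply Rmin_r.
destruct (elliptic_apriori K a1' q' Ha' Hq' ltac:(unfold K; lra))
  as (C & HC & Hap).
assert (HAs : forall s x, 0 <= s <= 1 -> a1' <= As s x <= K).
{ intros s x Hs; unfold As; simpl.
  assert (K1 := HA x); assert (K2 := UCb_le_norm A x).
  apply Rabs_le_between in K2; unfold K; nra. }
assert (HQs : forall s x, 0 <= s <= 1 -> q' <= Qs s x <= K).
{ intros s x Hs; unfold Qs; simpl.
  assert (K1 := HQ x); assert (K2 := UCb_le_norm Q x).
  apply Rabs_le_between in K2; unfold K; nra. }
assert (HBs : forall s x, 0 <= s <= 1 -> Rabs (Bs s x) <= K).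
{ intros s x Hs; unfold Bs; simpl; rewrite Rabs_mult, (Rabs_pos_eq s) by lra.
  assert (K2 := UCb_le_norm B x); assert (Q0 := Rabs_pos (B x)); unfold K; nra. }
set (Mop := fun f f1 f2 : UCb => UCb_mult (A [-] one) f2 [+] UCb_mult B f1
                                 [-] UCb_mult (Q [-] one) f).
set (C' := 2 * K * (C + C + / q')).
assert (Hiq : 0 < / q') by (now apply Rinv_0_lt_compat).
assert (HC' : 0 < C') by (unfold C', K; repeat apply Rmult_lt_0_compat; lra).
assert (HM : forall s (f f1 f2 r : UCb), 0 <= s <= 1 -> is_deriv f f1 -> is_deriv f1 f2 ->
  (forall x, As s x * f2 x + Bs s x * f1 x - Qs s x * f x = r x) ->
  vnorm (Mop f f1 f2) <= C' * vnorm r).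
{ intros s f f1 f2 r Hs H1 H2 Heq.
  destruct (Hap (As s) (Bs s) (Qs s) f f1 f2 r) as (B0 & B1 & B2); auto.
  apply UCb_norm_le; intros x; unfold Mop; simpl.
  assert (X0 := UCb_le_norm f x); assert (X1 := UCb_le_norm f1 x);
  assert (X2 := UCb_le_norm f2 x).
  assert (Y0 := UCb_le_norm A x); assert (Y1 := UCb_le_norm B x);
  assert (Y2 := UCb_le_norm Q x).
  assert (Z : forall y z m, Rabs y <= 2 * K -> Rabs z <= m -> Rabs (y * z) <= 2 * K * m).
  { intros y z m Hy Hz; rewrite Rabs_mult.
    apply Rmult_le_compat; auto using Rabs_pos. }
  assert (W : forall y, Rabs y <= K -> Rabs (y + - (1)) <= 2 * K).
  { intros y Hy; apply Rle_trans with (1 := Rabs_triang _ _).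
    rewrite (Rabs_left (- (1))) by lra; unfold K in *; lra. }
  assert (Z2 := Z (A x + - (1)) (f2 x) _ (W (A x) ltac:(unfold K; lra)) X2).
  assert (Z1 := Z (B x) (f1 x) _ ltac:(unfold K; lra) X1).
  assert (Z0 := Z (Q x + - (1)) (f x) _ (W (Q x) ltac:(unfold K; lra)) X0).
  apply Rle_trans with (1 := Rabs_triang _ _); rewrite Rabs_Ropp.
  assert (T := Rabs_triang ((A x + - (1)) * f2 x) (B x * f1 x)).
  apply Rle_trans with (2 * K * (vnorm f2 + vnorm f1 + vnorm f)); [lra|].
  replace (C' * vnorm r) with (2 * K * ((C + C + / q') * vnorm r))
    by (unfold C'; ring).
  apply Rmult_le_compat_l; [unfold K; lra|].
  unfold Rdiv in B0; lra. }
assert (Hbase : solv 0).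
{ intros r; destruct (model_equation_solvable r) as (f & f1 & f2 & H1 & H2 & H3).
  exists f, f1, f2; split; [auto | split; auto]; intros x; rewrite <- H3.
  unfold As, Bs, Qs; simpl; ring. }
assert (Hstep : forall s d, 0 <= s <= 1 -> 0 <= d -> d * C' <= / 2 ->
  solv s -> solv (s + d)).
{ intros s d Hs Hd HdC Hsolv r.
  assert (Hex : forall y : UCb, exists z : UCb, exists f f1 f2 : UCb,
    is_deriv f f1 /\ is_deriv f1 f2 /\
    (forall x, As s x * f2 x + Bs s x * f1 x - Qs s x * f x = y x) /\
    z = Mop f f1 f2).
  { intros y; destruct (Hsolv y) as (f & f1 & f2 & H1 & H2 & H3).
    exists (Mop f f1 f2), f, f1, f2; auto. }
  set (N := fun y : UCb => proj1_sig (constructive_indefinite_description _ (Hex y))).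
  assert (HN : forall y : UCb, exists f f1 f2 : UCb,
    is_deriv f f1 /\ is_deriv f1 f2 /\
    (forall x, As s x * f2 x + Bs s x * f1 x - Qs s x * f x = y x) /\
    N y = Mop f f1 f2).
  { intros y; unfold N.
    destruct (constructive_indefinite_description _ (Hex y)) as [z Hz]; exact Hz. }
  destruct (contraction_fixed_point (fun y => r [-] d [*] N y)) as [y Hy].
  { intros y y'.
    destruct (HN y) as (f & f1 & f2 & H1 & H2 & H3 & ->).
    destruct (HN y') as (g & g1 & g2 & G1 & G2 & G3 & ->).
    assert (E : Mop f f1 f2 [-] Mop g g1 g2 = Mop (f [-] g) (f1 [-] g1) (f2 [-] g2)).
    { apply UCb_eq; intros x; unfold Mop; simpl; ring. }
    replace (r [-] d [*] Mop f f1 f2 [-] (r [-] d [*] Mop g g1 g2))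
      with (vopp (d [*] (Mop f f1 f2 [-] Mop g g1 g2))) by module_eq.
    rewrite vnorm_opp, norm_scal_pos, E by auto.
    assert (B' : vnorm (Mop (f [-] g) (f1 [-] g1) (f2 [-] g2)) <= C' * vnorm (y [-] y')).
    { apply (HM s); auto using is_deriv_minus.
      intros x; simpl; rewrite <- H3, <- G3; unfold As, Bs, Qs; simpl; ring. }
    apply Rmult_le_compat_l with (r := d) in B'; auto.
    apply Rle_trans with (1 := B'); rewrite <- Rmult_assoc.
    apply Rmult_le_compat_r; auto; apply vnorm_ge_0. }
  destruct (HN y) as (f & f1 & f2 & H1 & H2 & H3 & H4).
  exists f, f1, f2; split; [auto | split; auto]; intros x.
  assert (E : y x = r x - d * Mop f f1 f2 x).
  { rewrite <- H4, <- Hy at 1; reflexivity. }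
  rewrite <- H3 in E; unfold Mop, As, Bs, Qs in *; simpl in *; lra. }
destruct (archimed_cor1 (/ (2 * C'))) as (n & Hn1 & Hn2).
{ apply Rinv_0_lt_compat; lra. }
assert (Hn3 : 0 < INR n) by now apply lt_0_INR.
assert (Hd0 : 0 < / INR n) by now apply Rinv_0_lt_compat.
assert (HdC : / INR n * C' <= / 2).
{ apply Rmult_lt_compat_r with (r := C') in Hn1; auto.
  replace (/ (2 * C') * C') with (/ 2) in Hn1 by (field; lra); lra. }
assert (Hall : forall j, (j <= n)%nat -> solv (INR j * / INR n)).
{ induction j as [|j IH]; intros Hj.
  - simpl; rewrite Rmult_0_l; exact Hbase.
  - rewrite S_INR, Rmult_plus_distr_r, Rmult_1_l; apply Hstep; auto; try lra.
    + split; [apply Rmult_le_pos; [apply pos_INR | lra]|].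
      rewrite <- (Rinv_r (INR n)) by lra.
      apply Rmult_le_compat_r; [lra | apply le_INR; lia].
    + apply IH; lia. }
specialize (Hall n (le_n n)); rewrite Rinv_r in Hall by lra.
intros r; destruct (Hall r) as (f & f1 & f2 & H1 & H2 & H3).
exists f, f1, f2; split; [auto | split; auto]; intros x; rewrite <- H3.
unfold As, Bs, Qs; simpl; ring.
Qed.

(** * Smoothing and the closure of the operator *)

Lemma is_deriv_closed (f f1 : nat -> UCb) (g g1 : UCb) :
  (forall n, is_deriv (f n) (f1 n)) ->
  filterlim f eventually (locally g) -> filterlim f1 eventually (locally g1) ->
  is_deriv g g1.
Proof.
intros Hd Hf Hf1 x; apply is_derive_Reals; intros eps He.
destruct (UCb_prop g1) as [_ Ug].
assert (He2 : 0 < eps / 2) by lra.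
destruct (Ug (mkposreal _ He2)) as [d Hdx]; exists d; intros h Hh Hhd.
enough (Rabs (g (x + h) - g x - h * g1 x) <= eps / 2 * Rabs h).
{ replace ((g (x + h) - g x) / h - g1 x) with (/ h * (g (x + h) - g x - h * g1 x))
    by (field; auto).
  rewrite Rabs_mult, Rabs_inv; assert (P := Rabs_pos_lt h Hh).
  apply Rmult_lt_reg_l with (Rabs h); auto.
  rewrite <- Rmult_assoc, Rinv_r, Rmult_1_l by lra.
  assert (0 < eps * Rabs h) by (now apply Rmult_lt_0_compat); lra. }
apply le_epsilon; intros e Hee.
assert (P := Rabs_pos h).
destruct (small_factor (2 + Rabs h) e ltac:(lra) Hee) as (z & He3 & Sm).
destruct (filter_ex (F := eventually) _ (filter_and _ _
  (proj1 (filterlim_vnorm eventually f g) Hf _ He3)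
  (proj1 (filterlim_vnorm eventually f1 g1) Hf1 _ He3))) as [n [N0 N1]].
assert (A0 := UCb_minus_le_norm (f n) g x).
assert (A1 := UCb_minus_le_norm (f n) g (x + h)).
destruct (MVT_all (f n) (f1 n) x (x + h) (Hd n)) as (y & Hy & E).
assert (A2 := UCb_minus_le_norm (f1 n) g1 y).
assert (A3 : Rabs (g1 y - g1 x) < eps / 2).
{ apply (Hdx y x I I).
  apply Rle_lt_trans with (2 := Hhd); apply Rabs_le.
  unfold Rmin, Rmax, Rabs in *; destruct (Rle_dec x (x + h)), (Rcase_abs h); lra. }
replace (g (x + h) - g x - h * g1 x) with
  (- (f n (x + h) - g (x + h)) + (f n x - g x)
   + (f1 n y - g1 y + (g1 y - g1 x)) * h)
  by (replace ((f1 n y - g1 y + (g1 y - g1 x)) * h)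
        with (f1 n y * (x + h - x) - h * g1 x) by ring; rewrite <- E; ring).
assert (T1 := Rabs_triang (- (f n (x + h) - g (x + h)) + (f n x - g x))
  ((f1 n y - g1 y + (g1 y - g1 x)) * h)).
assert (T2 := Rabs_triang (- (f n (x + h) - g (x + h))) (f n x - g x)).
assert (T3 := Rabs_triang (f1 n y - g1 y) (g1 y - g1 x)).
rewrite Rabs_Ropp in T2; rewrite Rabs_mult in T1.
assert (T4 : Rabs (f1 n y - g1 y + (g1 y - g1 x)) * Rabs h <= (z + eps / 2) * Rabs h)
  by (apply Rmult_le_compat_r; lra).
specialize (Sm z ltac:(lra)); lra.
Qed.

Definition antideriv (f : UCb) : R -> R := RInt f 0.

Lemma antideriv_spec (f : UCb) (x : R) : is_derive (antideriv f) x (f x).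
Proof. exact (is_derive_integral f 0 x (UCb_continuous f)). Qed.

(** The average of [f] over [x, x + h]. Unlike a convolution with a smooth kernel it
    is differentiated by a difference quotient, and it gains exactly one order. *)
Definition steklov_fun (h : R) (f : UCb) (x : R) : R :=
  / h * (antideriv f (x + h) - antideriv f x).

Definition diff_quot_fun (h : R) (f : UCb) (x : R) : R := / h * (f (x + h) - f x).

Lemma in_UCb_diff_quot (h : R) (f : UCb) : in_UCb (diff_quot_fun h f).
Proof.
apply in_UCb_scal, in_UCb_plus; [|apply in_UCb_opp; apply UCb_prop].
apply (in_UCb_shift f (fun _ => h)); [apply UCb_prop | apply in_UCb_const].
Qed.

Definition diff_quot (h : R) (f : UCb) : UCb := mkUCb _ (in_UCb_diff_quot h f).

Lemma is_derive_shift (f : R -> R) (h x l : R) :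
  is_derive f (x + h) l -> is_derive (fun y => f (y + h)) x l.
Proof.
intros H; replace l with (scal 1 l) by (unfold scal; simpl; unfold mult; simpl; ring).
apply (is_derive_comp f (fun y => y + h)); auto; auto_derive; auto; ring.
Qed.

Lemma is_derive_steklov_fun h f x :
  is_derive (steklov_fun h f) x (diff_quot_fun h f x).
Proof.
apply is_derive_scal, (is_derive_minus (fun y => antideriv f (y + h)));
  [apply is_derive_shift|]; apply antideriv_spec.
Qed.

Lemma steklov_fun_minus_mean (h : R) (f g : UCb) (x : R) : 0 < h ->
  exists z, x <= z <= x + h /\
    steklov_fun h f x - steklov_fun h g x = f z - g z.
Proof.
intros Hh.
destruct (MVT_all (fun y => antideriv f y - antideriv g y)
  (fun y => f y - g y) x (x + h)) as (z & Hz & E).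
- intros y; apply (is_derive_minus (antideriv f)); apply antideriv_spec.
- rewrite Rmin_left, Rmax_right in Hz by lra; exists z; split; auto.
  unfold steklov_fun; rewrite <- Rmult_minus_distr_l.
  apply Rmult_eq_reg_l with h; [|lra].
  rewrite <- Rmult_assoc, Rinv_r, Rmult_1_l by lra; lra.
Qed.

Lemma steklov_fun_mean (h : R) (f : UCb) (x : R) : 0 < h ->
  exists z, x <= z <= x + h /\ steklov_fun h f x = f z.
Proof.
intros Hh.
destruct (MVT_all (antideriv f) f x (x + h) (antideriv_spec f)) as (z & Hz & E).
rewrite Rmin_left, Rmax_right in Hz by lra; exists z; split; auto.
unfold steklov_fun; rewrite E; field; lra.
Qed.

Lemma in_UCb_steklov_fun (h : R) (f : UCb) : 0 < h -> in_UCb (steklov_fun h f).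
Proof.
intros Hh; apply in_UCb_derive with (diff_quot_fun h f).
- exists (vnorm f); intros x.
  destruct (steklov_fun_mean h f x Hh) as (z & _ & ->); apply UCb_le_norm.
- exact (proj1 (in_UCb_diff_quot h f)).
- apply is_derive_steklov_fun.
Qed.

Definition steklov (h : posreal) (f : UCb) : UCb :=
  mkUCb _ (in_UCb_steklov_fun h f (cond_pos h)).

Lemma is_deriv_steklov (h : posreal) (f : UCb) :
  is_deriv (steklov h f) (diff_quot h f).
Proof. intros x; apply is_derive_steklov_fun. Qed.

Lemma is_deriv_diff_quot (h : R) (f f1 : UCb) :
  is_deriv f f1 -> is_deriv (diff_quot h f) (diff_quot h f1).
Proof.
intros Hf x; apply is_derive_scal, (is_derive_minus (fun y => f (y + h)));
  [apply is_derive_shift|]; apply Hf.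
Qed.

Lemma is_deriv_steklov_deriv (h : posreal) (f f1 : UCb) :
  is_deriv f f1 -> is_deriv (steklov h f) (steklov h f1).
Proof.
intros Hf; apply is_deriv_ext with (1 := is_deriv_steklov h f).
intros x; simpl; unfold steklov_fun, diff_quot_fun; f_equal.
destruct (MVT_all (fun y => antideriv f1 y - f y) (fun y => f1 y - f1 y)
  x (x + h)) as (z & _ & E); [|lra].
intros y; apply (is_derive_minus (antideriv f1)); [apply antideriv_spec | apply Hf].
Qed.

Lemma steklov_contract (h : posreal) (f g : UCb) :
  vnorm (steklov h f [-] steklov h g) <= vnorm (f [-] g).
Proof.
apply UCb_norm_le; intros x.
destruct (steklov_fun_minus_mean h f g x (cond_pos h)) as (z & _ & E).
change (Rabs (steklov_fun h f x - steklov_fun h g x) <= vnorm (f [-] g)).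
rewrite E; apply UCb_minus_le_norm.
Qed.

Lemma steklov_close (h : posreal) (f : UCb) (e : R) :
  (forall x y, Rabs (x - y) <= h -> Rabs (f x - f y) <= e) ->
  vnorm (steklov h f [-] f) <= e.
Proof.
intros Hf; apply UCb_norm_le; intros x.
destruct (steklov_fun_mean h f x (cond_pos h)) as (z & Hz & E).
change (Rabs (steklov_fun h f x - f x) <= e); rewrite E; apply Hf.
apply Rabs_le; lra.
Qed.

Fixpoint Ck (k : nat) (f : UCb) : Prop :=
  match k with
  | O => True
  | S k => exists f1, is_deriv f f1 /\ Ck k f1
  end.

Lemma Ck_diff_quot k h f : Ck k f -> Ck k (diff_quot h f).
Proof.
revert f; induction k as [|k IH]; intros f; simpl; auto.
intros (f1 & H1 & H2); exists (diff_quot h f1); split; auto.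
now apply is_deriv_diff_quot.
Qed.

Lemma Ck_steklov k (h : posreal) f : Ck k f -> Ck (S k) (steklov h f).
Proof.
intros Hf; exists (diff_quot h f); split; [apply is_deriv_steklov|].
now apply Ck_diff_quot.
Qed.

(** Averages over lengths [e], [e / 2], [e / 4], and so on, the longest one being
    applied last: the limit over [k] is then the average over [e] of the limit for
    [e / 2]. *)
Fixpoint steklov_iter (k : nat) (e : posreal) (f : UCb) : UCb :=
  match k with
  | O => f
  | S k => steklov e (steklov_iter k (pos_div_2 e) f)
  end.

Definition lipschitz (L : R) (f : UCb) : Prop :=
  forall x y, Rabs (f x - f y) <= L * Rabs (x - y).

Lemma lipschitz_pos L f : lipschitz L f -> 0 <= L.
Proof.
intros Hf; specialize (Hf 1 0).
replace (1 - 0) with 1 in Hf by ring; rewrite Rabs_R1 in Hf.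
assert (P := Rabs_pos (f 1 - f 0)); lra.
Qed.

Lemma is_deriv_lipschitz f f1 : is_deriv f f1 -> lipschitz (vnorm f1) f.
Proof. intros Hf x y; now apply is_deriv_bound. Qed.

Lemma steklov_iter_step k L (e : posreal) f : lipschitz L f ->
  vnorm (steklov_iter (S k) e f [-] steklov_iter k e f) <= L * (e / 2 ^ k).
Proof.
intros Hf; assert (HL := lipschitz_pos L f Hf); revert e.
induction k as [|k IH]; intros e.
- apply steklov_close; intros x y Hxy; apply Rle_trans with (1 := Hf x y).
  simpl; apply Rmult_le_compat_l; auto; lra.
- apply Rle_trans with (1 := steklov_contract _ _ _).
  apply Rle_trans with (1 := IH (pos_div_2 e)); right.
  simpl; field; apply pow_nonzero; lra.
Qed.

Lemma steklov_iter_diff k j L (e : posreal) f : lipschitz L f ->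
  vnorm (steklov_iter (k + j) e f [-] steklov_iter k e f)
  <= 2 * L * e * (/ 2 ^ k - / 2 ^ (k + j)).
Proof.
intros Hf; induction j as [|j IH].
- rewrite Nat.add_0_r, norm_minus_diag; lra.
- rewrite Nat.add_succ_r.
  apply Rle_trans with (1 := norm_minus_triangle (steklov_iter (k + j) e f) _ _).
  assert (K := steklov_iter_step (k + j) L e f Hf).
  assert (E : / 2 ^ S (k + j) = / 2 * / 2 ^ (k + j)) by (simpl; apply Rinv_mult).
  rewrite E; unfold Rdiv in K; lra.
Qed.

Lemma steklov_iter_cv L (e : posreal) f : lipschitz L f ->
  exists l, filterlim (fun k => steklov_iter k e f) eventually (locally l).
Proof.
intros Hf; assert (HL := lipschitz_pos L f Hf).
apply (cauchy_seq_lim (fun k => steklov_iter k e f)); intros eps He.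
assert (He0 := cond_pos e).
destruct (small_factor (2 * L * e) eps) as (d & Hd & Sm);
  [repeat apply Rmult_le_pos; lra | auto |].
destruct (pow_lt_1_zero (/ 2)) with (y := d) as [N HN]; auto.
{ rewrite Rabs_pos_eq; lra. }
exists N; intros n m Hn Hm; replace m with (n + (m - n))%nat by lia.
rewrite norm_minus_sym.
apply Rle_trans with (1 := steklov_iter_diff n (m - n) L e f Hf).
assert (P : forall i, 0 < / 2 ^ i)
  by (intros i; apply Rinv_0_lt_compat, pow_lt; lra).
specialize (HN n Hn); rewrite pow_inv, Rabs_pos_eq in HN by (left; apply P).
assert (P1 := P n); assert (P2 := P (n + (m - n))%nat).
apply Rle_trans with (2 * L * e * / 2 ^ n).
- apply Rmult_le_compat_l; [repeat apply Rmult_le_pos|]; lra.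
- left; apply Sm; lra.
Qed.

(** The infinite composition of averages, a convolution with an infinitely
    differentiable kernel of support of length [2 e]. *)
Definition smoothing (e : posreal) (f : UCb) : UCb :=
  epsilon (inhabits f)
    (fun l => filterlim (fun k => steklov_iter k e f) eventually (locally l)).

Lemma smoothing_lim L (e : posreal) f : lipschitz L f ->
  filterlim (fun k => steklov_iter k e f) eventually (locally (smoothing e f)).
Proof.
intros Hf; exact (epsilon_spec (inhabits f)
  (fun l => filterlim (fun k => steklov_iter k e f) eventually (locally l))
  (steklov_iter_cv L e f Hf)).
Qed.

Lemma smoothing_close L (e : posreal) f : lipschitz L f ->
  vnorm (smoothing e f [-] f) <= 2 * L * e.
Proof.
intros Hf; apply (lim_norm_le _ _ _ _ (smoothing_lim L e f Hf)).
exists 0%nat; intros k _.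
assert (K := steklov_iter_diff 0 k L e f Hf); simpl Nat.add in K.
change (steklov_iter 0 e f) with f in K; apply Rle_trans with (1 := K).
assert (P : 0 < / 2 ^ k) by (apply Rinv_0_lt_compat, pow_lt; lra).
assert (HL := lipschitz_pos L f Hf); assert (He := cond_pos e).
assert (0 <= 2 * L * e * / 2 ^ k) by (repeat apply Rmult_le_pos; lra).
simpl pow at 1; rewrite Rinv_1; lra.
Qed.

Lemma smoothing_unfold L (e : posreal) f : lipschitz L f ->
  smoothing e f = steklov e (smoothing (pos_div_2 e) f).
Proof.
intros Hf; apply (lim_unique (fun k => steklov_iter (S k) e f)).
- apply filterlim_comp with (2 := smoothing_lim L e f Hf).
  intros P [N HN]; exists N; intros n Hn; apply HN; lia.
- apply filterlim_vnorm; [apply _|]; intros eps He.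
  refine (filter_imp _ _ _ (proj1 (filterlim_vnorm eventually _ _)
    (smoothing_lim L (pos_div_2 e) f Hf) eps He)).
  intros k Hk; apply Rle_lt_trans with (2 := Hk); apply steklov_contract.
Qed.

(** One order of differentiability is gained each time an average is peeled off. *)
Lemma smoothing_Ck k L (e : posreal) f : lipschitz L f -> Ck k (smoothing e f).
Proof.
intros Hf; revert e; induction k as [|k IH]; intros e; [exact I|].
rewrite (smoothing_unfold L) by auto; now apply Ck_steklov.
Qed.

Lemma is_deriv_steklov_iter k (e : posreal) f f1 :
  is_deriv f f1 -> is_deriv (steklov_iter k e f) (steklov_iter k e f1).
Proof.
intros Hf; revert e; induction k as [|k IH]; intros e; simpl; auto.
now apply is_deriv_steklov_deriv.
Qed.

Lemma is_deriv_smoothing L L1 (e : posreal) f f1 :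
  lipschitz L f -> lipschitz L1 f1 -> is_deriv f f1 ->
  is_deriv (smoothing e f) (smoothing e f1).
Proof.
intros Hf Hf1 Hd; apply (is_deriv_closed (fun k => steklov_iter k e f)
  (fun k => steklov_iter k e f1)).
- intros k; now apply is_deriv_steklov_iter.
- now apply (smoothing_lim L).
- now apply (smoothing_lim L1).
Qed.

Lemma steklov_lipschitz (h : posreal) f :
  lipschitz (vnorm (diff_quot h f)) (steklov h f).
Proof. apply is_deriv_lipschitz, is_deriv_steklov. Qed.

Lemma RinvN_small (d : R) : 0 < d -> eventually (fun n => RinvN n < d).
Proof.
intros Hd; destruct (RinvN_cv (eps := d) Hd) as [N HN]; exists N; intros n Hn.
specialize (HN n Hn); unfold Rdist in HN; rewrite Rminus_0_r in HN.
apply Rle_lt_trans with (2 := HN), Rle_abs.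
Qed.

Lemma steklov_approx (f : UCb) (eps : R) : 0 < eps ->
  eventually (fun n => vnorm (steklov (RinvN n) f [-] f) <= eps).
Proof.
intros He; destruct (UCb_prop f) as [_ Uf].
destruct (Uf (mkposreal _ He)) as [d Hd].
refine (filter_imp _ _ _ (RinvN_small d (cond_pos d))); intros n Hn.
apply steklov_close; intros x y Hxy; apply Rlt_le, (Hd x y I I); lra.
Qed.

Lemma smoothing_approx (h : posreal) (f : UCb) (eps : R) : 0 < eps ->
  eventually (fun n =>
    vnorm (smoothing (RinvN n) (steklov h f) [-] steklov h f) <= eps).
Proof.
intros He; assert (Hl := steklov_lipschitz h f).
set (L := vnorm (diff_quot h f)) in *; assert (HL := lipschitz_pos L _ Hl).
destruct (small_factor (2 * L) eps) as (d & Hd & Sm); [lra | auto |].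
refine (filter_imp _ _ _ (RinvN_small d Hd)); intros n Hn.
apply Rle_trans with (1 := smoothing_close L _ _ Hl); left; apply Sm.
assert (P := cond_pos (RinvN n)); lra.
Qed.

Lemma smooth_steklov_close (e h : posreal) (f : UCb) (eps : R) :
  vnorm (steklov h f [-] f) <= eps / 3 ->
  vnorm (smoothing e (steklov h f) [-] steklov h f) <= eps / 3 -> 0 < eps ->
  vnorm (smoothing e (steklov h f) [-] f) < eps.
Proof.
intros H1 H2 He.
apply Rle_lt_trans with (1 := norm_minus_triangle (steklov h f) _ _); lra.
Qed.

Lemma Ck_infty_dense (f : UCb) (eps : R) : 0 < eps ->
  exists p, (forall k, Ck k p) /\ vnorm (p [-] f) < eps.
Proof.
intros He; assert (He3 : 0 < eps / 3) by lra.
destruct (filter_ex (F := eventually) _ (steklov_approx f _ He3)) as [n Hn].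
set (h := RinvN n) in *.
destruct (filter_ex (F := eventually) _ (smoothing_approx h f _ He3)) as [m Hm].
exists (smoothing (RinvN m) (steklov h f)); split.
- intros k; eapply smoothing_Ck; apply steklov_lipschitz.
- now apply smooth_steklov_close.
Qed.

(** The speed of convergence of the infinite composition is controlled by a Lipschitz
    constant; a first average makes [f''] Lipschitz. *)
Lemma Ck_infty_dense_C2 (f f1 f2 : UCb) (eps : R) :
  is_deriv f f1 -> is_deriv f1 f2 -> 0 < eps ->
  exists p p1 p2, (forall k, Ck k p) /\ is_deriv p p1 /\ is_deriv p1 p2 /\
    vnorm (p [-] f) < eps /\ vnorm (p1 [-] f1) < eps /\ vnorm (p2 [-] f2) < eps.
Proof.
intros H1 H2 He; assert (He3 : 0 < eps / 3) by lra.
destruct (filter_ex (F := eventually) _ (filter_and _ _ (steklov_approx f _ He3)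
  (filter_and _ _ (steklov_approx f1 _ He3) (steklov_approx f2 _ He3))))
  as (n & N0 & N1 & N2).
set (h := RinvN n) in *.
destruct (filter_ex (F := eventually) _ (filter_and _ _ (smoothing_approx h f _ He3)
  (filter_and _ _ (smoothing_approx h f1 _ He3) (smoothing_approx h f2 _ He3))))
  as (m & M0 & M1 & M2).
set (e := RinvN m) in *.
exists (smoothing e (steklov h f)), (smoothing e (steklov h f1)),
  (smoothing e (steklov h f2)).
split; [intros k; eapply smoothing_Ck; apply steklov_lipschitz|].
split; [eapply is_deriv_smoothing; try apply steklov_lipschitz;
  now apply is_deriv_steklov_deriv|].
split; [eapply is_deriv_smoothing; try apply steklov_lipschitz;
  now apply is_deriv_steklov_deriv|].
split; [|split]; now apply smooth_steklov_close.
Qed.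

Lemma Ck_Derive_n n (f : UCb) : Ck n f -> forall k, (k <= n)%nat ->
  exists g : UCb, (forall x, Derive_n f k x = g x) /\
    (forall x, ex_derive_n f k x) /\ Ck (n - k) g.
Proof.
intros Hf; induction k as [|k IH]; intros Hk.
- exists f; rewrite Nat.sub_0_r; repeat split; auto.
- destruct IH as (g & Hg & _ & Hgk); [lia|].
  replace (n - k)%nat with (S (n - S k)) in Hgk by lia.
  destruct Hgk as (g1 & Hg1 & Hgk); exists g1; split; [|split; auto].
  + intros x; simpl; rewrite (Derive_ext _ _ x Hg).
    apply is_derive_unique, Hg1.
  + intros x; simpl; apply (ex_derive_ext g); [intros y; now rewrite Hg|].
    exists (g1 x); apply Hg1.
Qed.

Lemma Ck_infty_Cb (f : UCb) : (forall k, Ck k f) -> Cb_infty f.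
Proof.
intros Hf n k Hk; destruct (Ck_Derive_n n f (Hf n) k Hk) as (g & H1 & H2 & _).
split; auto; exists (vnorm g); intros x; rewrite H1; apply UCb_le_norm.
Qed.

Lemma bounded_derivs_UCb n (f : UCb) k :
  bounded_derivs (S n) f -> (k <= n)%nat -> exists g : UCb, forall x, g x = Derive_n f k x.
Proof.
intros Hf Hk; assert (HU : in_UCb (Derive_n f k)).
{ apply in_UCb_derive with (Derive_n f (S k)).
  - apply (Hf k); lia.
  - apply (Hf (S k)); lia.
  - intros x; apply Derive_correct; apply (Hf (S k)); lia. }
now exists (mkUCb _ HU).
Qed.

Lemma bounded_derivs_is_deriv n (f g g1 : UCb) k :
  bounded_derivs n f -> (k < n)%nat ->
  (forall x, g x = Derive_n f k x) -> (forall x, g1 x = Derive_n f (S k) x) ->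
  is_deriv g g1.
Proof.
intros Hf Hk Hg Hg1 x; rewrite Hg1.
apply (is_derive_ext (Derive_n f k)); [intros y; now rewrite Hg|].
apply Derive_correct; apply (Hf (S k)); lia.
Qed.

Section Second_order_operator.
Variables (a b c : UCb) (a0 : R).
Hypotheses (Ha0 : 0 < a0) (Ha : forall x, a0 <= a x).

(** The operator on its natural domain; [closure_operA] identifies it with the closure
    of its restriction to smooth functions. *)
Definition opgraph : graph UCb := fun p =>
  exists f1 f2, is_deriv (fst p) f1 /\ is_deriv f1 f2 /\
    forall x, snd p x = a x * f2 x + b x * f1 x + c x * fst p x.

Lemma zero_order_bounds lambda x : vnorm c < lambda ->
  lambda - vnorm c <= lambda - c x <= lambda + vnorm c.
Proof.
intros Hl; assert (K := UCb_le_norm c x); apply Rabs_le_between in K; lra.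
Qed.

(** Stated for derivatives that may be unbounded or discontinuous, so that it applies
    to every classical solution. *)
Lemma operator_dissipative (lambda : R) (f : UCb) (f1 f2 : R -> R) (r : R) :
  vnorm c < lambda -> 0 <= r ->
  (forall x, is_derive f x (f1 x)) -> (forall x, is_derive f1 x (f2 x)) ->
  (forall x, Rabs (a x * f2 x + b x * f1 x + (c x - lambda) * f x) <= r) ->
  (lambda - vnorm c) * vnorm f <= r.
Proof.
intros Hl Hr H1 H2 Heq.
assert (B : vnorm f <= r / (lambda - vnorm c)).
{ apply UCb_norm_le.
  apply (elliptic_bound a b (fun x => lambda - c x) f f1 f2
    (vnorm a + vnorm b) (vnorm f)); auto; try lra.
  - intros x; assert (K1 := Ha x); assert (K2 := UCb_le_norm a x).
    assert (K3 := vnorm_ge_0 b); apply Rabs_le_between in K2; lra.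
  - intros x; assert (K1 := UCb_le_norm b x); assert (K3 := vnorm_ge_0 a); lra.
  - intros x; now apply zero_order_bounds.
  - apply UCb_le_norm.
  - intros x; specialize (Heq x).
    replace (a x * f2 x + b x * f1 x - (lambda - c x) * f x)
      with (a x * f2 x + b x * f1 x + (c x - lambda) * f x) by ring; auto. }
apply Rmult_le_compat_l with (r := lambda - vnorm c) in B; [|lra].
replace ((lambda - vnorm c) * (r / (lambda - vnorm c))) with r in B by (field; lra).
exact B.
Qed.

Lemma operator_m_dissipative : m_dissipative (vnorm c) opgraph.
Proof.
split.
- intros f g f' g' (f1 & f2 & H1 & H2 & H3) (f1' & f2' & H1' & H2' & H3').
  exists (f1 [+] f1'), (f2 [+] f2').
  split; [now apply is_deriv_plus|]; split; [now apply is_deriv_plus|].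
  simpl in *; intros x; rewrite H3, H3'; ring.
- intros k f g (f1 & f2 & H1 & H2 & H3).
  exists (k [*] f1), (k [*] f2).
  split; [now apply is_deriv_scal|]; split; [now apply is_deriv_scal|].
  simpl in *; intros x; rewrite H3; ring.
- intros f eps He; destruct (Ck_infty_dense f eps He) as (p & Hp & Hpf).
  destruct (Hp 2%nat) as (p1 & H1 & p2 & H2 & _).
  exists p, (UCb_mult a p2 [+] UCb_mult b p1 [+] UCb_mult c p); split; auto.
  exists p1, p2; split; [auto | split; auto]; intros x; reflexivity.
- intros mu f g Hmu (f1 & f2 & H1 & H2 & H3).
  apply (operator_dissipative mu f f1 f2); auto; [apply vnorm_ge_0|].
  intros x; assert (K := UCb_le_norm (mu [*] f [-] g) x).
  rewrite <- Rabs_Ropp; simpl in H3, K; rewrite H3 in K.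
  replace (- (a x * f2 x + b x * f1 x + (c x - mu) * f x)) with
    (mu * f x + - (a x * f2 x + b x * f1 x + c x * f x)) by ring; exact K.
- intros mu g Hmu.
  destruct (elliptic_solvable a b (UCb_const mu [-] c) a0 (mu - vnorm c)
    Ha0 ltac:(lra) Ha (fun x => proj1 (zero_order_bounds mu x Hmu)) (vopp g))
    as (f & f1 & f2 & H1 & H2 & H3).
  exists f, f1, f2; split; [auto | split; auto]; simpl in *.
  intros x; specialize (H3 x); lra.
Qed.

Lemma operA_opgraph p : operA a b c p -> opgraph p.
Proof.
destruct p as [f g]; intros [Hf Hg].
destruct (bounded_derivs_UCb 2 f 1 (Hf 3%nat)) as [f1 Hf1]; [lia|].
destruct (bounded_derivs_UCb 2 f 2 (Hf 3%nat)) as [f2 Hf2]; [lia|].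
exists f1, f2; split; [|split].
- apply (bounded_derivs_is_deriv 3 f f f1 0); auto.
- apply (bounded_derivs_is_deriv 3 f f1 f2 1); auto.
- intros x; simpl; rewrite Hg, Hf1, Hf2; reflexivity.
Qed.

(** A limit of graph points is compared with the exact solution of the resolvent
    equation, so that no derivative of the approximants has to converge. Conversely
    points of the graph are smoothed. *)
Lemma closure_operA p : closure_of (operA a b c) p <-> opgraph p.
Proof.
assert (HG := operator_m_dissipative); destruct p as [f g]; split.
- intros Hcl; set (mu := vnorm c + 1).
  assert (Hmu : vnorm c < mu) by (unfold mu; lra).
  assert (Hmu0 : 0 < mu) by (unfold mu; assert (K := vnorm_ge_0 c); lra).
  destruct (md_range _ _ HG mu (mu [*] f [-] g) Hmu) as [f' Hf'].
  enough (E : f' = f).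
  { rewrite E in Hf'; replace g with (mu [*] f [-] (mu [*] f [-] g))
      by module_eq; auto. }
  apply norm_minus_eq_zero, le_epsilon; intros eps He; rewrite Rplus_0_l.
  destruct (small_factor (mu + 2) eps ltac:(lra) He) as (e & He' & Sm).
  destruct (Hcl (mkposreal _ He')) as ([u v] & [Hu Hv] & Huv).
  apply operA_opgraph in Huv.
  change (vnorm (u [-] f) < e) in Hu.
  change (vnorm (v [-] g) < e) in Hv.
  assert (D := md_diss _ _ HG mu _ _ Hmu (md_minus _ _ _ _ _ _ HG Huv Hf')).
  replace (mu - vnorm c) with 1 in D by (unfold mu; ring).
  rewrite Rmult_1_l in D.
  replace (mu [*] (u [-] f') [-] (v [-] (mu [*] f' [-] (mu [*] f [-] g))))
    with (mu [*] (u [-] f) [-] (v [-] g)) in D by module_eq.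
  assert (T := vnorm_triangle (mu [*] (u [-] f)) (vopp (v [-] g))).
  rewrite vnorm_opp, norm_scal_pos in T by lra.
  change (vnorm (mu [*] (u [-] f) [-] (v [-] g)) <=
    mu * vnorm (u [-] f) + vnorm (v [-] g)) in T.
  assert (T2 := norm_minus_triangle u f' f).
  rewrite (norm_minus_sym f' u) in T2.
  assert (T3 : mu * vnorm (u [-] f) <= mu * e)
    by (apply Rmult_le_compat_l; lra).
  specialize (Sm e ltac:(lra)); lra.
- intros (f1 & f2 & H1 & H2 & H3) eps.
  set (M := vnorm a + vnorm b + vnorm c + 1).
  assert (Na := vnorm_ge_0 a); assert (Nb := vnorm_ge_0 b);
  assert (Nc := vnorm_ge_0 c); assert (Pe := cond_pos eps).
  destruct (small_factor M eps ltac:(unfold M; lra) Pe) as (d & He & Sm).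
  specialize (Sm d ltac:(lra)).
  destruct (Ck_infty_dense_C2 f f1 f2 _ H1 H2 He)
    as (p & p1 & p2 & Hp & D1 & D2 & E0 & E1 & E2).
  set (h := UCb_mult a p2 [+] UCb_mult b p1 [+] UCb_mult c p).
  exists (p, h); split; [split|].
  + change (vnorm (p [-] f) < eps); unfold M in Sm; nra.
  + change (vnorm (h [-] g) < eps).
    apply Rle_lt_trans with (M * d); [|auto].
    apply UCb_norm_le; intros x; simpl in *; rewrite H3.
    assert (X0 := UCb_minus_le_norm p f x).
    assert (X1 := UCb_minus_le_norm p1 f1 x).
    assert (X2 := UCb_minus_le_norm p2 f2 x).
    assert (Y0 := UCb_le_norm a x); assert (Y1 := UCb_le_norm b x);
    assert (Y2 := UCb_le_norm c x).
    replace (a x * p2 x + b x * p1 x + c x * p x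
             + - (a x * f2 x + b x * f1 x + c x * f x)) with
      (a x * (p2 x - f2 x) + b x * (p1 x - f1 x) + c x * (p x - f x)) by ring.
    assert (Z : forall y z m, Rabs y <= m -> Rabs z <= d -> Rabs (y * z) <= m * d).
    { intros y z m Hy Hz; rewrite Rabs_mult.
      apply Rmult_le_compat; auto using Rabs_pos. }
    assert (Z2 := Z (a x) (p2 x - f2 x) _ Y0 ltac:(lra)).
    assert (Z1 := Z (b x) (p1 x - f1 x) _ Y1 ltac:(lra)).
    assert (Z0 := Z (c x) (p x - f x) _ Y2 ltac:(lra)).
    apply Rle_trans with (1 := Rabs_triang _ _).
    assert (T := Rabs_triang (a x * (p2 x - f2 x)) (b x * (p1 x - f1 x))).
    unfold M; lra.
  + split; [now apply Ck_infty_Cb|]; intros x.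
    assert (Q1 : forall y, Derive_n p 1 y = p1 y)
      by (intros y; apply is_derive_unique, D1).
    assert (Q2 : Derive_n p 2 x = p2 x).
    { change (Derive (Derive_n p 1) x = p2 x).
      rewrite (Derive_ext _ _ x Q1); apply is_derive_unique, D2. }
    rewrite Q1, Q2; reflexivity.
Qed.

End Second_order_operator.

Lemma generates_ext {X : CompleteNormedModule R_AbsRing} (G H : graph X) V :
  (forall p, G p <-> H p) -> generates G V -> generates H V.
Proof.
intros E [H1 H2]; split; auto; intros p; rewrite <- E; apply H2.
Qed.

(** * Regularity on the domain of the square of the operator *)

Lemma UCb_mult_bound (u v : UCb) (K m : R) :
  vnorm u <= K -> vnorm v <= m -> vnorm (UCb_mult u v) <= K * m.
Proof.
intros Hu Hv; apply UCb_norm_le; intros x; simpl; rewrite Rabs_mult.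
assert (H1 := UCb_le_norm u x); assert (H2 := UCb_le_norm v x).
apply Rmult_le_compat; auto using Rabs_pos; lra.
Qed.

Lemma plus_bound (u v : UCb) (m n : R) :
  vnorm u <= m -> vnorm v <= n -> vnorm (u [+] v) <= m + n.
Proof. intros Hu Hv; apply Rle_trans with (1 := vnorm_triangle _ _); lra. Qed.

Lemma minus_bound (u v : UCb) (m n : R) :
  vnorm u <= m -> vnorm v <= n -> vnorm (u [-] v) <= m + n.
Proof.
intros Hu Hv; replace (u [-] v) with (u [+] vopp v) by module_eq.
apply plus_bound; auto; now rewrite vnorm_opp.
Qed.

Definition norm_sum (l : list UCb) : R :=
  fold_right (fun u s => vnorm u + s) 0 l.

Lemma norm_sum_ge_0 l : 0 <= norm_sum l.
Proof.
induction l as [|u l IH]; simpl; [lra|]; assert (N := vnorm_ge_0 u); lra.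
Qed.

Lemma norm_sum_ge u l : In u l -> vnorm u <= norm_sum l.
Proof.
induction l as [|v l IH]; simpl; [easy|].
assert (N := vnorm_ge_0 v); assert (P := norm_sum_ge_0 l).
intros [->|Hu]; [lra | specialize (IH Hu); lra].
Qed.

(** Bookkeeping of bounds by multiples of one quantity [S]: every coefficient
    [u] is bounded by [K], every derivative [v] by a multiple of [S]. *)
Lemma scaled_mult_bound (S K m : R) (u v : UCb) :
  vnorm u <= K -> vnorm v <= m * S -> vnorm (UCb_mult u v) <= K * m * S.
Proof. intros Hu Hv; rewrite Rmult_assoc; now apply UCb_mult_bound. Qed.

Lemma scaled_plus_bound (S m n : R) (u v : UCb) :
  vnorm u <= m * S -> vnorm v <= n * S -> vnorm (u [+] v) <= (m + n) * S.
Proof. intros Hu Hv; rewrite Rmult_plus_distr_r; now apply plus_bound. Qed.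

Lemma scaled_minus_bound (S m n : R) (u v : UCb) :
  vnorm u <= m * S -> vnorm v <= n * S -> vnorm (u [-] v) <= (m + n) * S.
Proof. intros Hu Hv; rewrite Rmult_plus_distr_r; now apply minus_bound. Qed.

Lemma is_deriv_unique (f f1 f1' : UCb) :
  is_deriv f f1 -> is_deriv f f1' -> f1 = f1'.
Proof.
intros H H'; apply UCb_eq; intros x.
rewrite <- (is_derive_unique _ _ _ (H x)); apply is_derive_unique, H'.
Qed.

Lemma UCb_inverse (a a' : UCb) (a0 : R) :
  0 < a0 -> (forall x, a0 <= a x) -> is_deriv a a' ->
  exists ia : UCb, (forall x, ia x * a x = 1) /\
    is_deriv ia (vopp (UCb_mult a' (UCb_mult ia ia))).
Proof.
intros Ha0 Ha Hd.
assert (Hinv : forall x, 0 < / a x <= / a0).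
{ intros x; specialize (Ha x); split; [apply Rinv_0_lt_compat; lra|].
  apply Rinv_le_contravar; lra. }
assert (HD : forall x, is_derive (fun x => / a x) x (- (a' x * (/ a x * / a x)))).
{ intros x; replace (- (a' x * (/ a x * / a x))) with (- a' x / a x ^ 2)
    by (field; specialize (Ha x); lra).
  apply is_derive_inv; [apply Hd | specialize (Ha x); lra]. }
assert (HU : in_UCb (fun x => / a x)).
{ apply in_UCb_derive with (3 := HD).
  - exists (/ a0); intros x; specialize (Hinv x); rewrite Rabs_pos_eq; lra.
  - exists (vnorm a' * (/ a0 * / a0)); intros x; cbv beta.
    rewrite Rabs_Ropp, !Rabs_mult; specialize (Hinv x).
    rewrite (Rabs_pos_eq (/ a x)) by lra.
    apply Rmult_le_compat; [apply Rabs_pos| |apply UCb_le_norm|].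
    + apply Rmult_le_pos; lra.
    + apply Rmult_le_compat; lra. }
exists (mkUCb _ HU); split; [|exact HD].
intros x; simpl; apply Rinv_l; specialize (Ha x); lra.
Qed.

Lemma UCb_mult_lower_bound (a f : UCb) (a0 m : R) :
  0 < a0 -> (forall x, a0 <= a x) -> vnorm (UCb_mult a f) <= m ->
  vnorm f <= m / a0.
Proof.
intros Ha0 Ha Hm; apply UCb_norm_le; intros x.
assert (K := UCb_le_norm (UCb_mult a f) x); simpl in K; rewrite Rabs_mult in K.
specialize (Ha x); rewrite (Rabs_pos_eq (a x)) in K by lra.
apply Rmult_le_reg_r with a0; auto; unfold Rdiv.
rewrite Rmult_assoc, Rinv_l, Rmult_1_r by lra.
assert (P := Rabs_pos (f x)).
assert (a0 * Rabs (f x) <= a x * Rabs (f x)) by (apply Rmult_le_compat_r; lra).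
lra.
Qed.

Section Second_power.
Variables (a b c a1 a2 b1 b2 c1 c2 : UCb) (a0 : R).
Hypotheses (Ha0 : 0 < a0) (Ha : forall x, a0 <= a x).
Hypotheses (Ha1 : is_deriv a a1) (Ha2 : is_deriv a1 a2).
Hypotheses (Hb1 : is_deriv b b1) (Hb2 : is_deriv b1 b2).
Hypotheses (Hc1 : is_deriv c c1) (Hc2 : is_deriv c1 c2).

Let G := opgraph a b c.

(** [lambda f - A f = lambda f - g] with [lambda = |c| + 1], to which the a priori
    bound applies. *)
Lemma opgraph_bounds : exists C, 0 < C /\ forall f g f1 f2 : UCb,
  is_deriv f f1 -> is_deriv f1 f2 ->
  (forall x, g x = a x * f2 x + b x * f1 x + c x * f x) ->
  vnorm f1 <= C * (vnorm f + vnorm g) /\ vnorm f2 <= C * (vnorm f + vnorm g).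
Proof.
set (lam := vnorm c + 1).
assert (Nc := vnorm_ge_0 c); assert (Na := vnorm_ge_0 a);
assert (Nb := vnorm_ge_0 b).
set (K := a0 + vnorm a + vnorm b + 2 * vnorm c + 1).
destruct (elliptic_apriori K a0 1 Ha0 ltac:(lra) ltac:(unfold K; lra))
  as (C & HC & Hap).
exists (C * (lam + 1)); split; [unfold lam; apply Rmult_lt_0_compat; lra|].
intros f g f1 f2 H1 H2 Hg.
assert (Nf := vnorm_ge_0 f); assert (Ng := vnorm_ge_0 g).
assert (Hr : vnorm (g [-] lam [*] f) <= (lam + 1) * (vnorm f + vnorm g)).
{ apply Rle_trans with (vnorm g + lam * vnorm f).
  - apply minus_bound; [lra|]; rewrite norm_scal_pos; unfold lam; lra.
  - unfold lam; nra. }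
destruct (Hap a b (UCb_const lam [-] c) f f1 f2 (g [-] lam [*] f))
  as (_ & B1 & B2); auto.
- intros x; assert (X := UCb_le_norm a x); apply Rabs_le_between in X.
  specialize (Ha x); unfold K; lra.
- intros x; assert (X := UCb_le_norm b x); unfold K; lra.
- intros x; simpl; assert (X := UCb_le_norm c x); apply Rabs_le_between in X.
  unfold K, lam; lra.
- intros x; simpl; rewrite Hg; ring.
- rewrite (Rmult_assoc C); split; eapply Rle_trans; eauto;
    apply Rmult_le_compat_l; lra.
Qed.

(** In [a f'' = g - b f' - c f] the right-hand side is differentiable, and then twice
    differentiable, because [g] and [f] are; the bounds on [f'''] and [f''''] come
    from differentiating this identity. *)
Lemma opgraph2_regular : exists C, 0 <= C /\ forall f g k : UCb,
  G (f, g) -> G (g, k) -> exists f1 f2 f3 f4 : UCb,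
    is_deriv f f1 /\ is_deriv f1 f2 /\ is_deriv f2 f3 /\ is_deriv f3 f4 /\
    (forall x, g x = a x * f2 x + b x * f1 x + c x * f x) /\
    vnorm f2 <= C * (vnorm f + vnorm g + vnorm k) /\
    vnorm f4 <= C * (vnorm f + vnorm g + vnorm k).
Proof.
destruct opgraph_bounds as (C & HC & HB).
set (K := norm_sum [a1; a2; b; b1; b2; c; c1; c2]).
assert (HK : 0 <= K) by apply norm_sum_ge_0.
assert (Kc : forall u, In u [a1; a2; b; b1; b2; c; c1; c2] -> vnorm u <= K)
  by (intros u; apply norm_sum_ge).
set (M2 := C + (K * C + K * C) + (K * 1 + K * C)).
set (M3 := (M2 + K * C) / a0).
set (M4 := C + (K * C + K * C + (K * C + K * M3))
             + (K * 1 + K * C + (K * C + K * C))).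
set (M5 := (M4 + (K * C + K * M3) + K * M3) / a0).
assert (HKC : 0 <= K * C) by (apply Rmult_le_pos; lra).
assert (P2 : 0 <= M2) by (unfold M2; lra).
assert (P3 : 0 <= M3) by (apply Rdiv_le_0_compat; lra).
assert (HKM : 0 <= K * M3) by (apply Rmult_le_pos; lra).
assert (P5 : 0 <= M5) by (apply Rdiv_le_0_compat; unfold M4; lra).
exists (C + M5); split; [lra|]; intros f g k (f1 & f2 & F1 & F2 & Ef) (g1 & g2 & G1 & G2 & Eg).
simpl in *; set (S := vnorm f + vnorm g + vnorm k).
assert (Nf := vnorm_ge_0 f); assert (Ng := vnorm_ge_0 g);
assert (Nk := vnorm_ge_0 k).
destruct (HB f g f1 f2 F1 F2 Ef) as [Bf1 Bf2].
destruct (HB g k g1 g2 G1 G2 Eg) as [Bg1 Bg2].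
assert (HS : forall (u : UCb) m, vnorm u <= C * m -> m <= S -> vnorm u <= C * S).
{ intros u m Hu Hm; apply Rle_trans with (1 := Hu).
  apply Rmult_le_compat_l; lra. }
apply HS in Bf1; [|unfold S; lra]; apply HS in Bf2; [|unfold S; lra].
apply HS in Bg1; [|unfold S; lra]; apply HS in Bg2; [|unfold S; lra].
assert (Bf : vnorm f <= 1 * S) by (unfold S; lra).
assert (S0 : 0 <= S) by (unfold S; lra).
destruct (UCb_inverse a a1 a0 Ha0 Ha Ha1) as (ia & Eia & Dia).
set (N := g [-] UCb_mult b f1 [-] UCb_mult c f).
set (N1 := g1 [-] (UCb_mult b1 f1 [+] UCb_mult b f2)
              [-] (UCb_mult c1 f [+] UCb_mult c f1)).
assert (DN : is_deriv N N1)
  by (unfold N, N1; apply is_deriv_minus; [apply is_deriv_minus; [assumption|]|];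
      apply is_deriv_mult; assumption).
assert (Ef2 : f2 = UCb_mult ia N).
{ apply UCb_eq; intros x; unfold N; simpl; rewrite Ef.
  transitivity (ia x * a x * f2 x); [rewrite Eia; ring | ring]. }
assert (EN : UCb_mult a f2 = N).
{ apply UCb_eq; intros x; unfold N; simpl; rewrite Ef; ring. }
assert (Hf3 : exists f3, is_deriv f2 f3).
{ rewrite Ef2; eexists; apply is_deriv_mult; eauto. }
destruct Hf3 as [f3 F3].
set (N2 := g2 [-] (UCb_mult b2 f1 [+] UCb_mult b1 f2
                   [+] (UCb_mult b1 f2 [+] UCb_mult b f3))
              [-] (UCb_mult c2 f [+] UCb_mult c1 f1
                   [+] (UCb_mult c1 f1 [+] UCb_mult c f2))).
assert (DN1 : is_deriv N1 N2).
{ unfold N1, N2; apply is_deriv_minus; [apply is_deriv_minus; [assumption|]|];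
    (apply is_deriv_plus; apply is_deriv_mult; assumption). }
assert (EN1 : UCb_mult a1 f2 [+] UCb_mult a f3 = N1).
{ apply (is_deriv_unique N); auto; rewrite <- EN; apply is_deriv_mult; auto. }
assert (Ef3 : f3 = UCb_mult ia (N1 [-] UCb_mult a1 f2)).
{ apply UCb_eq; intros x; rewrite <- EN1; simpl.
  transitivity (ia x * a x * f3 x); [rewrite Eia; ring | ring]. }
assert (Hf4 : exists f4, is_deriv f3 f4).
{ rewrite Ef3; eexists; apply is_deriv_mult; eauto.
  apply is_deriv_minus; eauto; apply is_deriv_mult; eauto. }
destruct Hf4 as [f4 F4].
assert (EN2 : UCb_mult a2 f2 [+] UCb_mult a1 f3
  [+] (UCb_mult a1 f3 [+] UCb_mult a f4) = N2).
{ apply (is_deriv_unique N1); auto; rewrite <- EN1.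
  apply is_deriv_plus; apply is_deriv_mult; auto. }
assert (Bm : forall (u v : UCb) m,
  In u [a1; a2; b; b1; b2; c; c1; c2] -> vnorm v <= m * S ->
  vnorm (UCb_mult u v) <= K * m * S) by (intros; apply scaled_mult_bound; auto).
assert (Bp := scaled_plus_bound S); assert (Bs := scaled_minus_bound S).
simpl in Bm.
assert (BN1 : vnorm N1 <= M2 * S).
{ apply Bs; [apply Bs; auto|]; apply Bp; apply Bm; auto 12. }
assert (Bf3 : vnorm f3 <= M3 * S).
{ replace (M3 * S) with ((M2 + K * C) * S / a0) by (unfold M3; field; lra).
  apply (UCb_mult_lower_bound a); auto.
  replace (UCb_mult a f3) with (N1 [-] UCb_mult a1 f2)
    by (rewrite <- EN1; module_eq).
  apply Bs; auto. }
assert (BN2 : vnorm N2 <= M4 * S).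
{ apply Bs; [apply Bs; auto|]; (apply Bp; (apply Bp; apply Bm; auto 12)). }
assert (Bf4 : vnorm f4 <= M5 * S).
{ replace (M5 * S) with ((M4 + (K * C + K * M3) + K * M3) * S / a0)
    by (unfold M5; field; lra).
  apply (UCb_mult_lower_bound a); auto.
  replace (UCb_mult a f4) with
    (N2 [-] (UCb_mult a2 f2 [+] UCb_mult a1 f3) [-] UCb_mult a1 f3)
    by (rewrite <- EN2; module_eq).
  apply Bs; auto; apply Bs; auto; apply Bp; auto. }
exists f1, f2, f3, f4; fold S.
assert (0 <= C * S) by (apply Rmult_le_pos; lra).
assert (0 <= M5 * S) by (apply Rmult_le_pos; lra).
do 5 (split; [assumption|]); rewrite Rmult_plus_distr_r; split; lra.
Qed.

Lemma C4_opgraph2 : exists C, 0 <= C /\ forall f f1 f2 f3 f4 : UCb,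
  is_deriv f f1 -> is_deriv f1 f2 -> is_deriv f2 f3 -> is_deriv f3 f4 ->
  exists g k, G (f, g) /\ G (g, k) /\
    vnorm f + vnorm g + vnorm k
    <= C * (vnorm f + vnorm f1 + vnorm f2 + vnorm f3 + vnorm f4).
Proof.
set (K := norm_sum [a; a1; a2; b; b1; b2; c; c1; c2]).
assert (HK : 0 <= K) by apply norm_sum_ge_0.
set (P0 := K * 1 + K * 1 + K * 1).
set (P1 := K * 1 + K * 1 + (K * 1 + K * 1) + (K * 1 + K * 1)).
set (P2 := (K * 1 + K * 1) + (K * 1 + K * 1) + ((K * 1 + K * 1) + (K * 1 + K * 1))
  + ((K * 1 + K * 1) + (K * 1 + K * 1))).
set (P4 := K * P2 + K * P1 + K * P0).
exists (1 + P0 + P4); split.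
{ unfold P4, P0, P1, P2; assert (0 <= K * K) by (now apply Rmult_le_pos); lra. }
intros f f1 f2 f3 f4 F1 F2 F3 F4.
assert (N0 := vnorm_ge_0 f); assert (N1 := vnorm_ge_0 f1);
assert (N2 := vnorm_ge_0 f2); assert (N3 := vnorm_ge_0 f3);
assert (N4 := vnorm_ge_0 f4).
set (S := vnorm f + vnorm f1 + vnorm f2 + vnorm f3 + vnorm f4).
assert (vnorm f <= 1 * S /\ vnorm f1 <= 1 * S /\ vnorm f2 <= 1 * S /\
        vnorm f3 <= 1 * S /\ vnorm f4 <= 1 * S) as (B0 & B1 & B2 & B3 & B4)
  by (unfold S; repeat split; lra).
assert (Bm : forall (u v : UCb) m,
  In u [a; a1; a2; b; b1; b2; c; c1; c2] -> vnorm v <= m * S ->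
  vnorm (UCb_mult u v) <= K * m * S)
  by (intros u v m Hu Hv; apply scaled_mult_bound; auto; now apply norm_sum_ge).
assert (Bp := scaled_plus_bound S); simpl in Bm.
set (op := fun u0 u1 u2 => UCb_mult a u2 [+] UCb_mult b u1 [+] UCb_mult c u0).
set (g := op f f1 f2).
set (g1 := UCb_mult a1 f2 [+] UCb_mult a f3
  [+] (UCb_mult b1 f1 [+] UCb_mult b f2) [+] (UCb_mult c1 f [+] UCb_mult c f1)).
set (g2 := UCb_mult a2 f2 [+] UCb_mult a1 f3 [+] (UCb_mult a1 f3 [+] UCb_mult a f4)
  [+] (UCb_mult b2 f1 [+] UCb_mult b1 f2 [+] (UCb_mult b1 f2 [+] UCb_mult b f3))
  [+] (UCb_mult c2 f [+] UCb_mult c1 f1 [+] (UCb_mult c1 f1 [+] UCb_mult c f2))).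
assert (G1 : is_deriv g g1).
{ unfold g, g1, op; apply is_deriv_plus; [apply is_deriv_plus|];
    apply is_deriv_mult; assumption. }
assert (G2 : is_deriv g1 g2).
{ unfold g1, g2; apply is_deriv_plus; [apply is_deriv_plus|];
    (apply is_deriv_plus; apply is_deriv_mult; assumption). }
assert (Bop : forall (u0 u1 u2 : UCb) m0 m1 m2,
  vnorm u0 <= m0 * S -> vnorm u1 <= m1 * S -> vnorm u2 <= m2 * S ->
  vnorm (op u0 u1 u2) <= (K * m2 + K * m1 + K * m0) * S).
{ intros u0 u1 u2 m0 m1 m2 H0 H1 H2; unfold op.
  apply Bp; [apply Bp|]; apply Bm; auto 12. }
assert (Bg : vnorm g <= P0 * S) by (apply Bop; assumption).
assert (Bg1 : vnorm g1 <= P1 * S).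
{ unfold g1; apply Bp; [apply Bp|]; (apply Bp; apply Bm; auto 12). }
assert (Bg2 : vnorm g2 <= P2 * S).
{ unfold g2; apply Bp; [apply Bp|];
    (apply Bp; (apply Bp; apply Bm; auto 12)). }
assert (Bk : vnorm (op g g1 g2) <= P4 * S) by (apply Bop; assumption).
exists g, (op g g1 g2); split; [|split].
- exists f1, f2; split; [|split]; auto; intros x; reflexivity.
- exists g1, g2; split; [|split]; auto; intros x; reflexivity.
- lra.
Qed.

End Second_power.

(** * The Chernoff function and its rate of convergence *)

Lemma operS_norm (a b c : UCb) (t : R) (f : UCb) :
  vnorm (operS a b c t f) <= (1 + Rabs t * vnorm c) * vnorm f.
Proof.
apply UCb_norm_le; intros x; simpl; unfold S_fun.
set (u := f (x + 2 * sqrt (a x * t))); set (v := f (x - 2 * sqrt (a x * t))).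
set (w := f (x + 2 * b x * t)).
assert (Hu : Rabs u <= vnorm f) by apply UCb_le_norm.
assert (Hv : Rabs v <= vnorm f) by apply UCb_le_norm.
assert (Hw : Rabs w <= vnorm f) by apply UCb_le_norm.
assert (Hf : Rabs (t * c x * f x) <= Rabs t * vnorm c * vnorm f).
{ rewrite !Rabs_mult; apply Rmult_le_compat; auto using UCb_le_norm, Rabs_pos.
  - apply Rmult_le_pos; apply Rabs_pos.
  - apply Rmult_le_compat_l; auto using UCb_le_norm, Rabs_pos. }
apply Rabs_le_between in Hu; apply Rabs_le_between in Hv.
apply Rabs_le_between in Hw; apply Rabs_le_between in Hf.
apply Rabs_le; lra.
Qed.

Lemma operS_linear (a b c : UCb) (t : R) : is_linear (operS a b c t).
Proof.
apply (linear_intro (X := UCb_CompleteNormedModule) _ (1 + Rabs t * vnorm c)).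
- intros f g; apply UCb_eq; intros x; simpl; unfold S_fun; simpl; ring.
- intros k f; apply UCb_eq; intros x; simpl; unfold S_fun; simpl; ring.
- assert (P := Rabs_pos t); assert (N := vnorm_ge_0 c).
  assert (Q : 0 <= Rabs t * vnorm c) by (now apply Rmult_le_pos); lra.
- intros f; apply operS_norm.
Qed.

Lemma operS_norm_exp (a b c : UCb) (t : R) (f : UCb) : 0 <= t ->
  vnorm (operS a b c t f) <= exp (vnorm c * t) * vnorm f.
Proof.
intros Ht; apply Rle_trans with (1 := operS_norm a b c t f).
apply Rmult_le_compat_r; [apply vnorm_ge_0|]; rewrite Rabs_pos_eq by auto.
assert (K := exp_ineq1_le (vnorm c * t)); lra.
Qed.

(** The mean value theorem; the factor [1 / (n + 1)] is given up. *)
Lemma power_bound_of_derive (g g' : R -> R) (K : R) (n : nat) :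
  0 <= K -> (forall s, is_derive g s (g' s)) -> g 0 = 0 ->
  (forall s, 0 <= s -> Rabs (g' s) <= K * s ^ n) ->
  forall s, 0 <= s -> Rabs (g s) <= K * s ^ S n.
Proof.
intros HK Hg H0 Hb s Hs; destruct (MVT_all g g' 0 s Hg) as (z & Hz & E).
rewrite Rmin_left, Rmax_right in Hz by auto.
rewrite H0, !Rminus_0_r in E; rewrite E, Rabs_mult, (Rabs_pos_eq s) by auto.
replace (K * s ^ S n) with (K * s ^ n * s) by (simpl; ring).
apply Rmult_le_compat_r; auto; apply Rle_trans with (1 := Hb z (proj1 Hz)).
apply Rmult_le_compat_l; auto; now apply pow_incr.
Qed.

Lemma is_derive_shift_left (f : UCb) (f1 : UCb) (x s : R) :
  is_deriv f f1 -> is_derive (fun s => f (x - s)) s (- f1 (x - s)).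
Proof.
intros Hf; replace (- f1 (x - s)) with (scal (-1) (f1 (x - s)))
  by (unfold scal; simpl; unfold mult; simpl; ring).
apply (is_derive_comp f (fun s => x - s)); [apply Hf|]; auto_derive; auto; ring.
Qed.

Lemma is_derive_shift_right (f : UCb) (f1 : UCb) (x s : R) :
  is_deriv f f1 -> is_derive (fun s => f (x + s)) s (f1 (x + s)).
Proof.
intros Hf; replace (f1 (x + s)) with (scal 1 (f1 (x + s)))
  by (unfold scal; simpl; unfold mult; simpl; ring).
apply (is_derive_comp f (fun s => x + s)); [apply Hf|]; auto_derive; auto; ring.
Qed.

Lemma symmetric_taylor4 (f f1 f2 f3 f4 : UCb) (x h : R) :
  is_deriv f f1 -> is_deriv f1 f2 -> is_deriv f2 f3 -> is_deriv f3 f4 -> 0 <= h ->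
  Rabs (f (x + h) + f (x - h) - 2 * f x - h ^ 2 * f2 x) <= 2 * vnorm f4 * h ^ 4.
Proof.
intros F1 F2 F3 F4 Hh.
assert (HK : 0 <= 2 * vnorm f4) by (assert (K := vnorm_ge_0 f4); lra).
assert (D3 : forall s, 0 <= s -> Rabs (f3 (x + s) - f3 (x - s)) <= 2 * vnorm f4 * s ^ 1).
{ apply (power_bound_of_derive (fun s => f3 (x + s) - f3 (x - s))
    (fun s => f4 (x + s) - - f4 (x - s))); auto.
  - intros s; apply (is_derive_minus (fun s => f3 (x + s)));
      [now apply is_derive_shift_right | now apply is_derive_shift_left].
  - rewrite Rplus_0_r, Rminus_0_r; ring.
  - intros s _; simpl; rewrite Rmult_1_r.
    assert (A := UCb_le_norm f4 (x + s)); assert (B := UCb_le_norm f4 (x - s)).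
    apply Rabs_le_between in A; apply Rabs_le_between in B; apply Rabs_le; lra. }
assert (D2 : forall s, 0 <= s ->
  Rabs (f2 (x + s) + f2 (x - s) - 2 * f2 x) <= 2 * vnorm f4 * s ^ 2).
{ apply (power_bound_of_derive (fun s => f2 (x + s) + f2 (x - s) - 2 * f2 x)
    (fun s => f3 (x + s) - f3 (x - s))); auto.
  - intros s; replace (f3 (x + s) - f3 (x - s))
      with (f3 (x + s) + - f3 (x - s) - 0) by ring.
    apply (is_derive_minus (fun s => f2 (x + s) + f2 (x - s)));
      [|exact (is_derive_const (2 * f2 x) s)].
    apply (is_derive_plus (fun s => f2 (x + s)));
      [now apply is_derive_shift_right | now apply is_derive_shift_left].
  - rewrite Rplus_0_r, Rminus_0_r; ring. }
assert (D1 : forall s, 0 <= s ->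
  Rabs (f1 (x + s) - f1 (x - s) - 2 * f2 x * s) <= 2 * vnorm f4 * s ^ 3).
{ apply (power_bound_of_derive (fun s => f1 (x + s) - f1 (x - s) - 2 * f2 x * s)
    (fun s => f2 (x + s) + f2 (x - s) - 2 * f2 x)); auto.
  - intros s; replace (f2 (x + s) + f2 (x - s) - 2 * f2 x)
      with (f2 (x + s) - - f2 (x - s) - 2 * f2 x) by ring.
    apply (is_derive_minus (fun s => f1 (x + s) - f1 (x - s)));
      [|auto_derive; auto; ring].
    apply (is_derive_minus (fun s => f1 (x + s)));
      [now apply is_derive_shift_right | now apply is_derive_shift_left].
  - rewrite Rplus_0_r, Rminus_0_r; ring. }
apply (power_bound_of_derive (fun s => f (x + s) + f (x - s) - 2 * f x - s ^ 2 * f2 x)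
  (fun s => f1 (x + s) - f1 (x - s) - 2 * f2 x * s)); auto.
- intros s; replace (f1 (x + s) - f1 (x - s) - 2 * f2 x * s)
    with (f1 (x + s) + - f1 (x - s) - 0 - 2 * f2 x * s) by ring.
  apply (is_derive_minus (fun s => f (x + s) + f (x - s) - 2 * f x));
    [|auto_derive; auto; ring].
  apply (is_derive_minus (fun s => f (x + s) + f (x - s)));
    [|exact (is_derive_const (2 * f x) s)].
  apply (is_derive_plus (fun s => f (x + s)));
    [now apply is_derive_shift_right | now apply is_derive_shift_left].
- rewrite Rplus_0_r, Rminus_0_r; ring.
Qed.

Lemma taylor2 (f f1 f2 : UCb) (x y : R) :
  is_deriv f f1 -> is_deriv f1 f2 ->
  Rabs (f (x + y) - f x - y * f1 x) <= vnorm f2 * y ^ 2.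
Proof.
intros F1 F2; destruct (MVT_all f f1 x (x + y) F1) as (z & Hz & E).
rewrite E; replace (f1 z * (x + y - x) - y * f1 x) with ((f1 z - f1 x) * y) by ring.
rewrite Rabs_mult; assert (B := is_deriv_bound f1 f2 x z F2).
assert (Hzx : Rabs (z - x) <= Rabs y).
{ unfold Rmin, Rmax, Rabs in *.
  destruct (Rle_dec x (x + y)), (Rcase_abs y), (Rcase_abs (z - x)); lra. }
replace (y ^ 2) with (Rabs y * Rabs y)
  by (rewrite <- Rabs_mult, Rabs_pos_eq; [ring | apply Rle_0_sqr]).
rewrite <- Rmult_assoc; apply Rmult_le_compat_r; [apply Rabs_pos|].
apply Rle_trans with (1 := B); apply Rmult_le_compat_l; auto; apply vnorm_ge_0.
Qed.

(** The shift [h = 2 sqrt (a t)] satisfies [h^2 / 4 = a t], so the symmetric second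
    difference produces [t a f'']; odd orders cancel and the error is of order
    [h^4 = O(t^2)]. *)
Lemma operS_consistent (a b c f f1 f2 f3 f4 g : UCb) (t : R) :
  (forall x, 0 <= a x) ->
  is_deriv f f1 -> is_deriv f1 f2 -> is_deriv f2 f3 -> is_deriv f3 f4 ->
  (forall x, g x = a x * f2 x + b x * f1 x + c x * f x) -> 0 <= t ->
  vnorm (operS a b c t f [-] f [-] t [*] g)
  <= t ^ 2 * (8 * vnorm a ^ 2 * vnorm f4 + 2 * vnorm b ^ 2 * vnorm f2).
Proof.
intros Ha F1 F2 F3 F4 Hg Ht; apply UCb_norm_le; intros x.
change (Rabs (S_fun a b c t f x - f x - t * g x)
  <= t ^ 2 * (8 * vnorm a ^ 2 * vnorm f4 + 2 * vnorm b ^ 2 * vnorm f2)).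
unfold S_fun; rewrite Hg; set (h := 2 * sqrt (a x * t)).
assert (Hat : 0 <= a x * t) by (now apply Rmult_le_pos).
assert (Hh : 0 <= h) by (unfold h; assert (P := sqrt_pos (a x * t)); lra).
assert (Hh2 : h ^ 2 = 4 * (a x * t)).
{ unfold h; rewrite <- (sqrt_sqrt (a x * t)) at 2 by auto; ring. }
assert (T4 := symmetric_taylor4 f f1 f2 f3 f4 x h F1 F2 F3 F4 Hh).
assert (T2 := taylor2 f f1 f2 x (2 * b x * t) F1 F2).
replace (h ^ 4) with (16 * (a x * t) ^ 2) in T4
  by (transitivity ((h ^ 2) ^ 2); [rewrite Hh2; ring | ring]).
rewrite Hh2 in T4.
assert (Na : (a x * t) ^ 2 <= vnorm a ^ 2 * t ^ 2).
{ rewrite Rpow_mult_distr; apply Rmult_le_compat_r; [apply pow2_ge_0|].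
  apply pow_incr; split; auto; apply Rle_trans with (1 := Rle_abs _).
  apply UCb_le_norm. }
assert (Nb : (2 * b x * t) ^ 2 <= 4 * (vnorm b ^ 2 * t ^ 2)).
{ replace ((2 * b x * t) ^ 2) with (4 * ((b x) ^ 2 * t ^ 2)) by ring.
  apply Rmult_le_compat_l; [lra|]; apply Rmult_le_compat_r; [apply pow2_ge_0|].
  rewrite <- (pow2_abs (b x)); apply pow_incr; split;
    [apply Rabs_pos | apply UCb_le_norm]. }
assert (N4 := vnorm_ge_0 f4); assert (N2 := vnorm_ge_0 f2).
apply Rmult_le_compat_l with (r := vnorm f4) in Na; auto.
apply Rmult_le_compat_l with (r := vnorm f2) in Nb; auto.
apply Rabs_le_between in T4; apply Rabs_le_between in T2; apply Rabs_le; lra.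
Qed.

Section Chernoff_rate.
Variables (a b c a1 a2 b1 b2 c1 c2 : UCb) (a0 : R) (V : R -> UCb -> UCb).
Hypotheses (Ha0 : 0 < a0) (Ha : forall x, a0 <= a x).
Hypotheses (Ha1 : is_deriv a a1) (Ha2 : is_deriv a1 a2).
Hypotheses (Hb1 : is_deriv b b1) (Hb2 : is_deriv b1 b2).
Hypotheses (Hc1 : is_deriv c c1) (Hc2 : is_deriv c1 c2).

Let G := opgraph a b c.
Let w := vnorm c.
Hypothesis HV : generates G V.

Let Hw : 0 <= w := vnorm_ge_0 c.
Let HG : m_dissipative w G := operator_m_dissipative a b c a0 Ha0 Ha.

Lemma chernoff_norm n t f : 0 <= t -> (1 <= n)%nat ->
  vnorm (chernoff a b c n t f) <= exp (w * t) * vnorm f.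
Proof.
intros Ht Hn; assert (Hn0 : 0 < INR n) by (apply lt_0_INR; lia).
replace (exp (w * t)) with (exp (w * (t / INR n)) ^ n).
- apply iter_norm_le; [left; apply exp_pos|]; intros x; apply operS_norm_exp.
  now apply Rdiv_le_0_compat.
- rewrite exp_pow; f_equal; field; lra.
Qed.

Lemma iter_semigroup s j f : 0 <= s -> Nat.iter j (V s) f = V (INR j * s) f.
Proof.
intros Hs; induction j as [|j IH].
- simpl; rewrite Rmult_0_l; symmetry; exact (sg_zero G V HV f).
- rewrite S_INR; simpl Nat.iter; rewrite IH.
  rewrite <- (sg_add G V HV) by (auto; apply Rmult_le_pos; auto; apply pos_INR).
  f_equal; ring.
Qed.

(** The one-step errors of [S] and of [V] are both of order [(t/n)^2] on the orbit
    [V(j t/n) f], where [A] and [A^2] are bounded by their values at time [0] times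
    [exp (w j t/n)]; telescoping sums [n] of them. *)
Lemma chernoff_rate : exists C, 0 <= C /\ forall (f g k : UCb) (t : R) (n : nat),
  G (f, g) -> G (g, k) -> 0 <= t -> (1 <= n)%nat ->
  vnorm (chernoff a b c n t f [-] V t f)
  <= t ^ 2 * exp (w * t) / INR n * (C * (vnorm f + vnorm g + vnorm k)).
Proof.
destruct (opgraph2_regular a b c a1 a2 b1 b2 c1 c2 a0 Ha0 Ha Ha1 Ha2 Hb1 Hb2 Hc1 Hc2)
  as (C & HC & Hreg).
set (D := 8 * vnorm a ^ 2 * C + 2 * vnorm b ^ 2 * C).
assert (A2 : 0 <= vnorm a ^ 2) by apply pow2_ge_0.
assert (B2 : 0 <= vnorm b ^ 2) by apply pow2_ge_0.
assert (HD : 0 <= D).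
{ assert (0 <= vnorm a ^ 2 * C) by (now apply Rmult_le_pos).
  assert (0 <= vnorm b ^ 2 * C) by (now apply Rmult_le_pos); unfold D; lra. }
exists (D + 1); split; [lra|]; intros f g k t n Hf Hg Ht Hn.
assert (Hn0 : 0 < INR n) by (apply lt_0_INR; lia).
set (s := t / INR n); assert (Hs : 0 <= s) by (now apply Rdiv_le_0_compat).
assert (Ens : INR n * s = t) by (unfold s; field; lra).
set (Sg := vnorm f + vnorm g + vnorm k).
assert (Ms : 1 <= exp (w * s)) by (apply exp_ge_1, Rmult_le_pos; auto).
assert (K : vnorm (Nat.iter n (operS a b c s) f [-] Nat.iter n (V s) f)
  <= INR n * (s ^ 2 * ((D + 1) * Sg)) * exp (w * s) ^ n).
{ apply iter_telescope.
  - apply operS_linear.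
  - lra.
  - intros u; now apply operS_norm_exp.
  - intros j Hj; rewrite iter_semigroup by auto.
    set (r := INR j * s).
    assert (Hr : 0 <= r) by (apply Rmult_le_pos; auto; apply pos_INR).
    assert (Gf := sg_comm G V HV f g r Hf Hr).
    assert (Gg := sg_comm G V HV g k r Hg Hr).
    set (fj := V r f) in *; set (gj := V r g) in *; set (kj := V r k) in *.
    destruct (Hreg fj gj kj Gf Gg)
      as (f1 & f2 & f3 & f4 & F1 & F2 & F3 & F4 & Egj & N2 & N4).
    assert (Cs := operS_consistent a b c fj f1 f2 f3 f4 gj s
      (fun x => Rle_trans _ _ _ (Rlt_le _ _ Ha0) (Ha x)) F1 F2 F3 F4 Egj Hs).
    assert (Cv := sg_taylor2 w G V Hw HG HV fj gj kj s Gf Gg Hs).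
    assert (Er : exp (w * r) = exp (w * s) ^ j)
      by (rewrite exp_pow; f_equal; unfold r; ring).
    assert (Hp : 1 <= exp (w * s) ^ j) by (apply pow_R1_Rle; auto).
    assert (Bf := sg_norm w G V Hw HG HV f r Hr).
    assert (Bg := sg_norm w G V Hw HG HV g r Hr).
    assert (Bk := sg_norm w G V Hw HG HV k r Hr).
    fold fj in Bf; fold gj in Bg; fold kj in Bk; rewrite Er in Bf, Bg, Bk.
    set (M := exp (w * s)) in *; set (Mj := M ^ j) in *.
    set (Sj := vnorm fj + vnorm gj + vnorm kj) in *.
    assert (BS : Sj <= Mj * Sg) by (unfold Sj, Sg; lra).
    replace (operS a b c s fj [-] V s fj) with
      ((operS a b c s fj [-] fj [-] s [*] gj) [-] (V s fj [-] fj [-] s [*] gj))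
      by module_eq.
    apply Rle_trans with (1 := minus_bound _ _ _ _ Cs Cv).
    assert (S2 : 0 <= s ^ 2) by apply pow2_ge_0.
    replace (s ^ 2 * ((D + 1) * Sg) * M ^ Datatypes.S j)
      with (s ^ 2 * ((D + 1) * Sg * (M * Mj))) by (unfold Mj; simpl; ring).
    rewrite <- Rmult_plus_distr_l; apply Rmult_le_compat_l; auto.
    assert (X1 : 8 * vnorm a ^ 2 * vnorm f4 + 2 * vnorm b ^ 2 * vnorm f2 <= D * Sj).
    { apply Rle_trans with (8 * vnorm a ^ 2 * (C * Sj) + 2 * vnorm b ^ 2 * (C * Sj)).
      - apply Rplus_le_compat; apply Rmult_le_compat_l; auto; lra.
      - unfold D; right; ring. }
    assert (Nf := vnorm_ge_0 f); assert (Ng := vnorm_ge_0 g);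
    assert (Nk := vnorm_ge_0 k).
    assert (X2 : D * Sj <= D * (M * (Mj * Sg))).
    { apply Rmult_le_compat_l; auto; apply Rle_trans with (1 := BS).
      rewrite <- (Rmult_1_l (Mj * Sg)) at 1; apply Rmult_le_compat_r; auto.
      apply Rmult_le_pos; [lra | unfold Sg; lra]. }
    assert (X3 : M * vnorm kj <= M * (Mj * Sg)).
    { apply Rmult_le_compat_l; [lra|]; apply Rle_trans with (1 := Bk).
      apply Rmult_le_compat_l; [lra | unfold Sg; lra]. }
    lra. }
rewrite iter_semigroup, Ens in K by auto.
apply Rle_trans with (1 := K); right; rewrite exp_pow.
replace (INR n * (w * s)) with (w * t) by (rewrite <- Ens; ring).
fold Sg; unfold s; field; lra.
Qed.

End Chernoff_rate.

(** * The resolvent as a Laplace transform *)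

Lemma improper_integral_compare (phi psi : R -> R) (l m K L mu B : R) :
  0 < mu -> 0 <= K -> 0 <= L ->
  (forall T, 0 <= T -> Rabs (l - RInt phi 0 T) <= K * exp (- mu * T)) ->
  (forall T, 0 <= T -> Rabs (m - RInt psi 0 T) <= L * exp (- mu * T)) ->
  (forall T, 0 <= T -> Rabs (RInt phi 0 T - RInt psi 0 T) <= B) ->
  Rabs (l - m) <= B.
Proof.
intros Hmu HK HL Hl Hm HB; apply le_epsilon; intros eps He.
destruct (exp_decay (K + L) mu eps ltac:(lra) Hmu He) as (T & HT & Hsm).
specialize (Hsm T (Rle_refl T)).
specialize (Hl T HT); specialize (Hm T HT); specialize (HB T HT).
apply Rabs_le_between in Hl; apply Rabs_le_between in Hm;
apply Rabs_le_between in HB; apply Rabs_le; lra.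
Qed.

Lemma RInt_minus_bound (phi psi H dH : R -> R) (T : R) :
  0 <= T -> (forall t, continuous phi t) -> (forall t, continuous psi t) ->
  (forall t, is_derive H t (dH t)) ->
  (forall t, 0 <= t -> Rabs (phi t - psi t) <= dH t) ->
  Rabs (RInt phi 0 T - RInt psi 0 T) <= H T - H 0.
Proof.
intros HT C1 C2 HD Hb.
assert (E : RInt phi 0 T - RInt psi 0 T = RInt (fun t => phi t - psi t) 0 T).
{ symmetry; apply (RInt_minus (V := R_CompleteNormedModule)); now apply continuous_ex_RInt. }
rewrite E; apply (RInt_bound _ H dH); auto.
intros t; now apply (continuous_minus phi psi).
Qed.

Lemma sqrt_modulus (u v : R) : Rabs (sqrt u - sqrt v) <= sqrt (Rabs (u - v)).
Proof.
assert (M : forall x y, y <= x -> Rabs (sqrt x - sqrt y) <= sqrt (Rabs (x - y))).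
{ intros x y H; rewrite !Rabs_pos_eq.
  - now apply sqrt_incr_le.
  - lra.
  - assert (K := sqrt_le_1_alt _ _ H); lra. }
destruct (Rle_lt_dec v u) as [H|H]; auto.
rewrite (Rabs_minus_sym (sqrt u)), (Rabs_minus_sym u); apply M; lra.
Qed.

(** Continuity in [t] follows from the uniform continuity of [f]: the arguments move
    by at most [2 sqrt (|a| |s - t|)]. *)
Lemma operS_continuous (a b c f : UCb) (t eps : R) : 0 < eps ->
  exists d, 0 < d /\ forall s, Rabs (s - t) < d ->
    vnorm (operS a b c s f [-] operS a b c t f) <= eps.
Proof.
intros He; destruct (UCb_prop f) as [_ Uf].
assert (He2 : 0 < eps / 2) by lra.
destruct (Uf (mkposreal _ He2)) as [r Hr]; assert (Pr := cond_pos r).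
assert (Na := vnorm_ge_0 a); assert (Nb := vnorm_ge_0 b);
assert (Nc := vnorm_ge_0 c); assert (Nf := vnorm_ge_0 f).
destruct (small_factor (vnorm a) ((r / 2) ^ 2)) as (d1 & Hd1 & S1);
  [auto | apply pow_lt; lra |].
destruct (small_factor (vnorm b) (r / 2)) as (d2 & Hd2 & S2); [auto | lra |].
destruct (small_factor (vnorm c * vnorm f) (eps / 2)) as (d3 & Hd3 & S3);
  [now apply Rmult_le_pos | lra |].
exists (Rmin d1 (Rmin d2 d3)); split; [repeat apply Rmin_pos; auto|].
intros s Hs; assert (P := Rabs_pos (s - t)).
destruct (lt_Rmin _ _ _ Hs) as [L1 L23]; destruct (lt_Rmin _ _ _ L23) as [L2 L3].
specialize (S1 (Rabs (s - t)) ltac:(lra)); specialize (S2 (Rabs (s - t)) ltac:(lra)).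
specialize (S3 (Rabs (s - t)) ltac:(lra)).
assert (B : forall (u : UCb) x, Rabs (u x * (s - t)) <= vnorm u * Rabs (s - t)).
{ intros u x; rewrite Rabs_mult; apply Rmult_le_compat_r; auto; apply UCb_le_norm. }
apply UCb_norm_le; intros x.
change (Rabs (S_fun a b c s f x - S_fun a b c t f x) <= eps); unfold S_fun.
assert (Q : Rabs (2 * sqrt (a x * s) - 2 * sqrt (a x * t)) < r).
{ rewrite <- Rmult_minus_distr_l, Rabs_mult, (Rabs_pos_eq 2) by lra.
  enough (sqrt (Rabs (a x * s - a x * t)) < r / 2).
  { assert (M := sqrt_modulus (a x * s) (a x * t)); lra. }
  rewrite <- (sqrt_pow2 (r / 2)) by lra.
  apply sqrt_lt_1_alt; split; [apply Rabs_pos|].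
  rewrite <- Rmult_minus_distr_l; apply Rle_lt_trans with (1 := B a x); auto. }
assert (Q2 : Rabs (2 * b x * s - 2 * b x * t) < r).
{ replace (2 * b x * s - 2 * b x * t) with (2 * (b x * (s - t))) by ring.
  rewrite Rabs_mult, (Rabs_pos_eq 2) by lra; assert (X := B b x); lra. }
set (u := 2 * sqrt (a x * s)) in *; set (v := 2 * sqrt (a x * t)) in *.
set (p := 2 * b x * s) in *; set (q := 2 * b x * t) in *.
assert (R1 : Rabs (f (x + u) - f (x + v)) < eps / 2).
{ apply (Hr _ _ I I); replace (x + u - (x + v)) with (u - v) by ring; auto. }
assert (R2 : Rabs (f (x - u) - f (x - v)) < eps / 2).
{ apply (Hr _ _ I I); replace (x - u - (x - v)) with (- (u - v)) by ring.
  now rewrite Rabs_Ropp. }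
assert (R3 : Rabs (f (x + p) - f (x + q)) < eps / 2).
{ apply (Hr _ _ I I); replace (x + p - (x + q)) with (p - q) by ring; auto. }
assert (R4 : Rabs ((s - t) * (c x * f x)) <= eps / 2).
{ rewrite Rmult_comm; apply Rle_trans with (vnorm c * vnorm f * Rabs (s - t)); [|lra].
  rewrite !Rabs_mult; apply Rmult_le_compat_r; auto.
  apply Rmult_le_compat; auto using UCb_le_norm, Rabs_pos. }
apply Rabs_def2 in R1; apply Rabs_def2 in R2; apply Rabs_def2 in R3.
apply Rabs_le_between in R4; apply Rabs_le; lra.
Qed.

Lemma iter_operS_continuous (a b c f : UCb) (k : nat) (t eps : R) : 0 < eps ->
  exists d, 0 < d /\ forall s, Rabs (s - t) < d ->
    vnorm (Nat.iter k (operS a b c s) f [-] Nat.iter k (operS a b c t) f) <= eps.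
Proof.
revert eps; induction k as [|k IH]; intros eps He.
- exists 1; split; [lra|]; intros s _; simpl Nat.iter; rewrite norm_minus_diag; lra.
- assert (Nc := vnorm_ge_0 c); assert (Pt := Rabs_pos t).
  set (M := 1 + (Rabs t + 1) * vnorm c).
  assert (HM : 1 <= M).
  { assert (0 <= (Rabs t + 1) * vnorm c) by (apply Rmult_le_pos; lra); unfold M; lra. }
  destruct (IH (eps / 2 / M)) as (d1 & Hd1 & H1); [apply Rdiv_lt_0_compat; lra|].
  destruct (operS_continuous a b c (Nat.iter k (operS a b c t) f) t (eps / 2))
    as (d2 & Hd2 & H2); [lra|].
  exists (Rmin 1 (Rmin d1 d2)); split; [repeat apply Rmin_pos; lra|]; intros s Hs.
  destruct (lt_Rmin _ _ _ Hs) as [L0 L12].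
  specialize (H1 s (Rlt_le_trans _ _ _ L12 (Rmin_l _ _))).
  specialize (H2 s (Rlt_le_trans _ _ _ L12 (Rmin_r _ _))).
  simpl Nat.iter; set (u := Nat.iter k (operS a b c s) f) in *.
  set (v := Nat.iter k (operS a b c t) f) in *.
  apply Rle_trans with (1 := norm_minus_triangle (operS a b c s v) _ _).
  assert (B : vnorm (operS a b c s u [-] operS a b c s v) <= eps / 2).
  { rewrite <- (linear_vminus (X := UCb_CompleteNormedModule) (operS a b c s))
      by apply operS_linear.
    apply Rle_trans with (1 := operS_norm a b c s (u [-] v)).
    apply Rle_trans with (M * vnorm (u [-] v)).
    - apply Rmult_le_compat_r; [apply vnorm_ge_0|]; unfold M.
      apply Rplus_le_compat_l, Rmult_le_compat_r; auto.
      replace s with (t + (s - t)) by ring.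
      apply Rle_trans with (1 := Rabs_triang _ _); lra.
    - apply Rmult_le_compat_l with (r := M) in H1; [|lra].
      replace (M * (eps / 2 / M)) with (eps / 2) in H1 by (field; lra); auto. }
  lra.
Qed.

Lemma continuous_of_modulus (phi : R -> R) (t : R) :
  (forall eps, 0 < eps -> exists d, 0 < d /\ forall s, Rabs (s - t) < d ->
     Rabs (phi s - phi t) <= eps) -> continuous phi t.
Proof.
intros H; apply continuity_pt_filterlim; intros eps He.
destruct (H (eps / 2)) as (d & Hd & Hs); [lra|].
exists d; split; auto; intros s [_ Hsd]; specialize (Hs s Hsd).
change (Rabs (phi s - phi t) < eps); lra.
Qed.

Lemma chernoff_continuous (a b c g : UCb) (n : nat) (x t : R) :
  (1 <= n)%nat -> continuous (fun t => chernoff a b c n t g x) t.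
Proof.
intros Hn; assert (Hn0 : 0 < INR n) by (apply lt_0_INR; lia).
apply continuous_of_modulus; intros eps He.
destruct (iter_operS_continuous a b c g n (t / INR n) eps He) as (d & Hd & H).
exists (d * INR n); split; [now apply Rmult_lt_0_compat|]; intros s Hs.
apply Rle_trans with (1 := UCb_minus_le_norm _ _ x); apply H.
replace (s / INR n - t / INR n) with ((s - t) * / INR n) by (field; lra).
rewrite Rabs_mult, (Rabs_pos_eq (/ INR n)) by (left; now apply Rinv_0_lt_compat).
apply Rmult_lt_reg_r with (INR n); auto.
rewrite Rmult_assoc, Rinv_l, Rmult_1_r by lra; auto.
Qed.

Lemma continuous_exp_scal (lambda : R) (phi : R -> R) (t : R) :
  continuous phi t -> continuous (fun t => exp (- lambda * t) * phi t) t.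
Proof.
intros H; apply (continuous_mult (fun t => exp (- lambda * t)) phi); auto.
apply (ex_derive_continuous (V := R_NormedModule)); auto_derive; auto.
Qed.

Lemma sup_abs_le (f : R -> R) (M : R) :
  (forall x, Rabs (f x) <= M) -> Rbar_le (sup_abs f) (Finite M).
Proof.
intros H; destruct (Lub_Rbar_correct (fun y => exists x : R, y = Rabs (f x)))
  as [_ Hlub]; apply Hlub; intros y [x ->]; apply H.
Qed.

(** An explicit primitive of [K t^2 exp (- mu t)], whose total variation on the half
    line is [2 K / mu^3]. *)
Lemma laplace_second_moment (mu K t : R) : 0 < mu ->
  is_derive (fun t => - K * (t ^ 2 / mu + 2 * t / mu ^ 2 + 2 / mu ^ 3) * exp (- mu * t))
    t (K * t ^ 2 * exp (- mu * t)).
Proof. intros Hmu; auto_derive; auto; field; lra. Qed.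

Section Laplace_transform.
Variables (a b c : UCb) (a0 lambda : R) (V : R -> UCb -> UCb).
Hypotheses (Ha0 : 0 < a0) (Ha : forall x, a0 <= a x).
Hypotheses (HV : generates (opgraph a b c) V) (Hlam : vnorm c < lambda).

Let G := opgraph a b c.
Let w := vnorm c.
Let mu := lambda - w.

Let Hw : 0 <= w := vnorm_ge_0 c.
Let HG : m_dissipative w G := operator_m_dissipative a b c a0 Ha0 Ha.
Let Hmu : 0 < mu.
Proof. unfold mu, w; lra. Qed.

(* [V] is unspecified at negative times. *)
Let orbit (g : UCb) (x t : R) : R := V (Rmax 0 t) g x.

Lemma orbit_pos g x t : 0 <= t -> orbit g x t = V t g x.
Proof. intros Ht; unfold orbit; now rewrite Rmax_right. Qed.

Lemma orbit_continuous g x t : continuous (orbit g x) t.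
Proof.
apply continuous_of_modulus; intros eps He.
destruct (sg_continuous (opgraph a b c) V HV g (Rmax 0 t) eps (Rmax_l _ _) He) as (d & Hd & H).
exists d; split; auto; intros s Hs.
apply Rle_trans with (1 := UCb_minus_le_norm _ _ x); left; apply H; [apply Rmax_l|].
apply Rle_lt_trans with (2 := Hs); unfold Rmax.
destruct (Rle_dec 0 s), (Rle_dec 0 t); try (right; reflexivity).
- rewrite !Rabs_pos_eq; lra.
- rewrite Rabs_minus_sym, (Rabs_minus_sym s), !Rabs_pos_eq; lra.
- rewrite Rminus_diag, Rabs_R0; apply Rabs_pos.
Qed.

Lemma orbit_derive (f h : UCb) (x t : R) : G (f, h) -> 0 < t ->
  is_derive (orbit f x) t (orbit h x t).
Proof.
intros Hf Ht; rewrite orbit_pos by lra.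
apply is_derive_Reals; intros eps He.
destruct (sg_derivative w G V Hw HG HV f h t (eps / 2) Hf Ht) as (d & Hd & H); [lra|].
assert (Hdt : 0 < Rmin d t) by (now apply Rmin_pos).
exists (mkposreal _ Hdt); simpl; intros s Hs0 Hs.
destruct (lt_Rmin _ _ _ Hs) as [L1 L2]; apply Rabs_def2 in L2.
rewrite !orbit_pos by lra; specialize (H s L1).
assert (B := UCb_le_norm (V (t + s) f [-] V t f [-] s [*] V t h) x).
change (Rabs (V (t + s) f x - V t f x - s * V t h x)
  <= vnorm (V (t + s) f [-] V t f [-] s [*] V t h)) in B.
replace ((V (t + s) f x - V t f x) / s - V t h x)
  with (/ s * (V (t + s) f x - V t f x - s * V t h x)) by (field; auto).
rewrite Rabs_mult, Rabs_inv; assert (P := Rabs_pos_lt s Hs0).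
apply Rmult_lt_reg_l with (Rabs s); auto.
rewrite <- Rmult_assoc, Rinv_r, Rmult_1_l by lra.
assert (0 < eps * Rabs s) by (now apply Rmult_lt_0_compat); lra.
Qed.

Let psi (g : UCb) (x t : R) : R := exp (- lambda * t) * orbit g x t.

Lemma exp_discount t : exp (- lambda * t) * exp (w * t) = exp (- mu * t).
Proof. rewrite <- exp_plus; f_equal; unfold mu; ring. Qed.

Lemma discounted_bound (y : UCb) (K x t : R) :
  0 <= t -> vnorm y <= exp (w * t) * K ->
  Rabs (exp (- lambda * t) * y x) <= K * exp (- mu * t).
Proof.
intros Ht Hy; rewrite Rabs_mult, Rabs_pos_eq by (left; apply exp_pos).
rewrite <- exp_discount; assert (P := exp_pos (- lambda * t)).
apply Rle_trans with (exp (- lambda * t) * (exp (w * t) * K)).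
- apply Rmult_le_compat_l; [lra|]; assert (B := UCb_le_norm y x); lra.
- right; ring.
Qed.

Lemma discounted_orbit_bound g x t : 0 <= t -> Rabs (psi g x t) <= vnorm g * exp (- mu * t).
Proof.
intros Ht; unfold psi; rewrite orbit_pos by auto; apply discounted_bound; auto.
exact (sg_norm w G V Hw HG HV g t Ht).
Qed.

Lemma discounted_orbit_continuous g x t : continuous (psi g x) t.
Proof. apply continuous_exp_scal, orbit_continuous. Qed.

(** [d/dt (exp (- lambda t) V(t) f) = - exp (- lambda t) V(t) (lambda f - A f)]. *)
Lemma resolvent_partial_integral (f g : UCb) (x T : R) :
  G (f, lambda [*] f [-] g) -> 0 <= T ->
  RInt (psi g x) 0 T = f x - psi f x T.
Proof.
intros Hf HT.
set (Y := fun t => psi f x t + RInt (psi g x) 0 t).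
assert (DI : forall t, is_derive (RInt (psi g x) 0) t (psi g x t))
  by (intros t; apply is_derive_integral; intros; apply discounted_orbit_continuous).
assert (E0 : RInt (psi g x) 0 0 = 0) by exact (RInt_point 0 (psi g x)).
destruct (MVT_gen Y 0 T (fun _ => 0)) as (z & _ & Ez).
- rewrite Rmin_left, Rmax_right by auto; intros t Ht.
  assert (HD : is_derive Y t ((- lambda * exp (- lambda * t)) * orbit f x t
      + exp (- lambda * t) * orbit (lambda [*] f [-] g) x t + psi g x t)).
  { apply (is_derive_plus (psi f x)); [|exact (DI t)].
    apply (is_derive_mult (fun t => exp (- lambda * t)) (orbit f x));
      [|apply orbit_derive; auto; lra|apply Rmult_comm].
    auto_derive; auto; ring. }
  replace ((- lambda * exp (- lambda * t)) * orbit f x t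
      + exp (- lambda * t) * orbit (lambda [*] f [-] g) x t + psi g x t)
    with 0 in HD; [exact HD|].
  unfold psi; rewrite !orbit_pos by lra.
  assert (E : V t (lambda [*] f [-] g) = lambda [*] V t f [-] V t g).
  { assert (Ht0 : 0 <= t) by lra.
    assert (L := sg_linear (opgraph a b c) V HV t Ht0).
    rewrite (linear_vminus (X := UCb_CompleteNormedModule) (V t)) by exact L.
    now rewrite (linear_vscal (X := UCb_CompleteNormedModule) (V t)) by exact L. }
  rewrite E; simpl; ring.
- intros t _; apply continuity_pt_filterlim; unfold Y.
  apply (continuous_plus (psi f x)); [apply discounted_orbit_continuous|].
  apply (ex_derive_continuous (V := R_NormedModule)); eexists; apply DI.
- unfold Y in Ez; rewrite E0 in Ez.
  assert (P0 : psi f x 0 = f x).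
  { unfold psi; rewrite orbit_pos, Rmult_0_r, exp_0 by lra.
    rewrite (sg_zero (opgraph a b c) V HV); ring. }
  lra.
Qed.

Lemma resolvent_tail (f g : UCb) (x T : R) :
  G (f, lambda [*] f [-] g) -> 0 <= T ->
  Rabs (f x - RInt (psi g x) 0 T) <= vnorm f * exp (- mu * T).
Proof.
intros Hf HT; rewrite (resolvent_partial_integral f g x T Hf HT).
replace (f x - (f x - psi f x T)) with (psi f x T) by ring.
now apply discounted_orbit_bound.
Qed.

Lemma resolvent_integral (f g : UCb) (x : R) :
  G (f, lambda [*] f [-] g) ->
  is_RInt_gen (fun t => exp (- lambda * t) * V t g x)
    (at_point 0) (Rbar_locally p_infty) (f x).
Proof.
intros Hf; apply (is_RInt_gen_ext (psi g x)).
- apply Filter_prod with (fun x => x = 0) (fun T => 0 < T);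
    [reflexivity | now exists 0 |].
  intros s T -> HT t; simpl; rewrite Rmin_left, Rmax_right by lra; intros Ht.
  unfold psi; rewrite orbit_pos by lra; reflexivity.
- apply is_RInt_gen_of_limit.
  + intros T _; apply continuous_ex_RInt, discounted_orbit_continuous.
  + intros eps He.
    destruct (exp_decay (vnorm f) mu eps (vnorm_ge_0 f) Hmu He) as (T0 & HT0 & H).
    exists T0; split; auto; intros T HT; rewrite Rabs_minus_sym.
    apply Rle_lt_trans with (2 := H T HT), resolvent_tail; auto; lra.
Qed.

Let phi (n : nat) (g : UCb) (x t : R) : R := exp (- lambda * t) * chernoff a b c n t g x.

Lemma discounted_chernoff_continuous n g x t : (1 <= n)%nat -> continuous (phi n g x) t.
Proof. intros Hn; now apply continuous_exp_scal, chernoff_continuous. Qed.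

Lemma discounted_chernoff_bound n g x t : (1 <= n)%nat -> 0 <= t ->
  Rabs (phi n g x t) <= vnorm g * exp (- mu * t).
Proof. intros Hn Ht; apply discounted_bound; auto; now apply chernoff_norm. Qed.

Lemma chernoff_integral n g x : (1 <= n)%nat ->
  exists l, is_RInt_gen (phi n g x) (at_point 0) (Rbar_locally p_infty) l /\
    RInt_gen (phi n g x) (at_point 0) (Rbar_locally p_infty) = l /\
    (forall T, 0 <= T -> Rabs (l - RInt (phi n g x) 0 T)
       <= vnorm g / mu * exp (- mu * T)).
Proof.
intros Hn; destruct (exp_dominated_integral (phi n g x) (vnorm g) mu Hmu)
  as (l & Hl & Htail).
- intros t; now apply discounted_chernoff_continuous.
- intros t; now apply discounted_chernoff_bound.
- exists l; split; auto; split; auto; now apply is_RInt_gen_unique.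
Qed.

(** The two integrands differ by at most [(K t^2 + e) exp (- mu t)]; the constant part
    [e] accounts for replacing rough data by smooth ones. *)
Lemma chernoff_integral_error (n : nat) (f g : UCb) (x K e : R) : (1 <= n)%nat ->
  G (f, lambda [*] f [-] g) -> 0 <= K -> 0 <= e ->
  (forall t, 0 <= t -> vnorm (chernoff a b c n t g [-] V t g)
     <= exp (w * t) * (K * t ^ 2 + e)) ->
  Rabs (f x - RInt_gen (phi n g x) (at_point 0) (Rbar_locally p_infty))
  <= 2 * K / mu ^ 3 + e / mu.
Proof.
intros Hn Hf HK He Hrate.
destruct (chernoff_integral n g x Hn) as (l & _ & -> & Hl).
apply (improper_integral_compare (psi g x) (phi n g x) (f x) l (vnorm f) (vnorm g / mu)
  mu _ Hmu); [apply vnorm_ge_0 | | intros; now apply resolvent_tail | exact Hl |].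
{ apply Rdiv_le_0_compat; auto; apply vnorm_ge_0. }
intros T HT.
set (H := fun t => - K * (t ^ 2 / mu + 2 * t / mu ^ 2 + 2 / mu ^ 3) * exp (- mu * t)
  + - (e / mu) * exp (- mu * t)).
apply Rle_trans with (H T - H 0).
- apply (RInt_minus_bound _ _ H
    (fun t => K * t ^ 2 * exp (- mu * t) + e * exp (- mu * t))); auto.
  + intros t; apply discounted_orbit_continuous.
  + intros t; now apply discounted_chernoff_continuous.
  + intros t; apply (is_derive_plus (fun t =>
      - K * (t ^ 2 / mu + 2 * t / mu ^ 2 + 2 / mu ^ 3) * exp (- mu * t)));
      [now apply laplace_second_moment|].
    auto_derive; auto; field; lra.
  + intros t Ht; unfold psi, phi; rewrite orbit_pos, Rabs_minus_sym by auto.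
    rewrite <- Rmult_minus_distr_l.
    replace (K * t ^ 2 * exp (- mu * t) + e * exp (- mu * t))
      with ((K * t ^ 2 + e) * exp (- mu * t)) by ring.
    apply (discounted_bound (chernoff a b c n t g [-] V t g)); auto.
- unfold H; replace (- mu * 0) with 0 by ring; rewrite exp_0.
  assert (P := exp_pos (- mu * T)).
  assert (M2 : 0 < mu ^ 2) by (now apply pow_lt).
  assert (M3 : 0 < mu ^ 3) by (now apply pow_lt).
  assert (Q1 : 0 <= T ^ 2 / mu) by (apply Rdiv_le_0_compat; auto; apply pow2_ge_0).
  assert (Q2 : 0 <= 2 * T / mu ^ 2) by (apply Rdiv_le_0_compat; auto; lra).
  assert (Q3 : 0 <= 2 / mu ^ 3) by (apply Rdiv_le_0_compat; auto; lra).
  assert (Q4 : 0 <= e / mu) by (now apply Rdiv_le_0_compat).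
  assert (Q5 : 0 <= K * (T ^ 2 / mu + 2 * T / mu ^ 2 + 2 / mu ^ 3) * exp (- mu * T)).
  { repeat apply Rmult_le_pos; lra. }
  assert (Q6 : 0 <= e / mu * exp (- mu * T)) by (apply Rmult_le_pos; lra).
  replace (2 * K / mu ^ 3 + e / mu) with
    (K * (0 ^ 2 / mu + 2 * 0 / mu ^ 2 + 2 / mu ^ 3) + e / mu) by (field; lra).
  lra.
Qed.

(** A rate on a dense set of data suffices, since the Chernoff products and the
    semigroup have the same exponential bound. *)
Lemma chernoff_integral_lim (f g : UCb) (x : R) :
  G (f, lambda [*] f [-] g) ->
  (forall e, 0 < e -> exists p K, 0 <= K /\ vnorm (g [-] p) < e /\
     forall n t, (1 <= n)%nat -> 0 <= t ->
       vnorm (chernoff a b c n t p [-] V t p) <= t ^ 2 * exp (w * t) / INR n * K) ->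
  is_lim_seq
    (fun n => RInt_gen (phi n g x) (at_point 0) (Rbar_locally p_infty)) (f x).
Proof.
intros Hf Hdense; apply is_lim_seq_spec; intros eps; assert (Pe := cond_pos eps).
assert (He : 0 < eps * mu / 4)
  by (apply Rdiv_lt_0_compat; [now apply Rmult_lt_0_compat | lra]).
set (e := eps * mu / 4) in *.
destruct (Hdense (e / 2)) as (p & K & HK & Hpg & Hrate); [lra|].
assert (Hmu3 : 0 < mu ^ 3) by (now apply pow_lt).
assert (X : 0 <= 2 * K / mu ^ 3) by (apply Rdiv_le_0_compat; auto; lra).
destruct (small_factor (2 * K / mu ^ 3) (eps / 4)) as (d & Hd & Sm); [auto | lra |].
destruct (archimed_cor1 d Hd) as (N & HN1 & HN2).
exists N; intros n Hn; rewrite Rabs_minus_sym.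
assert (Hn1 : (1 <= n)%nat) by lia.
assert (Hn0 : 0 < INR n) by (apply lt_0_INR; lia).
apply Rle_lt_trans with (2 * (K / INR n) / mu ^ 3 + e / mu).
- apply chernoff_integral_error; auto; [now apply Rdiv_le_0_compat | lra |].
  intros t Ht; specialize (Hrate n t Hn1 Ht).
  assert (Q1 := chernoff_norm a b c n t (g [-] p) Ht Hn1).
  assert (Q2 := sg_norm w G V Hw HG HV (g [-] p) t Ht).
  assert (E1 : chernoff a b c n t (g [-] p)
               = chernoff a b c n t g [-] chernoff a b c n t p).
  { apply (linear_vminus (X := UCb_CompleteNormedModule) (chernoff a b c n t)).
    apply (iter_linear (X := UCb_CompleteNormedModule)), operS_linear. }
  assert (E2 : V t (g [-] p) = V t g [-] V t p).
  { apply (linear_vminus (X := UCb_CompleteNormedModule) (V t)).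
    exact (sg_linear G V HV t Ht). }
  rewrite E1 in Q1; rewrite E2 in Q2; fold w in Q1.
  replace (chernoff a b c n t g [-] V t g) with
    (chernoff a b c n t g [-] chernoff a b c n t p
     [+] (chernoff a b c n t p [-] V t p) [-] (V t g [-] V t p)) by module_eq.
  set (E := exp (w * t)) in *; assert (HE : 0 < E) by apply exp_pos.
  assert (Y : E * vnorm (g [-] p) <= E * (e / 2)) by (apply Rmult_le_compat_l; lra).
  apply Rle_trans with (1 := minus_bound _ _ _ _ (plus_bound _ _ _ _ Q1 Hrate) Q2).
  replace (E * (K / INR n * t ^ 2 + e)) with
    (E * (e / 2) + t ^ 2 * E / INR n * K + E * (e / 2)) by (field; lra).
  lra.
- assert (HnN : / INR n <= / INR N).
  { apply Rinv_le_contravar; [now apply lt_0_INR | now apply le_INR]. }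
  assert (Hi : 0 < / INR n) by (now apply Rinv_0_lt_compat).
  specialize (Sm (/ INR n) ltac:(lra)).
  replace (2 * (K / INR n) / mu ^ 3) with (2 * K / mu ^ 3 * / INR n) by (field; lra).
  replace (e / mu) with (eps / 4) by (unfold e; field; lra); lra.
Qed.

Lemma opgraph_solves (f g : UCb) : G (f, lambda [*] f [-] g) -> solves a b c lambda g f.
Proof.
intros (f1 & f2 & H1 & H2 & H3) x; simpl in H1, H2, H3.
assert (Q1 : forall y, Derive_n f 1 y = f1 y) by (intros y; apply is_derive_unique, H1).
assert (Q2 : Derive_n f 2 x = f2 x).
{ change (Derive (Derive_n f 1) x = f2 x).
  rewrite (Derive_ext _ _ x Q1); apply is_derive_unique, H2. }
split; [exists (f1 x); apply H1|]; split.
- change (ex_derive (Derive_n f 1) x); apply (ex_derive_ext f1);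
    [intros y; now rewrite Q1 | exists (f2 x); apply H2].
- rewrite Q1, Q2; specialize (H3 x); lra.
Qed.

Lemma solves_unique (f f' g : UCb) :
  solves a b c lambda g f -> solves a b c lambda g f' -> f = f'.
Proof.
intros H H'; apply norm_minus_eq_zero.
assert (N := vnorm_ge_0 (f [-] f')).
apply Rmult_le_reg_l with (lambda - vnorm c); [lra|]; rewrite Rmult_0_r.
apply (operator_dissipative a b c a0 Ha0 Ha lambda (f [-] f')
  (fun x => Derive_n f 1 x - Derive_n f' 1 x)
  (fun x => Derive_n f 2 x - Derive_n f' 2 x) 0 Hlam (Rle_refl 0)).
- intros x; destruct (H x) as (E1 & _ & _); destruct (H' x) as (E1' & _ & _).
  apply (is_derive_minus f f'); apply Derive_correct; [exact E1 | exact E1'].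
- intros x; destruct (H x) as (_ & E2 & _); destruct (H' x) as (_ & E2' & _).
  apply (is_derive_minus (Derive_n f 1) (Derive_n f' 1)); apply Derive_correct;
    [exact E2 | exact E2'].
- intros x; destruct (H x) as (_ & _ & E); destruct (H' x) as (_ & _ & E').
  change ((f [-] f') x) with (f x - f' x).
  replace (a x * (Derive_n f 2 x - Derive_n f' 2 x)
    + b x * (Derive_n f 1 x - Derive_n f' 1 x) + (c x - lambda) * (f x - f' x))
    with 0 by lra.
  rewrite Rabs_R0; lra.
Qed.

End Laplace_transform.

(** * The Chernoff approximation of the solution *)

Lemma inf_fun_ge (f : R -> R) (m x : R) :
  Rbar_le (Finite m) (inf_fun f) -> m <= f x.
Proof.
intros H; destruct (Glb_Rbar_correct (fun y => exists x : R, y = f x)) as [Hlb _].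
exact (Rbar_le_trans _ _ _ H (Hlb (f x) (ex_intro _ x eq_refl))).
Qed.

Lemma bounded_derivs_chain2 (f : UCb) : bounded_derivs 3 f ->
  exists f1 f2 : UCb, is_deriv f f1 /\ is_deriv f1 f2.
Proof.
intros Hf; destruct (bounded_derivs_UCb 2 f 1 Hf) as [f1 H1]; [lia|].
destruct (bounded_derivs_UCb 2 f 2 Hf) as [f2 H2]; [lia|].
exists f1, f2; split.
- apply (bounded_derivs_is_deriv 3 f f f1 0); auto; lia.
- apply (bounded_derivs_is_deriv 3 f f1 f2 1); auto; lia.
Qed.

Lemma vnorm_Derive_n (f g : UCb) (k : nat) :
  (forall x, g x = Derive_n f k x) -> sup_norm (Derive_n f k) = vnorm g.
Proof.
intros H; change (vnorm g) with (sup_norm g); f_equal.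
apply functional_extensionality; intros x; now rewrite H.
Qed.

Theorem theorem6 (a b c : UCb) (a0 lambda : R)
  (ha : bounded_derivs 3 a) (hb : bounded_derivs 3 b) (hc : bounded_derivs 3 c)
  (ha0 : 0 < a0) (hinf : Rbar_le (Finite a0) (inf_fun a))
  (hlambda : norm c < lambda) :
  (exists V : R -> UCb -> UCb, generates (closure_of (operA a b c)) V) /\
  forall V : R -> UCb -> UCb, generates (closure_of (operA a b c)) V ->
    (forall g : UCb, exists f : UCb,
       unique (solves a b c lambda g) f /\
       forall x : R,
         is_RInt_gen (fun t => exp (- lambda * t) * V t g x)
           (at_point 0) (Rbar_locally p_infty) (f x) /\
         (forall n : nat, (1 <= n)%nat ->
            ex_RInt_gen (fun t => exp (- lambda * t) * chernoff a b c n t g x)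
              (at_point 0) (Rbar_locally p_infty)) /\
         is_lim_seq
           (fun n => RInt_gen (fun t => exp (- lambda * t) * chernoff a b c n t g x)
                       (at_point 0) (Rbar_locally p_infty))
           (f x)) /\
    exists C0 C1 C2 C3 C4 : R,
      0 <= C0 /\ 0 <= C1 /\ 0 <= C2 /\ 0 <= C3 /\ 0 <= C4 /\
      forall g : UCb, bounded_derivs 5 g ->
        let Cg := C0 * norm g + C1 * sup_norm (Derive_n g 1)
                  + C2 * sup_norm (Derive_n g 2) + C3 * sup_norm (Derive_n g 3)
                  + C4 * sup_norm (Derive_n g 4) in
        (forall (t : R) (n : nat), 0 < t -> (1 <= n)%nat ->
           norm (minus (chernoff a b c n t g) (V t g))
             <= t ^ 2 * exp (norm c * t) / INR n * Cg) /\
        forall f : UCb, solves a b c lambda g f ->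
          (forall n : nat, (1 <= n)%nat ->
             Rbar_le
               (sup_abs (fun x => f x -
                  RInt_gen (fun t => exp (- lambda * t) * chernoff a b c n t g x)
                    (at_point 0) (Rbar_locally p_infty)))
               (Finite (2 * Cg / (INR n * (lambda - norm c) ^ 3)))) /\
          (forall eps : R, 0 < eps ->
             let T := Rmax 0 (1 / (lambda - norm c) *
                        ln (Rmax 2 (norm g) / ((lambda - norm c) * eps))) in
             forall n : nat, (1 <= n)%nat ->
               Rbar_le
                 (sup_abs (fun x => f x -
                    RInt (fun t => exp (- lambda * t) * chernoff a b c n t g x)
                      0 T))
                 (Finite (2 * Cg / (INR n * (lambda - norm c) ^ 3) + eps))).
Proof.
assert (Ha : forall x, a0 <= a x) by (intros x; now apply inf_fun_ge).
change (norm c) with (vnorm c) in *.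
assert (Hw : 0 <= vnorm c) by apply vnorm_ge_0.
assert (HG := operator_m_dissipative a b c a0 ha0 Ha).
assert (Hcl := closure_operA a b c a0 ha0 Ha).
destruct (bounded_derivs_chain2 a ha) as (a1 & a2 & Ha1 & Ha2).
destruct (bounded_derivs_chain2 b hb) as (b1 & b2 & Hb1 & Hb2).
destruct (bounded_derivs_chain2 c hc) as (c1 & c2 & Hc1 & Hc2).
split.
{ destruct (hille_yosida (vnorm c) (opgraph a b c) Hw HG) as [V HV]; exists V.
  apply generates_ext with (2 := HV); intros p; symmetry; apply Hcl. }
intros V HclV.
assert (HV : generates (opgraph a b c) V) by (apply generates_ext with (2 := HclV); auto).
clear HclV Hcl.
set (mu := lambda - vnorm c); assert (Hmu : 0 < mu) by (unfold mu; lra).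
destruct (chernoff_rate a b c a1 a2 b1 b2 c1 c2 a0 V ha0 Ha Ha1 Ha2 Hb1 Hb2 Hc1 Hc2 HV)
  as (R0 & HR0 & Hrate).
destruct (C4_opgraph2 a b c a1 a2 b1 b2 c1 c2 Ha1 Ha2 Hb1 Hb2 Hc1 Hc2)
  as (D & HD0 & HC4).
assert (Hres : forall g : UCb, exists f : UCb, opgraph a b c (f, lambda [*] f [-] g))
  by (intros g; now apply (md_range _ _ HG)).
split.
- intros g; destruct (Hres g) as [f Hf]; exists f; split.
  { split; [now apply opgraph_solves|]; intros f' Hf'.
    apply (solves_unique a b c a0 lambda ha0 Ha hlambda f f' g); auto.
    now apply opgraph_solves. }
  intros x; split; [|split].
  + now apply (resolvent_integral a b c a0 lambda V ha0 Ha HV hlambda f g x).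
  + intros n Hn; destruct (chernoff_integral a b c lambda hlambda n g x Hn) as (l & Hl & _).
    now exists l.
  + apply (chernoff_integral_lim a b c a0 lambda V ha0 Ha HV hlambda f g x Hf).
    intros e He; destruct (Ck_infty_dense g e He) as (p & Hp & Hpg).
    destruct (Hp 4%nat) as (p1 & P1 & p2 & P2 & p3 & P3 & p4 & P4 & _).
    destruct (HC4 p p1 p2 p3 p4 P1 P2 P3 P4) as (h & k & Hph & Hhk & _).
    exists p, (R0 * (vnorm p + vnorm h + vnorm k)).
    assert (N0 := vnorm_ge_0 p); assert (N1 := vnorm_ge_0 h);
    assert (N2 := vnorm_ge_0 k).
    split; [apply Rmult_le_pos; lra|]; rewrite norm_minus_sym; split; auto.
- set (C := R0 * D); assert (HC : 0 <= C) by (now apply Rmult_le_pos).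
  exists C, C, C, C, C; do 5 (split; [exact HC|]).
  intros g Hg Cg; change (norm g) with (vnorm g) in *.
  destruct (bounded_derivs_UCb 4 g 1 Hg) as [g1 E1]; [lia|].
  destruct (bounded_derivs_UCb 4 g 2 Hg) as [g2 E2]; [lia|].
  destruct (bounded_derivs_UCb 4 g 3 Hg) as [g3 E3]; [lia|].
  destruct (bounded_derivs_UCb 4 g 4 Hg) as [g4 E4]; [lia|].
  assert (D1 : is_deriv g g1)
    by (apply (bounded_derivs_is_deriv 5 g g g1 0); auto; lia).
  assert (D2 : is_deriv g1 g2)
    by (apply (bounded_derivs_is_deriv 5 g g1 g2 1); auto; lia).
  assert (D3 : is_deriv g2 g3)
    by (apply (bounded_derivs_is_deriv 5 g g2 g3 2); auto; lia).
  assert (D4 : is_deriv g3 g4)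
    by (apply (bounded_derivs_is_deriv 5 g g3 g4 3); auto; lia).
  destruct (HC4 g g1 g2 g3 g4 D1 D2 D3 D4) as (h & k & Hgh & Hhk & HS).
  assert (HCg : R0 * (vnorm g + vnorm h + vnorm k) <= Cg).
  { unfold Cg; rewrite (vnorm_Derive_n g g1 1 E1), (vnorm_Derive_n g g2 2 E2),
      (vnorm_Derive_n g g3 3 E3), (vnorm_Derive_n g g4 4 E4).
    apply Rmult_le_compat_l with (r := R0) in HS; auto.
    apply Rle_trans with (1 := HS); unfold C; right; ring. }
  assert (HCg0 : 0 <= Cg).
  { apply Rle_trans with (2 := HCg); apply Rmult_le_pos; auto.
    assert (N0 := vnorm_ge_0 g); assert (N1 := vnorm_ge_0 h);
    assert (N2 := vnorm_ge_0 k); lra. }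
  assert (Hrate' : forall t n, 0 <= t -> (1 <= n)%nat ->
    vnorm (chernoff a b c n t g [-] V t g) <= t ^ 2 * exp (vnorm c * t) / INR n * Cg).
  { intros t n Ht Hn; apply Rle_trans with (1 := Hrate g h k t n Hgh Hhk Ht Hn).
    apply Rmult_le_compat_l; auto; apply Rdiv_le_0_compat; [|apply lt_0_INR; lia].
    apply Rmult_le_pos; [apply pow2_ge_0 | left; apply exp_pos]. }
  split; [intros t n Ht Hn; apply Hrate'; auto; lra|].
  intros f Hf; destruct (Hres g) as [f' Hf'].
  assert (Eff : f = f').
  { apply (solves_unique a b c a0 lambda ha0 Ha hlambda f f' g); auto.
    now apply opgraph_solves. }
  subst f'; fold mu.
  assert (Herr : forall n x, (1 <= n)%nat ->
    Rabs (f x - RInt_gen (fun t => exp (- lambda * t) * chernoff a b c n t g x)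
                  (at_point 0) (Rbar_locally p_infty))
    <= 2 * Cg / (INR n * mu ^ 3)).
  { intros n x Hn; assert (Hn0 : 0 < INR n) by (apply lt_0_INR; lia).
    replace (2 * Cg / (INR n * mu ^ 3)) with (2 * (Cg / INR n) / mu ^ 3 + 0 / mu)
      by (field; lra).
    apply (chernoff_integral_error a b c a0 lambda V ha0 Ha HV hlambda n f g x); auto.
    - now apply Rdiv_le_0_compat.
    - lra.
    - intros t Ht; apply Rle_trans with (1 := Hrate' t n Ht Hn).
      right; field; lra. }
  split.
  + intros n Hn; apply sup_abs_le; intros x; now apply Herr.
  + intros eps He T n Hn; apply sup_abs_le; intros x.
    destruct (chernoff_integral a b c lambda hlambda n g x Hn) as (l & _ & El & Hl).
    specialize (Herr n x Hn); rewrite El in Herr.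
    assert (HT : 0 <= T) by apply Rmax_l.
    specialize (Hl T HT).
    assert (Ng := vnorm_ge_0 g).
    assert (Hm2 : 2 <= Rmax 2 (vnorm g)) by apply Rmax_l.
    assert (Hmg : vnorm g <= Rmax 2 (vnorm g)) by apply Rmax_r.
    set (m := Rmax 2 (vnorm g)) in *.
    assert (Hme : 0 < mu * eps) by (now apply Rmult_lt_0_compat).
    assert (Hq : 0 < m / (mu * eps)) by (apply Rdiv_lt_0_compat; lra).
    assert (HeT : exp (- mu * T) <= mu * eps / m).
    { apply Rle_trans with (exp (- ln (m / (mu * eps)))).
      - apply exp_le.
        assert (X : 1 / mu * ln (m / (mu * eps)) <= T) by apply Rmax_r.
        apply Rmult_le_compat_l with (r := mu) in X; [|lra].
        replace (mu * (1 / mu * ln (m / (mu * eps)))) with (ln (m / (mu * eps))) in X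
          by (field; lra); lra.
      - rewrite exp_Ropp, exp_ln by auto; right; field; lra. }
    assert (Htail : vnorm g / mu * exp (- mu * T) <= eps).
    { apply Rle_trans with (m / mu * (mu * eps / m)).
      - apply Rmult_le_compat; auto.
        + now apply Rdiv_le_0_compat.
        + left; apply exp_pos.
        + apply Rmult_le_compat_r; auto; left; now apply Rinv_0_lt_compat.
      - right; field; lra. }
    fold mu in Hl.
    replace (f x - RInt (fun t => exp (- lambda * t) * chernoff a b c n t g x) 0 T)
      with ((f x - l)
        + (l - RInt (fun t => exp (- lambda * t) * chernoff a b c n t g x) 0 T)) by ring.
    apply Rle_trans with (1 := Rabs_triang _ _); lra.
Qed.
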